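(* Let $N\ge1$. (1) Let $k,k'\in\mathbb Z$, $L,L'\in \mathrm M^T_N(\mathbb C)$. Any covariant differential operator of order $r$ from $|_{k,L}$ to $|_{k',L'}$ may be expressed as a linear combination of products of up to $r$ raising and lowering operators. There is a unique such expression in which the raising operators are all to the left of the lowering operators. (2) Let $k\in\mathbb Z$ and let $L\in \mathrm M^T_N(\mathbb C)$ be invertible. The expression of this form for the Casimir operator $\mathcal C^{k,L}$ is $$\begin{aligned}\mathcal C^{k,L}=&-2X_+X_-+i\bigl(X_+\,\mathcal L^{-1}[Y_-]-\mathcal L^{-1}[Y_+]\,X_-\bigr)\\&-\tfrac12\bigl(\mathcal L^{-1}[Y_+]\,\mathcal L^{-1}[Y_-]-Y_+^T(Y_+^T\mathcal L^{-1}Y_-)\mathcal L^{-1}Y_-\bigr)-\tfrac12(2k-N-3)\,i\,Y_+^T\mathcal L^{-1}Y_-.\end{aligned}$$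
   Context: Notation. $\mathrm M_{m,n}(R)$: $m\times n$ matrices; $\mathrm M_N=\mathrm M_{N,N}$; $\mathrm M^T_N$: symmetric $N\times N$ matrices. $J_2=\begin{pmatrix}0&-1\\1&0\end{pmatrix}$. $A[w]=w^TAw$. $\mathbb H_{1,N}=\mathbb H\times\mathbb C^N$ ($\mathbb H$ the upper half plane) with coordinates $\tau=x+iy$, $z=u+iv$ (column vectors). $\partial_z,\partial_{\bar z},\partial_u$ are column vectors of partial derivatives. $\mathcal L=2\pi iL$. Group and slash action. $\tilde G^J_N=\{(M,X,\kappa): M\in \mathrm{SL}_2(\mathbb R),X\in \mathrm M_{N,2}(\mathbb R),\kappa\in \mathrm M_N(\mathbb R),\ \kappa+\frac12XJ_2X^T\in \mathrm M^T_N(\mathbb R)\}$ with product $(M,X,\kappa)(\check M,\check X,\check\kappa)=(M\check M,X\check M+\check X,\kappa+\check\kappa-X\check MJ_2\check X^T)$. For $M=\begin{pmatrix}a&b\\c&d\end{pmatrix}$, $\beta(M,\tau)=(c\tau+d)^{-1}$; $X_1,X_2$ are the columns of $X$; $(M,X,\kappa)(\tau,z)=\bigl(\frac{a\tau+b}{c\tau+d},\beta(M,\tau)(z+X_1\tau+X_2)\bigr)$. For $L\in \mathrm M^T_N(\mathbb C)$, $\alpha_L((M,X,\kappa),(\tau,z))=\exp\{2\pi i\,\mathrm{tr}[LA]\}$ with $A=\kappa+X_2X_1^T+X_1z^T+zX_1^T+X_1X_1^T\tau-c\,\beta(M,\tau)(z+X_1\tau+X_2)(z+X_1\tau+X_2)^T$.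 For $g=(M,X,\kappa)$, $(\phi|_{k,L}[g])(\tau,z)=\beta(M,\tau)^k\alpha_L(g,(\tau,z))\phi(g(\tau,z))$ on $C^\infty(\mathbb H_{1,N})$. A differential operator $T$ on $\mathbb H_{1,N}$ is covariant from $|_{k,L}$ to $|_{k',L'}$ if $T(f|_{k,L}[g])=(Tf)|_{k',L'}[g]$ for all $g\in\tilde G^J_N$ and $f\in C^\infty(\mathbb H_{1,N})$. Lowering operators $X_-,Y_-$ and raising operators $X_+,Y_+$: $$X_-^{k,L}=-2iy(y\,\partial_{\bar\tau}+v^T\partial_{\bar z}),\quad X_+^{k,L}=2i(\partial_\tau+y^{-1}v^T\partial_z+y^{-2}\mathcal L[v])+ky^{-1},$$ $$Y_-^{k,L}=-iy\,\partial_{\bar z},\qquad Y_+^{k,L}=i\partial_z+2iy^{-1}\mathcal Lv.$$ $Y_\pm^{k,L}$ are $N$-vectors of operators with entries $Y_{\pm,j}^{k,L}$; the entries count as individual raising/lowering operators. $X_\pm^{k,L}$ is covariant from $|_{k,L}$ to $|_{k\pm2,L}$ and $Y_{\pm,j}^{k,L}$ from $|_{k,L}$ to $|_{k\pm1,L}$. In products the superscripts are suppressed and are to be supplied so that the product is defined, starting from weight $k$ at the right, e.g. $X_+Y_{+,j}$ means $X_+^{k+1,L}Y_{+,j}^{k,L}$. The raising operators commute with one another, as do the lowering operators, and uniqueness is understood up to reordering of these commuting factors. $Y_+^T(Y_+^T\mathcal L^{-1}Y_-)\mathcal L^{-1}Y_-$ means $\sum Y_{+,a}Y_{+,b}(\mathcal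 L^{-1})_{bc}(\mathcal L^{-1})_{ad}Y_{-,c}Y_{-,d}$. Casimir operator (coefficient functions left of derivatives), with $\Delta_\kappa=4y^2\partial_\tau\partial_{\bar\tau}-2i\kappa y\,\partial_{\bar\tau}$: $$\begin{aligned}\mathcal C^{k,L}=&-2\Delta_{k-N/2}+2y^2\bigl(\partial_{\bar\tau}\mathcal L^{-1}[\partial_z]+\partial_\tau\mathcal L^{-1}[\partial_{\bar z}]\bigr)-8y\,\partial_\tau v^T\partial_{\bar z}\\&-\tfrac12y^2\bigl(\mathcal L^{-1}[\partial_{\bar z}]\mathcal L^{-1}[\partial_z]-(\partial_{\bar z}^T\mathcal L^{-1}\partial_z)^2\bigr)+2y(v^T\partial_{\bar z})\partial_z^T\mathcal L^{-1}\partial_u\\&-\tfrac12(2k-N+1)iy\,\partial_{\bar z}^T\mathcal L^{-1}\partial_u+2v^T(v^T\partial_{\bar z})\partial_{\bar z}+(2k-N-1)iv^T\partial_{\bar z}.\end{aligned}$$ *)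

(* Defs.v *)
From HB Require Import structures.
From mathcomp Require Import all_boot all_order all_algebra.
From mathcomp Require Import all_classical all_reals all_analysis.
From mathcomp Require Import complex.
Set Implicit Arguments.
Unset Strict Implicit.
Unset Printing Implicit Defensive.
Import Order.TTheory GRing.Theory Num.Theory.
Import numFieldNormedType.Exports.
Local Open Scope classical_set_scope.
Local Open Scope ring_scope.
Local Open Scope complex_scope.

Section MultiIndex.
Variables (I : finType) (r : nat).

(* Multi-indices with entries at most r. *)
Definition expo := {ffun I -> 'I_r.+1}.

Definition expo_deg (m : expo) : nat := (\sum_(i : I) m i)%N.

Definition expo_word (m : expo) : seq I :=
  flatten [seq nseq (m i) i | i <- enum I].

End MultiIndex.

Section JacobiHalfSpace.
Variables (R : realType) (N : nat).
Local Notation C := R[i].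
Local Notation iC := (Complex (0 : R) 1).
Local Notation cmx := (map_mx (real_complex R)).

(* A point (tau, z) of C x C^N in real coordinates: row 0 is (Re tau, Im tau),
   row 1 + j is (Re z_j, Im z_j).  Functions on the open set [halfspace] are
   represented by total functions on [pt]; only their values on [halfspace] are
   ever constrained or compared. *)
Definition pt := 'M[R]_(1 + N, 2).

Definition yc (p : pt) : R := p ord0 1.
Definition tau (p : pt) : C := p ord0 0 +i* p ord0 1.
Definition zv (p : pt) : 'cV[C]_N :=
  \col_j (p (rshift 1 j) 0 +i* p (rshift 1 j) 1).
Definition vv (p : pt) : 'cV[R]_N := \col_j p (rshift 1 j) 1.

Definition mkpt (t : C) (z : 'cV[C]_N) : pt :=
  \matrix_(i, j) let c := col_mx t%:M z i 0 in
    if j == 0 then complex.Re c else complex.Im c.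

Definition halfspace : set pt := [set p | 0 < yc p].

Definition op := (pt -> C) -> pt -> C.

(* [(i, 0)] is the real part, [(i, 1)] the imaginary part of the i-th complex
   coordinate. *)
Definition dir : finType := ('I_(1 + N) * 'I_2)%type.

Definition pd (d : dir) : op := fun f p =>
  'D_(delta_mx d.1 d.2) (fun q => complex.Re (f q)) p
  +i* 'D_(delta_mx d.1 d.2) (fun q => complex.Im (f q)) p.

Definition iter_pd (w : seq dir) : op := fun f => foldr pd f w.

(* C^oo : all iterated partial derivatives exist and are continuous. *)
Definition smooth (f : pt -> C) : Prop :=
  forall (w : seq dir) (p : pt), halfspace p ->
  let re := fun q => complex.Re (iter_pd w f q) in
  let im := fun q => complex.Im (iter_pd w f q) in
  [/\ {for p, continuous re}, {for p, continuous im}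
    & forall d : dir,
        derivable re p (delta_mx d.1 d.2) /\ derivable im p (delta_mx d.1 d.2)].

Definition opeq (T U : op) : Prop :=
  forall f, smooth f -> forall p, halfspace p -> T f p = U f p.

(* Differential operators of order (at most) r with smooth coefficients. *)
Definition diffop (r : nat) (T : op) : Prop :=
  exists a : expo dir r -> pt -> C, (forall m, smooth (a m)) /\
  opeq T (fun f p => \sum_(m : expo dir r | (expo_deg m <= r)%N)
                       a m p * iter_pd (expo_word m) f p).

Definition wirt (i : 'I_(1 + N)) : op := fun f p =>
  2^-1 * (pd (i, 0) f p - iC * pd (i, 1) f p).
Definition wirtb (i : 'I_(1 + N)) : op := fun f p =>
  2^-1 * (pd (i, 0) f p + iC * pd (i, 1) f p).

Definition dtau : op := wirt ord0.
Definition dtaub : op := wirtb ord0.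
Definition dz (j : 'I_N) : op := wirt (rshift 1 j).
Definition dzb (j : 'I_N) : op := wirtb (rshift 1 j).
Definition du (j : 'I_N) : op := pd (rshift 1 j, 0).

Definition J2 : 'M[R]_2 := \matrix_(i, j) ((j < i)%N%:R - (i < j)%N%:R).

Record jacobi := Jacobi {
  jM : 'M[R]_2;
  jX : 'M[R]_(N, 2);
  jk : 'M[R]_N;
  jM_det : \det jM = 1;
  jk_sym : let S := jk + 2^-1 *: (jX *m J2 *m jX^T) in S^T = S }.

Definition cexp (z : C) : C :=
  (expR (complex.Re z))%:C * (cos (complex.Im z) +i* sin (complex.Im z)).

Definition beta (M : 'M[R]_2) (t : C) : C := ((M 1 0)%:C * t + (M 1 1)%:C)^-1.

Definition jshift (g : jacobi) (p : pt) : 'cV[C]_N :=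
  zv p + tau p *: cmx (col 0 (jX g)) + cmx (col 1 (jX g)).

Definition act (g : jacobi) (p : pt) : pt :=
  let b := beta (jM g) (tau p) in
  mkpt (((jM g 0 0)%:C * tau p + (jM g 0 1)%:C) * b) (b *: jshift g p).

Definition alpha (L : 'M[C]_N) (g : jacobi) (p : pt) : C :=
  let X1 := cmx (col 0 (jX g)) in
  let X2 := cmx (col 1 (jX g)) in
  let A := cmx (jk g) + X2 *m X1^T + X1 *m (zv p)^T + zv p *m X1^T
           + tau p *: (X1 *m X1^T)
           - ((jM g 1 0)%:C * beta (jM g) (tau p))
               *: (jshift g p *m (jshift g p)^T) in
  cexp (2 * pi%:C * iC * \tr (L *m A)).

Definition slash (k : int) (L : 'M[C]_N) (g : jacobi) : op := fun f p =>
  beta (jM g) (tau p) ^ k * alpha L g p * f (act g p).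

Definition covariant (k : int) (L : 'M[C]_N) (k' : int) (L' : 'M[C]_N)
    (T : op) : Prop :=
  forall g : jacobi,
    opeq (fun f => T (slash k L g f)) (fun f => slash k' L' g (T f)).

Definition calL (L : 'M[C]_N) : 'M[C]_N := (2 * pi%:C * iC) *: L.

(* v^T P and P^T A Q for column vectors P, Q of operators. *)
Definition vdot (P : 'I_N -> op) : op := fun f p =>
  \sum_j (vv p j 0)%:C * P j f p.
Definition bil (P : 'I_N -> op) (A : 'M[C]_N) (Q : 'I_N -> op) : op :=
  fun f p => \sum_a \sum_b A a b * P a (Q b f) p.

Definition Xm : op := fun f p =>
  - (2 * iC * (yc p)%:C) * ((yc p)%:C * dtaub f p + vdot dzb f p).
Definition Ym (j : 'I_N) : op := fun f p => - (iC * (yc p)%:C) * dzb j f p.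
Definition Xp (k : int) (L : 'M[C]_N) : op := fun f p =>
  let v := cmx (vv p) in
  2 * iC * (dtau f p + (yc p)%:C^-1 * vdot dz f p
            + (yc p)%:C ^- 2 * (v^T *m calL L *m v) 0 0 * f p)
  + k%:~R * (yc p)%:C^-1 * f p.
Definition Yp (L : 'M[C]_N) (j : 'I_N) : op := fun f p =>
  iC * dz j f p
  + 2 * iC * (yc p)%:C^-1 * (calL L *m cmx (vv p)) j 0 * f p.

(* [None] stands for X, [Some j] for Y_j. *)
Definition gen : finType := option 'I_N.

Inductive letter := Raise of gen | Lower of gen.

Definition letter_wt (a : letter) : int :=
  match a with
  | Raise None => 2
  | Raise (Some _) => 1
  | Lower None => - 2%:Z
  | Lower (Some _) => - 1%:Z
  end.

Definition word_wt (w : seq letter) : int := \sum_(a <- w) letter_wt a.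

Definition letter_op (k : int) (L : 'M[C]_N) (a : letter) : op :=
  match a with
  | Raise None => Xp k L
  | Raise (Some j) => Yp L j
  | Lower None => Xm
  | Lower (Some j) => Ym j
  end.

(* The product of the letters of w, starting from weight k at the right. *)
Fixpoint word_op (k : int) (L : 'M[C]_N) (w : seq letter) : op :=
  if w is a :: w' then
    fun f => letter_op (k + word_wt w') L a (word_op k L w' f)
  else id.

Definition lincomb_words (k : int) (L : 'M[C]_N) (s : seq (C * seq letter)) :
    op :=
  fun f p => \sum_(t <- s) t.1 * word_op k L t.2 f p.

(* Normally ordered monomials: exponents of the raising and of the lowering
   operators.  As the operators of each kind commute, [expo_word] only fixes a
   representative of the monomial up to reordering. *)
Definition nexpo (r : nat) : finType := (expo gen r * expo gen r)%type.

Definition nexpo_deg (r : nat) (m : nexpo r) : nat :=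
  (expo_deg m.1 + expo_deg m.2)%N.

Definition nexpo_word (r : nat) (m : nexpo r) : seq letter :=
  map Raise (expo_word m.1) ++ map Lower (expo_word m.2).

Definition normal_expression (k : int) (L : 'M[C]_N) (r : nat) (T : op)
    (c : {ffun nexpo r -> C}) : Prop :=
  (forall m, (r < nexpo_deg m)%N -> c m = 0) /\
  opeq T (fun f p => \sum_(m : nexpo r) c m * word_op k L (nexpo_word m) f p).

Definition Delta (kappa : C) : op := fun f p =>
  4 * (yc p)%:C ^+ 2 * dtau (dtaub f) p
  - 2 * iC * kappa * (yc p)%:C * dtaub f p.

Definition casimir (k : int) (L : 'M[C]_N) : op := fun f p =>
  let y := (yc p)%:C in
  let v j := (vv p j 0)%:C in
  let K : C := k%:~R in
  let n : C := N%:R in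
  let Li := invmx (calL L) in
  - 2 * Delta (K - n / 2) f p
  + 2 * y ^+ 2 * (dtaub (bil dz Li dz f) p + dtau (bil dzb Li dzb f) p)
  - 8 * y * \sum_j v j * dtau (dzb j f) p
  - 2^-1 * y ^+ 2 * (bil dzb Li dzb (bil dz Li dz f) p
                     - bil dzb Li dz (bil dzb Li dz f) p)
  + 2 * y * vdot dzb (bil dz Li du f) p
  - 2^-1 * (2 * K - n + 1) * iC * y * bil dzb Li du f p
  + 2 * \sum_a \sum_b v a * v b * dzb b (dzb a f) p
  + (2 * K - n - 1) * iC * vdot dzb f p.

Definition casimir_expression (k : int) (L : 'M[C]_N) : op := fun f p =>
  let K : C := k%:~R in
  let n : C := N%:R in
  let Li := invmx (calL L) in
  let W w := word_op k L w f p in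
  let X_ := Lower None in
  let Y_ j := Lower (Some j) in
  let X' := Raise None in
  let Y' j := Raise (Some j) in
  - 2 * W [:: X'; X_]
  + iC * (\sum_a \sum_b Li a b * W [:: X'; Y_ a; Y_ b]
          - \sum_a \sum_b Li a b * W [:: Y' a; Y' b; X_])
  - 2^-1 *
    (\sum_a \sum_b \sum_c \sum_d
        Li a b * Li c d * W [:: Y' a; Y' b; Y_ c; Y_ d]
     - \sum_a \sum_b \sum_c \sum_d
        Li b c * Li a d * W [:: Y' a; Y' b; Y_ c; Y_ d])
  - 2^-1 * (2 * K - n - 3) * iC * \sum_a \sum_b Li a b * W [:: Y' a; Y_ b].

End JacobiHalfSpace.

(* Main.v *)
From HB Require Import structures.
Require Import Defs.
From mathcomp Require Import all_boot all_order all_algebra.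
From mathcomp Require Import all_classical all_reals all_analysis.
From mathcomp Require Import complex.
From mathcomp Require Import ring lra zify.
Set Implicit Arguments.
Unset Strict Implicit.
Unset Printing Implicit Defensive.
Import Order.TTheory GRing.Theory Num.Theory.
Import numFieldNormedType.Exports.
Local Open Scope classical_set_scope.
Local Open Scope ring_scope.
Local Open Scope complex_scope.

(** Part (2) is an identity between explicit operators.  Every contracted product
    of raising and lowering operators in the expression is evaluated on a smooth
    function as a combination of a few operators built from the Wirtinger
    derivatives, the Euler-type operators v^T d/dz and v^T d/dzbar, and
    contractions of gradients with the inverse of 2 pi i L.  The computation
    closes because the zero-order term of Y_+ contains 2 pi i L, which cancels
    against its inverse ([qf_Li]), and because these operators satisfy simple
    commutation rules ([Bil_Vd], [wz_Vdr]).  Comparing the results ([word_XX] to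
    [word_YYYY2]) with the Casimir operator gives [casimirE].

    Part (1) rests on three facts about the products of letters (words) in which
    raising operators stand to the left of lowering ones.

    Words are covariant ([word_slash]).  The group acts by holomorphic maps with a
    holomorphic multiplier whose logarithmic derivatives are expressed through the
    single vector omega = X_1 - c beta zeta; the same vector describes how v / y
    is translated, so the zero-order terms of the raising operators compensate
    the derivatives of the multiplier.

    Normal words are linearly independent at every point ([words_free]).  On the
    function exp(sum_i lambda^(e_i) z_i + lambda^(e'_i) zbar_i), with exponents
    that are distinct powers of a base B > r + 1, a word acts as multiplication by
    a polynomial in lambda of exact degree the sum of the exponents of its
    letters.  By uniqueness of expansions in base B different normal words have
    different degrees, so no nontrivial combination vanishes.

    Normal words span at every point ([exists_words]).  Normal words of length at
    most r and partial derivatives of order at most r are both indexed by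
    multi-indices of degree at most r in 2N + 2 letters, and a square matrix with
    independent rows is invertible.

    Given a covariant operator T, its coefficients at the base point (i, 0) are
    obtained from the spanning property.  The stabilizer of the base point
    contains the rotations, which multiply a word of weight w by the w-th power of
    a unit complex number; independence therefore leaves only words of weight
    k' - k.  If T is nonzero, the central elements force L = L'.  So T and the
    combination of words are covariant for the same data, agree at the base point,
    and agree everywhere since the group acts transitively
    ([covariant_normal_form]).  Uniqueness is independence again.

    Smoothness is given by iterated partial derivatives in the real coordinates,
    so the chain rule and the symmetry of second derivatives are first derived
    from the mean value theorem. *)

(** * Symmetry of second directional derivatives *)

Section LineDerivatives.
Variables (R : realType) (V : normedModType R).
Implicit Types (f : V -> R) (a v w : V).

Lemma is_derive_line f a v (t : R) : derivable f (a + t *: v) v ->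
  is_derive t (1 : R) (fun s : R => f (a + s *: v)) ('D_v f (a + t *: v)).
Proof.
move=> df; have E : (fun h : R => h^-1 *: (f (h *: v + (a + t *: v)) - f (a + t *: v))) =
   (fun h : R => h^-1 *: (f (a + (h *: (1:R) + t) *: v) - f (a + t *: v))).
  apply/funext => h; congr (_ *: (f _ - _)).
  by rewrite [h *: 1]mulr1 scalerDl addrCA.
apply: DeriveDef; first by move: df; rewrite /derivable E.
by rewrite /derive E.
Qed.

Lemma MVT_line f a v (t : R) :
  (forall s, `|s| <= `|t| -> derivable f (a + s *: v) v) ->
  exists2 s, `|s| <= `|t| & f (a + t *: v) - f a = t * 'D_v f (a + s *: v).
Proof.
move=> df.
pose g s := f (a + s *: v); pose dg s := 'D_v f (a + s *: v).
have dgP s : `|s| <= `|t| -> is_derive s (1 : R) g (dg s).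
  by move=> st; exact/is_derive_line/df.
have cg (I : interval R) : (forall s, s \in I -> `|s| <= `|t|) ->
    {within [set` I], continuous g}.
  move=> sI; apply: derivable_within_continuous => s /sI st.
  by have [] := dgP s st.
have g0 : g 0 = f a by rewrite /g scale0r addr0.
have [t0|t0] := leP 0 t.
  have sub s : s \in `[0, t]%R -> `|s| <= `|t|.
    by rewrite in_itv /= => /andP[s0 st]; rewrite !ger0_norm.
  have [|s sI E] := @MVT_segment R g dg 0 t t0 _ (cg _ sub).
    by move=> s /subset_itv_oo_cc sI; apply: dgP; apply: sub.
  by exists s; [exact: sub | rewrite -g0 E subr0 mulrC].
have sub s : s \in `[t, 0]%R -> `|s| <= `|t|.
  by rewrite in_itv /= => /andP[ts s0]; rewrite !ler0_norm ?lerN2 // ltW.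
have [|s sI E] := @MVT_segment R g dg t 0 (ltW t0) _ (cg _ sub).
  by move=> s /subset_itv_oo_cc sI; apply: dgP; apply: sub.
exists s; first exact: sub.
by rewrite -g0 -[LHS]opprB -/(g t) E sub0r mulrN opprK mulrC.
Qed.

(** Two applications of the mean value theorem: along [v] to the difference
    x |-> f (x + tw) - f x, then along [w] to the derivative of [f] along [v]. *)
Lemma second_difference_MVT f a v w (t : R) :
  (forall x y, `|x| <= `|t| -> `|y| <= `|t| ->
    derivable f (a + x *: v + y *: w) v /\ derivable ('D_v f) (a + x *: v + y *: w) w) ->
  exists x y, [/\ `|x| <= `|t|, `|y| <= `|t| &
    f (a + t *: v + t *: w) - f (a + t *: v) - (f (a + t *: w) - f a)
    = t * (t * 'D_w ('D_v f) (a + x *: v + y *: w))].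
Proof.
move=> df; have tt : `|t| <= `|t| by [].
have z0 : `|0 : R| <= `|t| by rewrite normr0.
pose h q := f (q + t *: w) - f q.
have dh x : `|x| <= `|t| -> is_derive (a + x *: v) v h
    ('D_v f (a + x *: v + t *: w) - 'D_v f (a + x *: v)).
  move=> xt; apply: is_deriveB.
    have [d _] := df _ _ xt tt.
    have E : (fun s : R => s^-1 *: (f (s *: v + (a + x *: v + t *: w)) -
         f (a + x *: v + t *: w))) =
       (fun s : R => s^-1 *: (f (s *: v + (a + x *: v) + t *: w) -
         f (a + x *: v + t *: w))).
      by apply/funext => s; rewrite !addrA.
    apply: DeriveDef; first by move: d; rewrite /derivable E.
    by rewrite /derive E.
  apply: derivableP.
  by have [] := df _ _ xt z0; rewrite scale0r addr0.
have [x xt Ex] : exists2 x, `|x| <= `|t| & h (a + t *: v) - h a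
    = t * ('D_v f (a + x *: v + t *: w) - 'D_v f (a + x *: v)).
  have [x|x xt E] := @MVT_line h a v t; first by move=> xt; have [] := dh _ xt.
  by exists x => //; rewrite E; congr (_ * _); have [_] := dh _ xt.
have [y yt Ey] := @MVT_line ('D_v f) (a + x *: v) w t (fun s st => (df _ _ xt st).2).
by exists x, y; split=> //; rewrite -[LHS]/(h (a + t *: v) - h a) Ex Ey.
Qed.

(** Schwarz: the second difference over the parallelogram spanned by tv and tw is
    symmetric in [v] and [w], so [second_difference_MVT] equates values of the
    two mixed derivatives at two points near [a]; continuity of both lets these
    points tend to [a]. *)
Lemma derive_swap f a v w :
  (\forall q \near a, derivable f q v /\ derivable f q w) ->
  (\forall q \near a, derivable ('D_v f) q w /\ derivable ('D_w f) q v) ->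
  {for a, continuous ('D_w ('D_v f))} -> {for a, continuous ('D_v ('D_w f))} ->
  'D_w ('D_v f) a = 'D_v ('D_w f) a.
Proof.
move=> d1 d2 c1 c2; apply/eqP; rewrite -subr_eq0 -normr_le0.
apply/ler_addgt0Pl => e e0; rewrite addr0.
have e2 : 0 < e / 2 by rewrite divr_gt0.
have /nbhs_ballP[r /= r0 rP] : \forall q \near a,
    (derivable f q v /\ derivable f q w) /\
    (derivable ('D_v f) q w /\ derivable ('D_w f) q v) /\
    `|'D_w ('D_v f) a - 'D_w ('D_v f) q| < e / 2 /\
    `|'D_v ('D_w f) a - 'D_v ('D_w f) q| < e / 2.
  apply: filterI d1 _; apply: filterI d2 _; apply: filterI.
    by move/cvgrPdist_lt: c1; exact.
  by move/cvgrPdist_lt: c2; exact.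
pose M := `|v| + `|w| + 1.
have M0 : 0 < M by rewrite /M; have := normr_ge0 v; have := normr_ge0 w; lra.
(* Small enough for the whole parallelogram to stay in the ball of radius r. *)
pose t := r / 2 / M.
have t0 : 0 < t by rewrite !divr_gt0.
have inB x y : `|x| <= `|t| -> `|y| <= `|t| -> ball a r (a + x *: v + y *: w).
  rewrite (gtr0_norm t0) => xt yt; rewrite -ball_normE /ball_ /=.
  rewrite opprD opprD !addrA subrr sub0r -opprD normrN.
  have tM : t * M = r / 2 by rewrite /t mulfVK // gt_eqF.
  apply: le_lt_trans (ler_normD _ _) _; rewrite !normrZ.
  have := ler_wpM2r (normr_ge0 v) xt; have := ler_wpM2r (normr_ge0 w) yt.
  by move: tM; rewrite /M; nra.
have [x1 [y1 [hx1 hy1 E1]]] : exists x y, [/\ `|x| <= `|t|, `|y| <= `|t| & _] :=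
  second_difference_MVT (fun x y hx hy => conj (rP _ (inB x y hx hy)).1.1 (rP _ (inB x y hx hy)).2.1.1).
have [y2 [x2 [hy2 hx2 E2]]] : exists y x, [/\ `|y| <= `|t|, `|x| <= `|t| &
    f (a + t *: w + t *: v) - f (a + t *: w) - (f (a + t *: v) - f a)
    = t * (t * 'D_v ('D_w f) (a + y *: w + x *: v))].
  apply: second_difference_MVT => y x hy hx; rewrite (addrAC a).
  by have [[_ d] [[_ d'] _]] := rP _ (inB x y hx hy).
have [_ [_ [B1 _]]] := rP _ (inB _ _ hx1 hy1).
have [_ [_ [_ B2]]] := rP _ (inB _ _ hx2 hy2).
have EE : 'D_w ('D_v f) (a + x1 *: v + y1 *: w) =
    'D_v ('D_w f) (a + x2 *: v + y2 *: w).
  apply: (mulfI (lt0r_neq0 t0)); apply: (mulfI (lt0r_neq0 t0)).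
  rewrite (addrAC a (x2 *: v)); apply: etrans (esym E1) (etrans _ E2).
  rewrite (addrAC a (t *: w)).
  by move: (f _) (f (a + t *: v)) (f (a + t *: w)) (f a) => *; ring.
rewrite -EE in B2.
rewrite distrC in B2.
apply: ltW; rewrite [ltRHS]splitr.
apply: le_lt_trans (ltrD B1 B2).
by apply: le_trans (ler_normD _ _); rewrite addrA subrK.
Qed.

End LineDerivatives.

(** * Continuously differentiable functions of a matrix *)

Lemma derive_along_line (R : realType) (U W : normedModType R) (G : U -> W) x v :
  'D_v G x = 'D_1 (fun t : R => G (t *: v + x)) 0.
Proof.
rewrite /derive; set g1 := fun h => h^-1 *: _; set g2 := fun h => h^-1 *: _.
suff -> : g1 = g2 by [].
by rewrite funeqE /g1 /g2 => h /=; rewrite addr0 scale0r add0r [_%:A]mulr1.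
Qed.

Section MatrixC1.
Variables (R : realType) (m n : nat).
Local Notation V := 'M[R]_(m, n).
Local Notation ix := ('I_m * 'I_n)%type.
Local Notation e d := (delta_mx d.1 d.2 : V).
Implicit Types (f : V -> R) (p q h : V).

Lemma le_coord_norm h (d : ix) : `|h d.1 d.2| <= `|h|.
Proof. by rewrite [leRHS]/Num.Def.normr/= mx_normrE; apply: (le_bigmax _ (fun ij : ix => `|h ij.1 ij.2|)). Qed.

Lemma norm_delta_le1 (d : ix) : `|e d| <= 1 :> R.
Proof.
rewrite [leLHS]/Num.Def.normr/= mx_normrE; apply: bigmax_le => // i _.
by rewrite mxE; case: (_ && _); rewrite ?normr1 ?normr0.
Qed.

Lemma matrix_sum_delta_pair h : h = \sum_(d : ix) h d.1 d.2 *: e d.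
Proof. by rewrite [LHS]matrix_sum_delta (pair_bigA _ (fun i j => h i j *: delta_mx i j)). Qed.

Lemma norm_partial_sum_le h (s : seq ix) :
  `|\sum_(d <- s) h d.1 d.2 *: e d| <= (size s)%:R * `|h|.
Proof.
elim: s => [|d s IH]; first by rewrite big_nil normr0 mul0r.
rewrite big_cons /= -nat1r mulrDl mul1r; apply: le_trans (ler_normD _ _) _.
apply: lerD IH; rewrite normrZ -[leRHS]mulr1.
by apply: ler_pM => //; [exact: le_coord_norm | exact: norm_delta_le1].
Qed.

(** The increment is split coordinate by coordinate along [s], and each partial
    increment is a partial derivative at a point close to [p] by the mean value
    theorem; stating it for every list [s] of coordinates makes it an
    induction. *)
Lemma C1_linear_approx f p (s : seq ix) (eps : R) : 0 < eps ->
  (forall d, \forall q \near p, derivable f q (e d)) ->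
  (forall d, {for p, continuous ('D_(e d) f)}) ->
  exists2 r : R, 0 < r & forall h, `|h| < r ->
   `|f (p + \sum_(d <- s) h d.1 d.2 *: e d) - f p
      - \sum_(d <- s) h d.1 d.2 * 'D_(e d) f p| <= eps * (size s)%:R * `|h|.
Proof.
move=> eps0 df cf; elim: s => [|d s [r r0 IH]].
  by exists 1 => // h _; rewrite !big_nil addr0 !subrr normr0 mulr0 mul0r.
have /nbhs_ballP[r2 /= r20 rP] : \forall q \near p,
    derivable f q (e d) /\ `|'D_(e d) f p - 'D_(e d) f q| < eps.
  apply: filterI (df d) _; have /cvgrPdist_lt := cf d; exact.
pose M : R := (size s).+1%:R.
have M0 : 0 < M by rewrite ltr0n.
exists (Num.min r (r2 / M)); first by rewrite lt_min r0 divr_gt0.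
move=> h; rewrite lt_min => /andP[hr hr2].
have {}IH := IH h hr.
set a := p + _ in IH.
have hd : `|h d.1 d.2| <= `|h| := le_coord_norm h d.
have inB x : `|x| <= `|h d.1 d.2| -> ball p r2 (a + x *: e d).
  move=> xh; rewrite -ball_normE /ball_ /= /a -addrA opprD addrA subrr sub0r normrN.
  apply: (@le_lt_trans _ _ (M * `|h|)); last by rewrite mulrC -ltr_pdivlMr.
  apply: le_trans (ler_normD _ _) _; rewrite /M -natr1 mulrDl mul1r lerD //.
    exact: norm_partial_sum_le.
  rewrite normrZ -[leRHS]mulr1; apply: ler_pM => //; last exact: norm_delta_le1.
  exact: le_trans xh hd.
have [x xh E] := @MVT_line R V f a (e d) (h d.1 d.2) (fun y yh => (rP _ (inB y yh)).1).
have [_ B] := rP _ (inB x xh).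
rewrite !big_cons /=.
have -> : p + (h d.1 d.2 *: e d + \sum_(j <- s) h j.1 j.2 *: e j) =
  a + h d.1 d.2 *: e d by rewrite /a addrCA addrC.
have aux (P A F c D0 D1 S : R) : P - A = c * D1 ->
   P - F - (c * D0 + S) = (A - F - S) - c * (D0 - D1).
  by move=> /eqP; rewrite subr_eq => /eqP ->; ring.
rewrite (aux _ _ _ _ _ _ _ E).
apply: le_trans (ler_normB _ _) _.
rewrite /= -[(size s).+1%:R]natr1 (mulrDr eps) mulr1 [leRHS]mulrDl; apply: lerD; first exact: IH.
rewrite normrM mulrC; by apply: ler_pM => //; exact: ltW.
Qed.

Lemma C1_differentiable f p :
  (forall d : ix, \forall q \near p, derivable f q (e d)) ->
  (forall d : ix, {for p, continuous ('D_(e d) f)}) -> differentiable f p.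
Proof.
move=> df cf.
pose L h := \sum_(d : ix) h d.1 d.2 * 'D_(e d) f p.
have Ladd : linear_for *%R L.
  move=> c x y; rewrite /L mulr_sumr -big_split /=; apply: eq_bigr => d _.
  by rewrite !mxE mulrDl mulrA.
pose lm := GRing.isLinear.Build R V R *%R L Ladd.
pose Lin : {linear V -> R} := HB.pack L lm.
have Lc : continuous Lin.
  apply: (@continuous_big R _ +%R 0 xpredT _ V _ (fun (d : ix) (h : V) => h d.1 d.2 * 'D_(e d) f p)).
    exact: add_continuous.
  move=> d _ q.
  apply: (@continuousM R V (fun h => h d.1 d.2) (fun=> 'D_(e d) f p)).
    exact: coord_continuous.
  exact: cst_continuous.
have key : f \o shift p = (cst (f p) + Lin : V -> R^o) +o_ (0 : V) id.
  apply: (@eqaddoP R V R^o V _ _ _ _).2 => eps eps0.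
  pose K : R := (size (enum {: ix})).+1%:R.
  have K0 : 0 < K by rewrite ltr0n.
  have [r r0 rP] := @C1_linear_approx f p (enum {: ix}) (eps / K) (divr_gt0 eps0 K0) df cf.
  apply/nbhs_ballP; exists r => //= h; rewrite -ball_normE /ball_ /= sub0r normrN => hr.
  have := rP h hr; rewrite !big_enum /= -matrix_sum_delta_pair.
  rewrite [p + h]addrC => H.
  rewrite -[X in `|X|]/(f (h + p) - (f p + L h)) opprD addrA.
  apply: (le_trans H); rewrite ler_wpM2r //.
  rewrite -[leRHS](divfK (lt0r_neq0 K0)) ler_wpM2l ?divr_ge0 ?ltW //.
  by rewrite ltr_nat.
have E := diff_unique Lc key.
by apply/diff_locallyP; rewrite E.
Qed.

Lemma diff_sum_partials f p w : differentiable f p ->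
  'd f p w = \sum_(d : ix) w d.1 d.2 * 'D_(e d) f p.
Proof.
move=> df; rewrite {1}(matrix_sum_delta_pair w) linear_sum; apply: eq_bigr => d _.
by rewrite linearZ /= deriveE.
Qed.

(** Along the direction [v] the inner function is a function of one real
    variable, for which derivable and differentiable coincide, so the chain rule
    for differentials applies. *)
Lemma is_derive_comp_mx (U : normedModType R) (G : U -> V) f (x v : U) :
  differentiable f (G x) -> derivable G x v ->
  is_derive x v (f \o G)
    (\sum_(d : ix) 'D_v (fun y => G y d.1 d.2) x * 'D_(e d) f (G x)).
Proof.
move=> df dG.
pose g (t : R) := G (t *: v + x).
have g0 : g 0 = G x by rewrite /g scale0r add0r.
have dg1 : derivable g 0 1 := (derivable1P G x v).1 dG.
have dg : differentiable g 0 := (@derivable1_diffP R V g 0).1 dg1.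
have dfg : differentiable f (g 0) by rewrite g0.
have Eg : 'D_1 g 0 = 'D_v G x by rewrite (derive_along_line G).
apply: DeriveDef.
  apply: (derivable1P _ _ _).2; apply: (@derivable1_diffP R R^o (f \o g) 0).2.
  exact: (differentiable_comp dg dfg).
rewrite (derive_along_line (f \o G : U -> R^o)).
rewrite -[fun t => _]/(f \o g).
rewrite deriveE; last exact: differentiable_comp.
have Edg : 'd g 0 1 = 'D_v G x by rewrite -Eg deriveE.
rewrite (diff_comp dg dfg) /= Edg g0 diff_sum_partials //.
by rewrite (derive_mx dG); apply: eq_bigr => d _; rewrite mxE.
Qed.

End MatrixC1.

(** * Functions of class C^k on an open set *)

Lemma nbhsS2 (T : topologicalType) (p : T) (P Q S : set T) :
  nbhs p P -> nbhs p Q -> (forall q, P q -> Q q -> S q) -> nbhs p S.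
Proof. by move=> nP nQ PQS; apply: filterS2 nP nQ. Qed.

Lemma continuous_atP (R : realType) (T : topologicalType) (W : normedModType R)
    (f : T -> W) p :
  {for p, continuous f} <->
  forall e : R, 0 < e -> nbhs p [set q | `|f p - f q| < e].
Proof. by split=> [/cvgrPdist_lt|H]; last apply/cvgrPdist_lt. Qed.

Lemma nbhs_forall (T : topologicalType) (I : finType) (p : T) (P : I -> set T) :
  (forall i, nbhs p (P i)) -> nbhs p [set q | forall i, P i q].
Proof. by move=> nP; apply: filter_forall. Qed.

Section Ck.
Variables (R : realType) (m n : nat).
Local Notation V := 'M[R]_(m, n).
Local Notation ix := ('I_m * 'I_n)%type.
Variable U : set V.
Hypothesis Uo : open U.
Implicit Types (f g : V -> R) (p q : V).

Definition pdr (d : ix) f : V -> R := fun p => 'D_(delta_mx d.1 d.2) f p.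
Definition pdrable (d : ix) f p : Prop := derivable f p (delta_mx d.1 d.2 : V).

(** Unlike the definition of smoothness, which quantifies over all words of
    partial derivatives at once, the class is defined by recursion on the order,
    so that closure under products, quotients and composition follows by
    induction from the one-step rules for derivatives. *)
Fixpoint Ck (k : nat) f : Prop :=
  (forall p, U p -> {for p, continuous f}) /\
  if k is k'.+1 then
    forall d, (forall p, U p -> pdrable d f p) /\ Ck k' (pdr d f)
  else True.

Lemma nearU p (P : V -> Prop) : U p -> (forall q, U q -> P q) -> \forall q \near p, P q.
Proof. by move=> Up UP; apply: filterS UP _; apply: open_nbhs_nbhs; split. Qed.

Lemma Ck_cont k f : Ck k f -> forall p, U p -> {for p, continuous f}.
Proof. by case: k => [[]|k []]. Qed.

Lemma Ck_pdrable k f d p : Ck k.+1 f -> U p -> pdrable d f p.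
Proof. by move=> [_ /(_ d)[+ _]]; exact. Qed.

Lemma Ck_pdr k f d : Ck k.+1 f -> Ck k (pdr d f).
Proof. by move=> [_ /(_ d)[]]. Qed.

Lemma CkW k f : Ck k.+1 f -> Ck k f.
Proof.
elim: k f => [|k IH] f [cf df]; split=> // d; split.
  by have [] := df d.
by have [_ /IH] := df d.
Qed.

Lemma Ck0 k f : Ck k f -> Ck 0 f.
Proof. by elim: k f => // k IH f /CkW/IH. Qed.

Lemma pdrable_ext d f g p : U p -> (forall q, U q -> f q = g q) ->
  pdrable d f p -> pdrable d g p.
Proof.
move=> Up fg; apply: near_eq_derivable; exact: (nearU Up fg).
Qed.

Lemma pdr_ext d f g p : U p -> (forall q, U q -> f q = g q) -> pdr d f p = pdr d g p.
Proof. by move=> Up fg; apply: near_eq_derive; exact: (nearU Up fg). Qed.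

Lemma cont_ext f g p : U p -> (forall q, U q -> f q = g q) ->
  {for p, continuous f} -> {for p, continuous g}.
Proof.
move=> Up fg /continuous_atP cf; apply/continuous_atP => e e0.
apply: (@nbhsS2 V p _ _ _ (nearU Up fg) (cf e e0)) => q /= <-.
by rewrite -(fg _ Up).
Qed.

Lemma Ck_ext k f g : (forall q, U q -> f q = g q) -> Ck k f -> Ck k g.
Proof.
elim: k f g => [|k IH] f g fg [cf df]; split=> //.
- by move=> p Up; apply: cont_ext (cf p Up).
- by move=> p Up; apply: cont_ext (cf p Up).
move=> d; have [df1 df2] := df d; split.
  by move=> p Up; apply: pdrable_ext (df1 p Up).
by apply: IH df2 => q Uq; exact: pdr_ext.
Qed.

Lemma Ck_differentiable k f p : Ck k.+1 f -> U p -> differentiable f p.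
Proof.
move=> cf Up; apply: C1_differentiable => d.
  apply: (nearU Up) => q Uq. exact: (Ck_pdrable cf Uq).
exact: (Ck_cont (Ck_pdr d cf) Up).
Qed.

Lemma Ck_pdr_swap k f d d' p : Ck k.+2 f -> U p ->
  pdr d (pdr d' f) p = pdr d' (pdr d f) p.
Proof.
move=> cf Up; apply: derive_swap.
- by apply: (nearU Up) => q Uq; split; [exact: (Ck_pdrable cf Uq) | exact: (Ck_pdrable cf Uq)].
- apply: (nearU Up) => q Uq; split.
    exact: (Ck_pdrable (Ck_pdr d' cf) Uq).
  exact: (Ck_pdrable (Ck_pdr d cf) Uq).
- exact: (Ck_cont (Ck_pdr d (Ck_pdr d' cf)) Up).
- exact: (Ck_cont (Ck_pdr d' (Ck_pdr d cf)) Up).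
Qed.

(** The way all the closure properties below are proved: exhibit the expected
    formula for the derivatives and check that it is of class C^k. *)
Lemma CkS_intro k f (df : ix -> V -> R) :
  (forall p, U p -> {for p, continuous f}) ->
  (forall d p, U p -> is_derive p (delta_mx d.1 d.2 : V) f (df d p)) ->
  (forall d, Ck k (df d)) -> Ck k.+1 f.
Proof.
move=> cf dfP Cdf; split=> // d; split=> [p Up|]; first by have [] := dfP d p Up.
by apply: Ck_ext (Cdf d) => p Up; have [_ <-] := dfP d p Up.
Qed.

Lemma pdr_is_derive d f p : pdrable d f p ->
  is_derive p (delta_mx d.1 d.2 : V) f (pdr d f p).
Proof. exact: derivableP. Qed.

Lemma Ck_is_derive k d f p : Ck k.+1 f -> U p ->
  is_derive p (delta_mx d.1 d.2 : V) f (pdr d f p).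
Proof. by move=> cf Up; apply: pdr_is_derive; exact: Ck_pdrable cf Up. Qed.

Lemma Ck_cst k (c : R) : Ck k (fun=> c).
Proof.
elim: k c => [|k IH] c; first by split=> // p _; exact: cst_continuous.
apply: (@CkS_intro _ _ (fun _ _ => 0)) => //.
by move=> p _; exact: cst_continuous.
Qed.

Lemma is_derive_coord (d0 : ix) p (v : V) :
  is_derive p v (fun q : V => q d0.1 d0.2) (v d0.1 d0.2).
Proof.
have H : derivable (id : V -> V) p v by exact: derivable_id.
apply: DeriveDef; first exact: (derivable_mxP _ _ _).1 H d0.1 d0.2.
have := congr1 (fun M : V => M d0.1 d0.2) (derive_mx H).
by rewrite derive_id mxE => /esym.
Qed.

Lemma Ck_coord k (d0 : ix) : Ck k (fun q : V => q d0.1 d0.2).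
Proof.
case: k => [|k]; first by split=> // p _; exact: coord_continuous.
apply: (@CkS_intro _ _ (fun d p => (delta_mx d.1 d.2 : V) d0.1 d0.2)).
- by move=> p _; exact: coord_continuous.
- by move=> d p Up; exact: is_derive_coord.
- by move=> d; exact: Ck_cst.
Qed.

Lemma CkD k f g : Ck k f -> Ck k g -> Ck k (fun p => f p + g p).
Proof.
elim: k f g => [|k IH] f g cf cg.
  split=> // p Up; exact: (@continuousD R R^o V f g p (Ck_cont cf Up) (Ck_cont cg Up)).
apply: (@CkS_intro _ _ (fun d p => pdr d f p + pdr d g p)).
- move=> p Up; exact: (@continuousD R R^o V f g p (Ck_cont cf Up) (Ck_cont cg Up)).
- by move=> d p Up; apply: is_deriveD; [exact: (Ck_is_derive d cf Up) | exact: (Ck_is_derive d cg Up)].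
- by move=> d; apply: IH; exact: Ck_pdr.
Qed.

Lemma CkM k f g : Ck k f -> Ck k g -> Ck k (fun p => f p * g p).
Proof.
elim: k f g => [|k IH] f g cf cg.
  split=> // p Up; exact: (@continuousM R V f g p (Ck_cont cf Up) (Ck_cont cg Up)).
apply: (@CkS_intro _ _ (fun d p => f p * pdr d g p + g p * pdr d f p)).
- move=> p Up; exact: (@continuousM R V f g p (Ck_cont cf Up) (Ck_cont cg Up)).
- by move=> d p Up; apply: is_deriveM; [exact: (Ck_is_derive d cf Up) | exact: (Ck_is_derive d cg Up)].
- by move=> d; apply: CkD; apply: IH; by [exact: Ck_pdr | exact: CkW].
Qed.

Lemma CkN k f : Ck k f -> Ck k (fun p => - f p).
Proof.
by move=> cf; apply: Ck_ext (CkM (Ck_cst k (-1)) cf) => p _; rewrite mulN1r.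
Qed.

Lemma CkB k f g : Ck k f -> Ck k g -> Ck k (fun p => f p - g p).
Proof. by move=> cf cg; apply: CkD => //; exact: CkN. Qed.

Lemma Ck_sum k (I : Type) (s : seq I) (F : I -> V -> R) :
  (forall i, Ck k (F i)) -> Ck k (fun p => \sum_(i <- s) F i p).
Proof.
move=> cF; elim: s => [|i s IH].
  by apply: Ck_ext (Ck_cst k 0) => p _; rewrite big_nil.
by apply: Ck_ext (CkD (cF i) IH) => p _; rewrite big_cons.
Qed.

Lemma CkV k f : (forall p, U p -> f p != 0) -> Ck k f -> Ck k (fun p => (f p)^-1).
Proof.
move=> f0; elim: k => [|k IH] cf.
  split=> // p Up; apply: continuousV; first exact: f0.
  exact: (Ck_cont cf Up).
apply: (@CkS_intro _ _ (fun d p => - ((f p)^-1 * (f p)^-1 * pdr d f p))).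
- move=> p Up; apply: continuousV; first exact: f0.
  exact: (Ck_cont cf Up).
- move=> d p Up; have fp0 := f0 p Up; have df : pdrable d f p := Ck_pdrable cf Up.
  apply: DeriveDef; first exact: (derivableV fp0 df).
  by rewrite (deriveV fp0 df) -[_ *: _]/(_ * _) mulNr -exprVn expr2.
- have cV := IH (CkW cf).
  by move=> d; apply: CkN; apply: CkM; [exact: CkM | exact: Ck_pdr].
Qed.

Lemma is_derive_comp1 (h : R -> R) (dh : R) f p d :
  pdrable d f p -> is_derive (f p) (1 : R) h dh ->
  is_derive p (delta_mx d.1 d.2 : V) (fun q => h (f q)) (dh * pdr d f p).
Proof.
move=> df [hd <-].
pose v := (delta_mx d.1 d.2 : V); pose g (t : R) := f (t *: v + p).
have g0 : g 0 = f p by rewrite /g scale0r add0r.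
have dg1 : derivable g 0 1 := (derivable1P f p v).1 df.
have hd0 : derivable h (g 0) 1 := eq_ind_r (fun z => derivable h z 1) hd g0.
have dg := (@derivable1_diffP R R^o g 0).1 dg1.
have dh' := (@derivable1_diffP R R^o h (g 0)).1 hd0.
apply: DeriveDef.
  apply: (derivable1P _ _ _).2; apply: (@derivable1_diffP R R^o (h \o g) 0).2.
  exact: (differentiable_comp dg dh').
have E : 'D_1 (h \o g) 0 = 'D_1 h (g 0) * 'D_1 g 0.
  apply: etrans (esym (derive1E (h \o g) 0)) _.
  apply: etrans (derive1_comp dg1 hd0) _.
  exact: (congr2 *%R (derive1E h (g 0)) (derive1E g 0)).
apply: etrans (@derive_along_line _ _ R^o (fun q => h (f q)) p v) _.
apply: etrans E _; rewrite g0; congr (_ * _); apply/esym.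
exact: (@derive_along_line _ _ R^o f).
Qed.

Lemma cont_comp1 (h : R -> R) f p : continuous h -> {for p, continuous f} ->
  {for p, continuous (fun q => h (f q))}.
Proof. by move=> ch cf; apply: (@continuous_comp _ _ _ f h) => //; exact: ch. Qed.

Lemma Ck_exp k f : Ck k f -> Ck k (fun p => expR (f p)).
Proof.
elim: k => [|k IH] cf.
  by split=> // p Up; apply: (cont_comp1 (@continuous_expR R)); exact: (Ck_cont cf Up).
apply: (@CkS_intro _ _ (fun d p => expR (f p) * pdr d f p)).
- by move=> p Up; apply: (cont_comp1 (@continuous_expR R)); exact: (Ck_cont cf Up).
- by move=> d p Up; apply: is_derive_comp1; first exact: (Ck_pdrable cf Up).
- by move=> d; apply: CkM; [exact: IH (CkW cf) | exact: Ck_pdr].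
Qed.

(** Cosine and sine are treated together because each is the derivative of the
    other up to sign. *)
Lemma Ck_cos_sin k f : Ck k f ->
  Ck k (fun p => cos (f p)) /\ Ck k (fun p => sin (f p)).
Proof.
elim: k => [|k IH] cf.
  split; split=> // p Up.
    by apply: (cont_comp1 (@continuous_cos R)); exact: (Ck_cont cf Up).
  by apply: (cont_comp1 (@continuous_sin R)); exact: (Ck_cont cf Up).
have [Cc Cs] := IH (CkW cf); split.
  apply: (@CkS_intro _ _ (fun d p => - sin (f p) * pdr d f p)).
  - by move=> p Up; apply: (cont_comp1 (@continuous_cos R)); exact: (Ck_cont cf Up).
  - by move=> d p Up; apply: is_derive_comp1; first exact: (Ck_pdrable cf Up).
  - by move=> d; apply: CkM; [exact: CkN | exact: Ck_pdr].
apply: (@CkS_intro _ _ (fun d p => cos (f p) * pdr d f p)).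
- by move=> p Up; apply: (cont_comp1 (@continuous_sin R)); exact: (Ck_cont cf Up).
- by move=> d p Up; apply: is_derive_comp1; first exact: (Ck_pdrable cf Up).
- by move=> d; apply: CkM; [exact: Cc | exact: Ck_pdr].
Qed.

Lemma cont_mx (G : V -> V) p :
  (forall d : ix, {for p, continuous (fun q => G q d.1 d.2)}) ->
  {for p, continuous G}.
Proof.
move=> cG; apply/continuous_atP => e e0.
have H : nbhs p [set q | forall d : ix, `|G p d.1 d.2 - G q d.1 d.2| < e].
  apply: (@nbhs_forall V) => d.
  by have /continuous_atP := cG d; exact.
apply: (@nbhsS2 V p _ _ _ H H) => q Hq _ /=.
rewrite [ltLHS]/Num.Def.normr/= mx_normrE; apply: bigmax_lt => // d _.
by rewrite !mxE; exact: Hq.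
Qed.

Lemma pdr_comp (G : V -> V) f d p : differentiable f (G p) ->
  (forall d' : ix, pdrable d (fun q => G q d'.1 d'.2) p) ->
  is_derive p (delta_mx d.1 d.2 : V) (fun q => f (G q))
    (\sum_(d' : ix) pdr d (fun q => G q d'.1 d'.2) p * pdr d' f (G p)).
Proof.
move=> df dG; apply: is_derive_comp_mx => //.
by apply/derivable_mxP => i j; exact: dG (i, j).
Qed.

(** The chain rule writes a partial derivative of the composite as a sum of
    products of C^k functions, one factor being again a composite with [G], to
    which the induction hypothesis applies. *)
Lemma Ck_comp k (G : V -> V) f : (forall p, U p -> U (G p)) ->
  (forall d' : ix, Ck k (fun q => G q d'.1 d'.2)) ->
  Ck k f -> Ck k (fun p => f (G p)).
Proof.
move=> UG; have cc : forall f, (forall d' : ix, Ck 0 (fun q => G q d'.1 d'.2)) ->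
    Ck 0 f -> forall p, U p -> {for p, continuous (fun p => f (G p))}.
  move=> h cG [ch _] p Up; apply: (@continuous_comp _ _ _ G h).
    by apply: cont_mx => d; exact: (Ck_cont (cG d) Up).
  exact: ch (UG p Up).
elim: k f => [|k IH] f cG cf; first by split=> // p Up; exact: cc Up.
apply: (@CkS_intro _ _ (fun d p => \sum_(d' : ix) pdr d (fun q => G q d'.1 d'.2) p * pdr d' f (G p))).
- by apply: cc => [d'|]; [exact: Ck0 (cG d') | exact: Ck0 cf].
- move=> d p Up; apply: pdr_comp; first exact: Ck_differentiable cf (UG p Up).
  by move=> d'; exact: (Ck_pdrable (cG d') Up).
- move=> d; apply: Ck_sum => d'; apply: CkM; first exact: Ck_pdr.
  by apply: IH; [move=> d''; exact: CkW | exact: Ck_pdr].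
Qed.

End Ck.

(** * Smooth complex-valued functions on the half space *)

Section ComplexCalculus.
Variables (R : realType) (N : nat).
Local Notation C := R[i].
Local Notation P := (pt R N).
Local Notation dir := (dir N).
Local Notation H := (@halfspace R N).
Local Notation CkH := (@Ck R (1 + N) 2 H).
Local Notation re := (@complex.Re R).
Local Notation im := (@complex.Im R).
Implicit Types (f g : P -> C) (p q : P) (d : dir).

Lemma halfspace_open : open H.
Proof.
have -> : H = (fun p : P => p ord0 1) @^-1` [set x : R | 0 < x] by [].
apply: open_comp; last exact: open_gt.
by move=> p _; exact: coord_continuous.
Qed.
Local Notation Ho := halfspace_open.

Lemma complexE (x : C) : x = re x +i* im x. Proof. by case: x. Qed.
Lemma cReD (x y : C) : re (x + y) = re x + re y. Proof. by case: x y => ? ? []. Qed.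
Lemma cImD (x y : C) : im (x + y) = im x + im y. Proof. by case: x y => ? ? []. Qed.
Lemma cReM (x y : C) : re (x * y) = re x * re y - im x * im y. Proof. by case: x y => ? ? []. Qed.
Lemma cImM (x y : C) : im (x * y) = re x * im y + im x * re y. Proof. by case: x y => ? ? []. Qed.
Lemma complex_ext (x y : C) : re x = re y -> im x = im y -> x = y.
Proof. by case: x y => ? ? [? ?] /= -> ->. Qed.

Definition cCk k f := CkH k (fun p => re (f p)) /\ CkH k (fun p => im (f p)).

Lemma cCk_pd k d f : cCk k.+1 f -> cCk k (pd d f).
Proof. by move=> [c1 c2]; split; [exact: (Ck_pdr d c1) | exact: (Ck_pdr d c2)]. Qed.

Lemma smooth_pd d f : smooth f -> smooth (pd d f).
Proof. by move=> sf w p Hp; have := sf (rcons w d) p Hp; rewrite /iter_pd foldr_rcons. Qed.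

(** The bridge between the words of partial derivatives that define smoothness
    and the recursive classes, on which the closure properties are proved. *)
Lemma smoothP f : smooth f <-> forall k, cCk k f.
Proof.
split=> [sf k|cf w p Hp].
  elim: k f sf => [|k IH] f sf.
    by split; split=> // p Hp; have [] := sf [::] p Hp.
  split; split.
  - by move=> p Hp; have [] := sf [::] p Hp.
  - move=> d; split; first by move=> p Hp; have [_ _ /(_ d)[]] := sf [::] p Hp.
    by have [] := IH _ (smooth_pd d sf).
  - by move=> p Hp; have [] := sf [::] p Hp.
  - move=> d; split; first by move=> p Hp; have [_ _ /(_ d)[]] := sf [::] p Hp.
    by have [] := IH _ (smooth_pd d sf).
have {}cf : forall k, cCk k (iter_pd w f).
  elim: w => [|d w IH] k; first exact: cf.
  exact: cCk_pd (IH k.+1).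
have [c1 c2] := cf 1.
split; [exact: (Ck_cont c1 Hp) | exact: (Ck_cont c2 Hp) |].
by move=> d; split; [exact: (Ck_pdrable c1 Hp) | exact: (Ck_pdrable c2 Hp)].
Qed.

(** Functions are total but only their values on the half space matter; since
    that set is open, all the operators below respect this equality. *)
Definition eqH f g := forall p, H p -> f p = g p.

Lemma smooth_ext f g : eqH f g -> smooth f -> smooth g.
Proof.
move=> fg /smoothP cf; apply/smoothP => k; have [c1 c2] := cf k.
split; [apply: Ck_ext c1 | apply: Ck_ext c2]; try exact: Ho.
all: by move=> q Hq; rewrite fg.
Qed.

Lemma smooth_re_im f : (forall k, CkH k (fun p => re (f p))) ->
  (forall k, CkH k (fun p => im (f p))) -> smooth f.
Proof. by move=> c1 c2; apply/smoothP => k; split. Qed.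

Lemma smooth_cst (c : C) : smooth (fun _ : P => c).
Proof. by apply: smooth_re_im => k; exact: (Ck_cst Ho). Qed.

Lemma smoothD f g : smooth f -> smooth g -> smooth (fun p => f p + g p).
Proof.
move=> /smoothP cf /smoothP cg; apply/smoothP => k.
have [f1 f2] := cf k; have [g1 g2] := cg k; split.
  by apply: (Ck_ext Ho) (CkD Ho f1 g1) => p _; rewrite cReD.
by apply: (Ck_ext Ho) (CkD Ho f2 g2) => p _; rewrite cImD.
Qed.

Lemma smoothM f g : smooth f -> smooth g -> smooth (fun p => f p * g p).
Proof.
move=> /smoothP cf /smoothP cg; apply/smoothP => k.
have [f1 f2] := cf k; have [g1 g2] := cg k; split.
  by apply: (Ck_ext Ho) (CkB Ho (CkM Ho f1 g1) (CkM Ho f2 g2)) => p _; rewrite cReM.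
by apply: (Ck_ext Ho) (CkD Ho (CkM Ho f1 g2) (CkM Ho f2 g1)) => p _; rewrite cImM.
Qed.

Lemma smooth_sum (I : Type) (s : seq I) (F : I -> P -> C) :
  (forall i, smooth (F i)) -> smooth (fun p => \sum_(i <- s) F i p).
Proof.
move=> sF; elim: s => [|i s IH].
  by apply: smooth_ext (smooth_cst 0) => p _; rewrite big_nil.
by apply: smooth_ext (smoothD (sF i) IH) => p _; rewrite big_cons.
Qed.

Lemma normsq_neq0 (x : C) : x != 0 -> re x * re x + im x * im x != 0.
Proof.
case: x => a b; rewrite eq_complex /= negb_and -!expr2 => ab.
by rewrite paddr_eq0 ?sqr_ge0 // !sqrf_eq0 negb_and.
Qed.

Lemma smoothV f : (forall p, H p -> f p != 0) -> smooth f -> smooth (fun p => (f p)^-1).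
Proof.
move=> f0 /smoothP cf; apply/smoothP => k; have [f1 f2] := cf k.
have cn : CkH k (fun p => (re (f p) * re (f p) + im (f p) * im (f p))^-1).
  apply: (CkV Ho); first by move=> p /f0/normsq_neq0.
  by apply: (CkD Ho); exact: (CkM Ho).
split.
  by apply: (Ck_ext Ho) (CkM Ho f1 cn) => p _; case: (f p) => a b /=; rewrite -!expr2.
apply: (Ck_ext Ho) (CkM Ho (CkN Ho f2) cn) => p _; case: (f p) => a b /=.
by rewrite -!expr2 mulNr.
Qed.

Lemma smooth_cexp f : smooth f -> smooth (fun p => cexp (f p)).
Proof.
move=> /smoothP cf; apply/smoothP => k; have [f1 f2] := cf k.
have [c s] := Ck_cos_sin Ho f2; have e := Ck_exp Ho f1; split.
  by apply: (Ck_ext Ho) (CkM Ho e c) => p _; rewrite cReM /= mul0r subr0.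
by apply: (Ck_ext Ho) (CkM Ho e s) => p _; rewrite cImM /= mul0r addr0.
Qed.

Lemma smooth_conj f : smooth f -> smooth (fun p => conjc (f p)).
Proof.
move=> /smoothP cf; apply/smoothP => k; have [f1 f2] := cf k; split.
  by apply: (Ck_ext Ho) f1 => p _; case: (f p).
by apply: (Ck_ext Ho) (CkN Ho f2) => p _; case: (f p).
Qed.

Lemma smooth_coord (d : dir) : smooth (fun p => (p d.1 d.2)%:C).
Proof. by apply: smooth_re_im => k; [exact: (Ck_coord Ho) | exact: (Ck_cst Ho)]. Qed.

Lemma pd_ext d f g p : H p -> eqH f g -> pd d f p = pd d g p.
Proof.
move=> Hp fg; rewrite /pd.
have E1 := @pdr_ext R _ _ H Ho d (fun q => re (f q)) (fun q => re (g q)) p Hp (fun q Hq => congr1 re (fg q Hq)).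
have E2 := @pdr_ext R _ _ H Ho d (fun q => im (f q)) (fun q => im (g q)) p Hp (fun q Hq => congr1 im (fg q Hq)).
by rewrite -!/(pdr _ _ _) E1 E2.
Qed.

Definition ispd d f p (z : C) :=
  is_derive p (delta_mx d.1 d.2 : P) (fun q => re (f q)) (re z) /\
  is_derive p (delta_mx d.1 d.2 : P) (fun q => im (f q)) (im z).

Lemma ispdE d f p z : ispd d f p z -> pd d f p = z.
Proof. by move=> [[_ E1] [_ E2]]; rewrite /pd E1 E2 -complexE. Qed.

Lemma smooth_ispd d f p : H p -> smooth f -> ispd d f p (pd d f p).
Proof.
move=> Hp /smoothP cf; have [c1 c2] := cf 1%N.
by split; [exact: (Ck_is_derive d c1 Hp) | exact: (Ck_is_derive d c2 Hp)].
Qed.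

Lemma pd_cst d (c : C) p : pd d (fun=> c) p = 0.
Proof. by apply: ispdE; split; exact: is_derive_cst. Qed.

Lemma pdD d f g p : H p -> smooth f -> smooth g ->
  pd d (fun q => f q + g q) p = pd d f p + pd d g p.
Proof.
move=> Hp sf sg; apply: ispdE.
have [f1 f2] := smooth_ispd d Hp sf; have [g1 g2] := smooth_ispd d Hp sg.
split.
  rewrite cReD (_ : (fun q => re (f q + g q)) = (fun q => re (f q) + re (g q))).
    exact: is_deriveD.
  by apply/funext => q; rewrite cReD.
rewrite cImD (_ : (fun q => im (f q + g q)) = (fun q => im (f q) + im (g q))).
  exact: is_deriveD.
by apply/funext => q; rewrite cImD.
Qed.

Lemma pdM d f g p : H p -> smooth f -> smooth g ->
  pd d (fun q => f q * g q) p = pd d f p * g p + f p * pd d g p.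
Proof.
move=> Hp sf sg; apply: ispdE.
have [f1 f2] := smooth_ispd d Hp sf; have [g1 g2] := smooth_ispd d Hp sg.
split.
  rewrite (_ : (fun q => re (f q * g q)) = (fun q => re (f q) * re (g q) - im (f q) * im (g q))).
    apply: (is_derive_eq (is_deriveB (is_deriveM f1 g1) (is_deriveM f2 g2))).
    by rewrite -![_ *: _]/(_ * _) cReD !cReM; ring.
  by apply/funext => q; rewrite cReM.
rewrite (_ : (fun q => im (f q * g q)) = (fun q => re (f q) * im (g q) + im (f q) * re (g q))).
  apply: (is_derive_eq (is_deriveD (is_deriveM f1 g2) (is_deriveM f2 g1))).
  by rewrite -![_ *: _]/(_ * _) cImD !cImM; ring.
by apply/funext => q; rewrite cImM.
Qed.

Lemma pd_sum d (I : Type) (s : seq I) (F : I -> P -> C) p : H p ->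
  (forall i, smooth (F i)) ->
  pd d (fun q => \sum_(i <- s) F i q) p = \sum_(i <- s) pd d (F i) p.
Proof.
move=> Hp sF; elim: s => [|i s IH].
  rewrite big_nil -[RHS](pd_cst d 0 p); apply: pd_ext => // q _; exact: big_nil.
rewrite big_cons -IH -pdD //; last exact: smooth_sum.
by apply: pd_ext => // q _; rewrite big_cons.
Qed.

Lemma pd_cexp d f p : H p -> smooth f ->
  pd d (fun q => cexp (f q)) p = cexp (f p) * pd d f p.
Proof.
move=> Hp sf; apply: ispdE.
have [f1 f2] := smooth_ispd d Hp sf.
have /smoothP/(_ 1)[c1 c2] := sf.
have e1 := is_derive_comp1 (Ck_pdrable (d := d) c1 Hp) (is_derive_expR (re (f p))).
have e2 := is_derive_comp1 (Ck_pdrable (d := d) c2 Hp) (is_derive_cos (im (f p))).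
have e3 := is_derive_comp1 (Ck_pdrable (d := d) c2 Hp) (is_derive_sin (im (f p))).
split.
  rewrite (_ : (fun q => re (cexp (f q))) = (fun q => expR (re (f q)) * cos (im (f q)))).
    apply: (is_derive_eq (is_deriveM e1 e2)).
    rewrite -![_ *: _]/(_ * _) !cReM !cImM /=; rewrite /pdr; ring.
  by apply/funext => q; rewrite cReM /= mul0r subr0.
rewrite (_ : (fun q => im (cexp (f q))) = (fun q => expR (re (f q)) * sin (im (f q)))).
  apply: (is_derive_eq (is_deriveM e1 e3)).
  rewrite -![_ *: _]/(_ * _) !cImM /=; rewrite /pdr; ring.
by apply/funext => q; rewrite cImM /= mul0r addr0.
Qed.

Lemma pd_conj d f p : H p -> smooth f ->
  pd d (fun q => conjc (f q)) p = conjc (pd d f p).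
Proof.
move=> Hp sf; apply: ispdE.
have [f1 f2] := smooth_ispd d Hp sf; split.
  by rewrite (_ : (fun q => re (conjc (f q))) = (fun q => re (f q))) //; apply/funext => q; case: (f q).
rewrite (_ : (fun q => im (conjc (f q))) = (fun q => - im (f q))); first exact: is_deriveN.
by apply/funext => q; case: (f q).
Qed.

Lemma pd_coord d (d0 : dir) p : pd d (fun q => (q d0.1 d0.2)%:C) p = (d == d0)%:R.
Proof.
apply: ispdE; split; last first.
  by rewrite (_ : im _ = 0); [exact: is_derive_cst | case: (_ == _)].
rewrite (_ : re _ = (delta_mx d.1 d.2 : P) d0.1 d0.2).
  exact: is_derive_coord.
by rewrite mxE -xpair_eqE -!surjective_pairing eq_sym; case: (_ == _).
Qed.

Lemma pd_swap d d' f p : H p -> smooth f -> pd d (pd d' f) p = pd d' (pd d f) p.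
Proof.
move=> Hp /smoothP/(_ 2)[c1 c2]; apply: complex_ext => /=.
  exact: (Ck_pdr_swap Ho d d' c1 Hp).
exact: (Ck_pdr_swap Ho d d' c2 Hp).
Qed.

End ComplexCalculus.

(** * Wirtinger derivatives *)

Section Wirtinger.
(* Unification must not unfold derivatives into limits of quotients. *)
Local Opaque pd.
Variables (R : realType) (N : nat).
Local Notation C := R[i].
Local Notation iC := (Complex (0 : R) 1).
Local Notation P := (pt R N).
Local Notation dir := (dir N).
Local Notation H := (@halfspace R N).
Local Notation re := (@complex.Re R).
Local Notation im := (@complex.Im R).
Local Notation ix := 'I_(1 + N).
Implicit Types (f g : P -> C) (p q : P) (d : dir) (b : bool) (i j : ix).

Lemma iC2 : iC * iC = -1 :> C.
Proof. by apply: complex_ext => /=; ring. Qed.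

Lemma rshift1_neq0 (j : 'I_N) : (rshift 1 j == ord0 :> ix) = false.
Proof. by []. Qed.

Lemma eq_rshift1 (j l : 'I_N) : (rshift 1 j == rshift 1 l :> ix) = (j == l).
Proof. by rewrite (inj_eq (@rshift_inj _ _)). Qed.

Variant split1_spec : ix -> Type :=
 | Split1_0 : split1_spec ord0
 | Split1_r (j : 'I_N) : split1_spec (rshift 1 j).

(** Coordinates are the modular variable, index 0, followed by the N elliptic
    variables. *)
Lemma split1P i : split1_spec i.
Proof.
case: (split_ordP i) => j ->; last exact: Split1_r.
have -> : lshift N j = ord0 by apply: val_inj; rewrite /= ord1.
exact: Split1_0.
Qed.

Lemma sum1N (V : nmodType) (F : ix -> V) :
  \sum_i F i = F ord0 + \sum_j F (rshift 1 j).
Proof.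
rewrite big_split_ord /= big_ord1; congr (F _ + _).
exact: val_inj.
Qed.

(** Both Wirtinger derivatives at once: [b = true] is the antiholomorphic
    one.  The algebraic rules are the same for the two, and conjugation
    exchanges them. *)
Definition wz b i : op R N := fun f p =>
  2^-1 * (pd (i, 0) f p + (if b then iC else - iC) * pd (i, 1) f p).

Lemma wirtE i : @wirt R N i = wz false i.
Proof. by apply/funext => f; apply/funext => p; rewrite /wirt /wz mulNr. Qed.

Lemma smooth_wz b i f : smooth f -> smooth (wz b i f).
Proof.
move=> sf; apply: smoothM; first exact: smooth_cst.
apply: smoothD; first exact: smooth_pd.
by apply: smoothM; [exact: smooth_cst | exact: smooth_pd].
Qed.

Lemma wz_ext b i f g p : H p -> eqH f g -> wz b i f p = wz b i g p.
Proof. by move=> Hp fg; rewrite /wz !(pd_ext _ Hp fg). Qed.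

Lemma wz_cst b i (c : C) p : wz b i (fun=> c) p = 0.
Proof. by rewrite /wz !pd_cst mulr0 addr0 mulr0. Qed.

Lemma wzD b i f g p : H p -> smooth f -> smooth g ->
  wz b i (fun q => f q + g q) p = wz b i f p + wz b i g p.
Proof.
move=> Hp sf sg; rewrite /wz (pdD (i, 0) Hp sf sg) (pdD (i, 1) Hp sf sg).
move: (pd _ f p) (pd _ f p) (pd _ g p) (pd _ g p) (if b then _ else _) => *; ring.
Qed.

Lemma wzM b i f g p : H p -> smooth f -> smooth g ->
  wz b i (fun q => f q * g q) p = wz b i f p * g p + f p * wz b i g p.
Proof.
move=> Hp sf sg; rewrite /wz (pdM (i, 0) Hp sf sg) (pdM (i, 1) Hp sf sg).
move: (pd _ f p) (pd _ f p) (pd _ g p) (pd _ g p) (f p) (g p) (if b then _ else _) => *; ring.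
Qed.

Lemma wzZ b i (c : C) f p : H p -> smooth f ->
  wz b i (fun q => c * f q) p = c * wz b i f p.
Proof.
by move=> Hp sf; rewrite (wzM b i Hp (smooth_cst c) sf) wz_cst mul0r add0r.
Qed.

Lemma wzN b i f p : H p -> smooth f -> wz b i (fun q => - f q) p = - wz b i f p.
Proof.
move=> Hp sf; rewrite -mulN1r -(wzZ b i (-1) Hp sf); apply: (wz_ext b i Hp) => q _.
by rewrite mulN1r.
Qed.

Lemma wz_sum b i (I : Type) (s : seq I) (F : I -> P -> C) p : H p ->
  (forall k, smooth (F k)) ->
  wz b i (fun q => \sum_(k <- s) F k q) p = \sum_(k <- s) wz b i (F k) p.
Proof.
move=> Hp sF; rewrite /wz (pd_sum (i, 0) s Hp sF) (pd_sum (i, 1) s Hp sF) mulr_sumr -big_split mulr_sumr.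
by apply: eq_bigr.
Qed.

Lemma wz_cexp b i f p : H p -> smooth f ->
  wz b i (fun q => cexp (f q)) p = cexp (f p) * wz b i f p.
Proof.
move=> Hp sf; rewrite /wz (pd_cexp (i, 0) Hp sf) (pd_cexp (i, 1) Hp sf).
by move: (pd _ f p) (pd _ f p) (cexp _) (if b then _ else _) => *; ring.
 Qed.

Lemma conjC_M (x y : C) : conjc (x * y) = conjc x * conjc y.
Proof. exact: rmorphM. Qed.
Lemma conjC_D (x y : C) : conjc (x + y) = conjc x + conjc y.
Proof. exact: rmorphD. Qed.
Lemma wz_conj b i f p : H p -> smooth f ->
  wz b i (fun q => conjc (f q)) p = conjc (wz (~~ b) i f p).
Proof.
move=> Hp sf; rewrite /wz (pd_conj (i, 0) Hp sf) (pd_conj (i, 1) Hp sf) conjC_M conjC_D conjC_M.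
have -> : conjc (2^-1 : C) = 2^-1 by rewrite /conjc /=; apply: complex_ext => /=; rewrite ?mul0r ?oppr0; ring.
congr (_ * (_ + _ * _)).
by case: b; apply: complex_ext => /=; rewrite ?oppr0 ?opprK.
Qed.

Lemma wz_swap b b' i i' f p : H p -> smooth f ->
  wz b i (wz b' i' f) p = wz b' i' (wz b i f) p.
Proof.
move=> Hp sf; rewrite {1 3}/wz.
have E d c i0 : pd d (wz c i0 f) p = 2^-1 *
    (pd d (pd (i0, 0) f) p + (if c then iC else - iC) * pd d (pd (i0, 1) f) p).
  set k := if c then _ else _.
  have s0 := smooth_pd (i0, 0) sf; have s1 := smooth_pd (i0, 1) sf.
  have s2 := smoothM (smooth_cst k) s1.
  rewrite /wz (pdM d Hp (smooth_cst 2^-1) (smoothD s0 s2)).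
  by rewrite (pdD d Hp s0 s2) (pdM d Hp (smooth_cst k) s1) !pd_cst !mul0r !add0r.
rewrite !E (pd_swap (i', 0) (i, 0) Hp sf) (pd_swap (i', 0) (i, 1) Hp sf).
rewrite (pd_swap (i', 1) (i, 0) Hp sf) (pd_swap (i', 1) (i, 1) Hp sf).
move: (pd _ _ p) (pd _ _ p) (pd _ _ p) (pd _ _ p) (if b then _ else _) (if b' then _ else _) => *.
by ring.
Qed.

(** The complex coordinate functions, treating tau and the z_j alike. *)
Definition zc i p : C := p i 0 +i* p i 1.

Lemma zcE i p : zc i p = (p i 0)%:C + iC * (p i 1)%:C.
Proof. by apply: complex_ext => /=; ring. Qed.

Lemma smooth_zc i : smooth (zc i).
Proof.
apply: (@smooth_ext _ _ (fun p => (p i 0)%:C + iC * (p i 1)%:C)).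
  by move=> p _; rewrite zcE.
apply: smoothD; first exact: (smooth_coord (i, 0)).
apply: smoothM; [exact: smooth_cst | exact: (smooth_coord (i, 1))].
Qed.

Lemma pd_zc (d : dir) i p : H p ->
  pd d (zc i) p = (d == (i, 0))%:R + iC * (d == (i, 1))%:R.
Proof.
move=> Hp; rewrite (@pd_ext _ _ d (zc i) (fun p => (p i 0)%:C + iC * (p i 1)%:C)) //; last first.
  by move=> q _; rewrite zcE.
have s0 := @smooth_coord R N (i, 0); have s1 := @smooth_coord R N (i, 1).
have sc := @smooth_cst R N iC.
rewrite (pdD d Hp s0 (smoothM sc s1)) (pdM d Hp sc s1).
by rewrite (pd_coord d (i, 0)) (pd_coord d (i, 1)) pd_cst mul0r add0r.
Qed.

Lemma wz_zc b i j p : H p -> wz b i (zc j) p = (~~ b && (i == j))%:R.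
Proof.
move=> Hp; rewrite /wz !pd_zc // !xpair_eqE /= !andbT !andbF mulr0 addr0 add0r.
have -> (c : C) : c * (iC * (i == j)%:R) = c * iC * (i == j)%:R by rewrite mulrA.
rewrite -[X in X + _]mul1r -mulrDl.
have -> : 1 + (if b then iC else - iC) * iC = (~~ b)%:R *+ 2 :> C.
  by case: b; rewrite ?mulNr iC2 ?opprK ?subrr ?mul0rn.
case: b; case: (_ == _); rewrite /= ?mul0rn ?mul0r ?mulr0 ?mulr1 //.
by rewrite mulVf // pnatr_eq0.
Qed.

Lemma ord2P (k : 'I_2) : k = 0 \/ k = 1.
Proof. by case: k => [[|[|//]] lk]; [left|right]; exact: val_inj. Qed.

Lemma re_sum (I : Type) (s : seq I) (F : I -> C) : re (\sum_(i <- s) F i) = \sum_(i <- s) re (F i).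
Proof. exact: (big_morph _ (@cReD R) (erefl : re 0 = 0)). Qed.
Lemma im_sum (I : Type) (s : seq I) (F : I -> C) : im (\sum_(i <- s) F i) = \sum_(i <- s) im (F i).
Proof. exact: (big_morph _ (@cImD R) (erefl : im 0 = 0)). Qed.

Lemma re_lin (A B : C) (r s : R) : re (A * r%:C + B * s%:C) = re A * r + re B * s.
Proof. by rewrite cReD !cReM /= !mulr0 !subr0. Qed.
Lemma im_lin (A B : C) (r s : R) : im (A * r%:C + B * s%:C) = im A * r + im B * s.
Proof. by rewrite cImD !cImM /= !mulr0 !add0r. Qed.

(** The real chain rule, over pairs of real coordinates, regrouped into
    Wirtinger derivatives of the outer function. *)
Lemma pd_comp (G : P -> P) d f p : H p -> H (G p) -> smooth f ->
  (forall i, smooth (fun q => zc i (G q))) ->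
  pd d (fun q => f (G q)) p =
   \sum_i (wz false i f (G p) * pd d (fun q => zc i (G q)) p
           + wz true i f (G p) * conjc (pd d (fun q => zc i (G q)) p)).
Proof.
move=> Hp HG /smoothP/(_ 1)[c1 c2] sG.
have Ho := @halfspace_open R N.
have cG (d' : dir) : Ck H 1 (fun q => G q d'.1 d'.2).
  have /smoothP/(_ 1)[g1 g2] := sG d'.1.
  by case: d' g1 g2 => i k /= g1 g2; case: (ord2P k) => ->.
have dG (d' : dir) : pdrable d (fun q => G q d'.1 d'.2) p := Ck_pdrable (cG d') Hp.
have D1 := pdr_comp (Ck_differentiable Ho c1 HG) dG.
have D2 := pdr_comp (Ck_differentiable Ho c2 HG) dG.
have pairE (h : P -> R) : \sum_(d' : dir) pdr d (fun q => G q d'.1 d'.2) p * pdr d' h (G p)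
   = \sum_i (pdr d (fun q => G q i 0) p * pdr (i, 0) h (G p)
            + pdr d (fun q => G q i 1) p * pdr (i, 1) h (G p)).
  rewrite -(pair_bigA _ (fun i k => pdr d (fun q => G q i k) p * pdr (i, k) h (G p))) /=.
  apply: eq_bigr => i _; rewrite big_ord_recl big_ord1.
  have -> : lift ord0 ord0 = 1 :> 'I_2 by exact: val_inj.
  have -> : ord0 = 0 :> 'I_2 by exact: val_inj.
  by [].
rewrite !pairE in D1 D2.
rewrite (ispdE (z := \sum_i
   (pd (i, 0) f (G p) * (re (pd d (fun q => zc i (G q)) p))%:C
  + pd (i, 1) f (G p) * (im (pd d (fun q => zc i (G q)) p))%:C))); last first.
  split; rewrite ?re_sum ?im_sum.
    apply: (is_derive_eq D1); apply: eq_bigr => i _; apply/esym/etrans; first exact: re_lin.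
    by congr (_ + _); exact: mulrC.
  apply: (is_derive_eq D2); apply: eq_bigr => i _; apply/esym/etrans; first exact: im_lin.
  by congr (_ + _); exact: mulrC.
apply: eq_bigr => i _; rewrite /wz.
move: (pd (i, 0) f (G p)) (pd (i, 1) f (G p)) (pd d _ p) => x y z.
case: z => r s.
have -> : conjc (r +i* s) = r%:C - iC * s%:C by apply: complex_ext => /=; ring.
have -> : re (r +i* s) = r by []. have -> : im (r +i* s) = s by [].
have -> : r +i* s = r%:C + iC * s%:C by apply: complex_ext => /=; ring.
have -> : y * s%:C = - (iC * iC) * (y * s%:C) by rewrite iC2 opprK mul1r.
move: (r%:C) (s%:C) iC => {}r {}s I; by field.
Qed.

End Wirtinger.

(** * Holomorphic functions and the chain rule *)

Section Holomorphic.
Local Opaque pd wz.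
Variables (R : realType) (N : nat).
Local Notation C := R[i].
Local Notation iC := (Complex (0 : R) 1).
Local Notation P := (pt R N).
Local Notation H := (@halfspace R N).
Local Notation ix := 'I_(1 + N).
Implicit Types (f g : P -> C) (p q : P) (b : bool) (i j : ix).

Lemma wzV b i f p : (forall q, H q -> f q != 0) -> H p -> smooth f ->
  wz b i (fun q => (f q)^-1) p = - ((f p)^-1 * (f p)^-1 * wz b i f p).
Proof.
move=> f0 Hp sf; have sV := smoothV f0 sf.
have fp0 := f0 p Hp.
have E : wz b i (fun q => f q * (f q)^-1) p = 0.
  rewrite -[RHS](wz_cst b i 1 p); apply: (wz_ext b i Hp) => q Hq.
  by rewrite divff // f0.
rewrite (wzM b i Hp sf sV) in E.
apply: (mulfI fp0); apply/eqP; rewrite -subr_eq0 -[X in _ == X]E; apply/eqP.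
move: (wz _ _ _ p) (wz _ _ _ p) => x y; by field.
Qed.

Lemma smoothX n f : smooth f -> smooth (fun q => f q ^+ n).
Proof.
move=> sf; elim: n => [|n IH].
  by apply: smooth_ext (@smooth_cst R N 1) => p _; rewrite expr0.
by apply: smooth_ext (smoothM sf IH) => p _; rewrite exprS.
Qed.

Lemma wzX b i n f p : f p != 0 -> H p -> smooth f ->
  wz b i (fun q => f q ^+ n) p = n%:R * (f p ^+ n * (f p)^-1 * wz b i f p).
Proof.
move=> fp0 Hp sf; elim: n => [|n IH].
  rewrite mul0r -[RHS](wz_cst b i 1 p); apply: (wz_ext b i Hp) => q Hq.
  by rewrite expr0.
rewrite (wz_ext b i Hp (g := fun q => f q * f q ^+ n)); last first.
  by move=> q _; rewrite exprS.
rewrite (wzM b i Hp sf (smoothX n sf)) IH exprS -natr1.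
move: (wz _ _ _ p) (f p ^+ n) => x y; by field.
Qed.

Lemma smoothXz (k : int) f : (forall q, H q -> f q != 0) -> smooth f ->
  smooth (fun q => f q ^ k).
Proof.
move=> f0 sf; case: k => n; first exact: smoothX.
apply: smoothV; last exact: smoothX.
by move=> q Hq; rewrite expf_neq0 // f0.
Qed.

Lemma wzXz b i (k : int) f p : (forall q, H q -> f q != 0) -> H p -> smooth f ->
  wz b i (fun q => f q ^ k) p = k%:~R * (f p ^ k * (f p)^-1 * wz b i f p).
Proof.
move=> f0 Hp sf; have fp0 := f0 p Hp; case: k => n; first exact: wzX.
rewrite -[fun q => _]/(fun q => (f q ^+ n.+1)^-1).
rewrite wzV //; [|by move=> q Hq; rewrite expf_neq0 // f0|exact: smoothX].
rewrite wzX // NegzE -[f p ^ _]/((f p ^+ n.+1)^-1) mulrNz -[n.+1%:~R]/(n.+1%:R).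
have : f p ^+ n.+1 != 0 by rewrite expf_neq0.
move: (wz _ _ _ p) (f p ^+ n.+1) (n.+1%:R) => x y z y0; by field; rewrite fp0 y0.
Qed.

(** Carrying the gradient along lets the derivatives of a closed formula be
    computed by applying the rules to its subterms. *)
Definition holo f (df : ix -> P -> C) : Prop :=
  smooth f /\ forall i p, H p -> wz true i f p = 0 /\ wz false i f p = df i p.

Lemma holo_ext f g (df dg : ix -> P -> C) : holo f df -> eqH f g ->
  (forall i, eqH (df i) (dg i)) -> holo g dg.
Proof.
move=> [sf hf] fg dfg; split; first exact: smooth_ext sf.
move=> i p Hp; rewrite -!(wz_ext _ i Hp fg).
by have [h1 h2] := hf i p Hp; rewrite h1 h2 dfg.
Qed.

Lemma holo_cst (c : C) : holo (fun=> c) (fun _ _ => 0).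
Proof. by split; [exact: smooth_cst | move=> i p Hp; rewrite !wz_cst]. Qed.

Lemma holo_zc j : holo (zc j) (fun i _ => (i == j)%:R).
Proof. by split; [exact: smooth_zc | move=> i p Hp; rewrite !wz_zc]. Qed.

Lemma holoD f g df dg : holo f df -> holo g dg ->
  holo (fun p => f p + g p) (fun i p => df i p + dg i p).
Proof.
move=> [sf hf] [sg hg]; split; first exact: smoothD.
move=> i p Hp; have [a1 a2] := hf i p Hp; have [b1 b2] := hg i p Hp.
by rewrite (wzD true i Hp sf sg) (wzD false i Hp sf sg) a1 a2 b1 b2 addr0.
Qed.

Lemma holoM f g df dg : holo f df -> holo g dg ->
  holo (fun p => f p * g p) (fun i p => df i p * g p + f p * dg i p).
Proof.
move=> [sf hf] [sg hg]; split; first exact: smoothM.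
move=> i p Hp; have [a1 a2] := hf i p Hp; have [b1 b2] := hg i p Hp.
by rewrite (wzM true i Hp sf sg) (wzM false i Hp sf sg) a1 a2 b1 b2 mul0r mulr0 addr0.
Qed.

Lemma holoZ c f df : holo f df -> holo (fun p => c * f p) (fun i p => c * df i p).
Proof.
move=> hf; apply: holo_ext (holoM (holo_cst c) hf) _ _ => // i p _.
by rewrite mul0r add0r.
Qed.

Lemma holo_sum (I : Type) (s : seq I) (F : I -> P -> C) dF :
  (forall k, holo (F k) (dF k)) ->
  holo (fun p => \sum_(k <- s) F k p) (fun i p => \sum_(k <- s) dF k i p).
Proof.
move=> hF; elim: s => [|k s IH].
  by apply: holo_ext (holo_cst 0) _ _ => [p _|i p _]; rewrite big_nil.
by apply: holo_ext (holoD (hF k) IH) _ _ => [p _|i p _]; rewrite big_cons.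
Qed.

Lemma holoV f df : (forall q, H q -> f q != 0) -> holo f df ->
  holo (fun p => (f p)^-1) (fun i p => - ((f p)^-1 * (f p)^-1 * df i p)).
Proof.
move=> f0 [sf hf]; split; first exact: smoothV.
move=> i p Hp; have [a1 a2] := hf i p Hp.
by rewrite (wzV true i f0 Hp sf) (wzV false i f0 Hp sf) a1 a2 mulr0 oppr0.
Qed.

Lemma holoXz (k : int) f df : (forall q, H q -> f q != 0) -> holo f df ->
  holo (fun p => f p ^ k) (fun i p => k%:~R * (f p ^ k * (f p)^-1 * df i p)).
Proof.
move=> f0 [sf hf]; split; first exact: smoothXz.
move=> i p Hp; have [a1 a2] := hf i p Hp.
by rewrite (wzXz true i k f0 Hp sf) (wzXz false i k f0 Hp sf) a1 a2 !mulr0.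
Qed.

Lemma holo_cexp f df : holo f df ->
  holo (fun p => cexp (f p)) (fun i p => cexp (f p) * df i p).
Proof.
move=> [sf hf]; split; first exact: smooth_cexp.
move=> i p Hp; have [a1 a2] := hf i p Hp.
by rewrite (wz_cexp true i Hp sf) (wz_cexp false i Hp sf) a1 a2 mulr0.
Qed.

Section Chain.
Variables (G : P -> P) (D : ix -> ix -> P -> C).
Hypothesis GH : forall p, H p -> H (G p).
Hypothesis hG : forall i, holo (fun p => zc i (G p)) (D i).

Lemma smooth_comp f : smooth f -> smooth (fun p => f (G p)).
Proof.
move=> /smoothP cf; have Ho := @halfspace_open R N.
have cG k (d' : dir N) : Ck H k (fun q => G q d'.1 d'.2).
  have [/smoothP/(_ k)[g1 g2] _] := hG d'.1.
  by case: d' g1 g2 => i b /= g1 g2; case: (ord2P b) => ->.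
apply/smoothP => k; have [c1 c2] := cf k; split.
  exact: (Ck_comp Ho GH (cG k) c1).
exact: (Ck_comp Ho GH (cG k) c2).
Qed.

(** For a holomorphic map the two Wirtinger derivatives do not mix, and the
    antiholomorphic one sees the conjugate Jacobian matrix. *)
Lemma wz_comp i' f p : H p -> smooth f ->
  wz false i' (fun q => f (G q)) p = \sum_i wz false i f (G p) * D i i' p /\
  wz true i' (fun q => f (G q)) p = \sum_i wz true i f (G p) * conjc (D i i' p).
Proof.
move=> Hp sf; have sG i := (hG i).1.
have E b : wz b i' (fun q => f (G q)) p = \sum_i
   (wz false i f (G p) * wz b i' (fun q => zc i (G q)) p +
    wz true i f (G p) * conjc (wz (~~ b) i' (fun q => zc i (G q)) p)).
  have wzE (h : P -> C) : wz b i' h p = 2^-1 *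
      (pd (i', 0) h p + (if b then iC else - iC) * pd (i', 1) h p) by [].
  rewrite wzE (pd_comp (i', 0) Hp (GH Hp) sf sG) (pd_comp (i', 1) Hp (GH Hp) sf sG).
  rewrite mulr_sumr -big_split mulr_sumr; apply: eq_bigr => i _ /=.
  rewrite -(wz_conj b i' Hp (sG i)) !wzE (pd_conj (i', 0) Hp (sG i)) (pd_conj (i', 1) Hp (sG i)).
  move: (wz _ _ _ _) (wz _ _ _ _) (pd _ _ p) (pd _ _ p) (if b then _ else _) => *; ring.
rewrite !E; split; apply: eq_bigr => i _; have [h1 h2] := (hG i).2 i' p Hp.
  have c0 : conjc 0 = 0 :> C by apply: complex_ext => /=; rewrite ?oppr0.
  by rewrite h2 [~~ false]/= h1 c0 mulr0 addr0.
by rewrite h1 h2 mulr0 add0r.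
Qed.

End Chain.
End Holomorphic.

(** * The action of the Jacobi group *)

Section JacobiAction.
Local Opaque pd wz.
Variables (R : realType) (N : nat).
Local Notation C := R[i].
Local Notation iC := (Complex (0 : R) 1).
Local Notation P := (pt R N).
Local Notation H := (@halfspace R N).
Local Notation re := (@complex.Re R).
Local Notation im := (@complex.Im R).
Local Notation ix := 'I_(1 + N).
Local Notation "x ^*c" := (conjc x) (at level 2, format "x ^*c").

Lemma conjc_real (r : R) : (r%:C)^*c = r%:C :> C.
Proof. by apply: complex_ext; rewrite //= oppr0. Qed.

Lemma conjc_inv (x : C) : (x^-1)^*c = (x^*c)^-1.
Proof. exact: fmorphV. Qed.

Lemma iC_neq0 : iC != 0 :> C.
Proof. by rewrite eq_complex /= oner_eq0 andbF. Qed.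

Lemma im_conj (x : C) : (im x)%:C = (x - x^*c) / (2 * iC).
Proof.
have i0 := iC_neq0.
apply: (@mulIf _ (2 * iC)); first by rewrite mulf_neq0 // pnatr_eq0.
rewrite divfK; last by rewrite mulf_neq0 // pnatr_eq0.
by case: x => a b; rewrite (_ : 2 = 2%:R%:C) ?rmorph_nat //; apply: complex_ext => /=; ring.
Qed.

Lemma zc_tau : tau (R:=R) (N:=N) = zc ord0. Proof. by []. Qed.
Lemma zv_zc (p : P) (j : 'I_N) : zv p j 0 = zc (rshift 1 j) p.
Proof. by rewrite /zv mxE. Qed.
Lemma yc_im (p : P) : (yc p)%:C = (tau p - (tau p)^*c) / (2 * iC).
Proof. by rewrite -im_conj. Qed.
Lemma vv_im (p : P) (j : 'I_N) : (vv p j 0)%:C = (zv p j 0 - (zv p j 0)^*c) / (2 * iC).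
Proof. by rewrite -im_conj /vv /zv !mxE. Qed.

Lemma zc_mkpt (t : C) (z : 'cV[C]_N) i : zc i (mkpt t z) = col_mx t%:M z i 0.
Proof.
have E k : mkpt t z i k = if k == 0 then re (col_mx t%:M z i 0) else im (col_mx t%:M z i 0).
  by rewrite /mkpt mxE.
by rewrite /zc !E /= -complexE.
Qed.

Lemma zc_mkpt0 (t : C) (z : 'cV[C]_N) : zc ord0 (mkpt t z) = t.
Proof.
rewrite zc_mkpt; have -> : ord0 = lshift N (ord0 : 'I_1) by exact: val_inj.
by rewrite (col_mxEu t%:M z) mxE eqxx.
Qed.

Lemma zc_mkptr (t : C) (z : 'cV[C]_N) j : zc (rshift 1 j) (mkpt t z) = z j 0.
Proof. by rewrite zc_mkpt (col_mxEd t%:M z). Qed.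

Variable g : jacobi R N.
Local Notation a := ((jM g 0 0)%:C).
Local Notation b := ((jM g 0 1)%:C).
Local Notation c := ((jM g 1 0)%:C).
Local Notation d := ((jM g 1 1)%:C).
Local Notation X1 j := ((jX g j 0)%:C).
Local Notation X2 j := ((jX g j 1)%:C).

Lemma jdet : jM g 0 0 * jM g 1 1 - jM g 0 1 * jM g 1 0 = 1.
Proof.
rewrite -(jM_det g) (expand_det_row _ ord0) !big_ord_recl big_ord0 /cofactor !det_mx11 !mxE.
rewrite /= !expr0 /bump /= expr1 addr0.
have E0 : ord0 = 0 :> 'I_2 by exact: val_inj.
have E1 : lift ord0 ord0 = 1 :> 'I_2 by exact: val_inj.
have E2 : lift 1 ord0 = 0 :> 'I_2 by exact: val_inj.
rewrite !E0 !E1 !E2; ring.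
Qed.

Lemma jdetC : a * d - b * c = 1.
Proof. by rewrite -!rmorphM -rmorphB jdet. Qed.

Definition den (p : P) : C := c * tau p + d.
Definition bt (p : P) : C := beta (jM g) (tau p).

(** The numerator zeta = z + X_1 tau + X_2 of the transformed elliptic
    variable. *)
Definition zt (j : 'I_N) (p : P) : C := zv p j 0 + tau p * X1 j + X2 j.

(** omega = X_1 - c beta zeta governs everything that follows: it is the
    derivative of the transformed z by tau divided by beta, the translation of
    v / y, and, contracted with 2 pi i L, up to a constant the logarithmic
    derivative of the multiplier. *)
Definition om (j : 'I_N) (p : P) : C := X1 j - c * bt p * zt j p.

Lemma btE p : bt p = (den p)^-1. Proof. by []. Qed.

Lemma den_neq0 p : H p -> den p != 0.
Proof.
rewrite /halfspace /yc /den /tau => Hp; rewrite eq_complex /=.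
apply/negP => /andP[/eqP e1 /eqP e2].
have c0 : jM g 1 0 = 0.
  apply/eqP; move/eqP: e2; rewrite mul0r !addr0 mulf_eq0 => /orP[//|/eqP e].
  by move: Hp; rewrite /= e ltxx.
move: e1; rewrite c0 !mul0r subr0 add0r => d0.
by have := jdet; rewrite c0 d0 !mulr0 subr0 => /esym/eqP; rewrite oner_eq0.
Qed.

Lemma bt_neq0 p : H p -> bt p != 0.
Proof. by move=> Hp; rewrite btE invr_eq0 den_neq0. Qed.

Lemma jshiftE p j : jshift g p j 0 = zt j p.
Proof. by rewrite /jshift /zt !mxE. Qed.

Lemma zc_act0 p : zc ord0 (act g p) = (a * tau p + b) * bt p.
Proof. by rewrite /act zc_mkpt0. Qed.

Lemma zc_actr p j : zc (rshift 1 j) (act g p) = bt p * zt j p.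
Proof. by rewrite /act zc_mkptr mxE jshiftE. Qed.

Lemma conj_den p : (den p)^*c = c * (tau p)^*c + d.
Proof. by rewrite /den conjC_D conjC_M !conjc_real. Qed.

Lemma conj_neq0 (x : C) : x != 0 -> x^*c != 0.
Proof. by rewrite (fmorph_eq0 (@conjc R)). Qed.

Lemma yc_act p : H p -> (yc (act g p))%:C = (yc p)%:C * bt p * (bt p)^*c.
Proof.
move=> Hp; rewrite !yc_im zc_tau zc_act0 -zc_tau btE conjC_M conjC_D conjC_M !conjc_real conjc_inv.
have d0 := den_neq0 Hp; have d0' := conj_neq0 d0.
move: d0 d0'; rewrite conj_den /den; move: (tau p) (tau p)^*c => t tb d0 d0'.
have i0 := iC_neq0; have det := jdetC.
move: a b c d det d0 d0' iC i0 => a' b' c' d' det d0 d0' I I0.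
have -> : (a' * t + b') / (c' * t + d') - (a' * tb + b') / (c' * tb + d') =
    (a' * d' - b' * c') * (t - tb) / (c' * t + d') / (c' * tb + d') by field; rewrite d0 d0'.
by rewrite det; field; rewrite I0 d0 d0'.
Qed.

Lemma act_H p : H p -> H (act g p).
Proof.
move=> Hp; have := yc_act Hp; have := bt_neq0 Hp.
case: (bt p) => r s; rewrite eq_complex /= => rs0 /(congr1 re) /= E.
rewrite /halfspace /= E; move: Hp; rewrite /halfspace /=.
have : 0 < r ^+ 2 + s ^+ 2.
  by rewrite lt0r paddr_eq0 ?sqr_ge0 // !sqrf_eq0 rs0 /= addr_ge0 ?sqr_ge0.
by move=> h h'; rewrite (_ : _ - _ = yc p * (r ^+ 2 + s ^+ 2)) ?mulr_gt0 //; ring.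
Qed.

(** The vector v / y is translated by omega and rescaled by 1 / beta, which is
    what makes the zero-order terms of the raising operators compensate the
    logarithmic derivative of the multiplier. *)
Lemma vv_act p j : H p ->
  (vv (act g p) j 0)%:C = (bt p)^*c * ((vv p j 0)%:C + (yc p)%:C * om j p).
Proof.
move=> Hp; rewrite !vv_im yc_im /om !zv_zc zc_actr /zt zv_zc btE.
rewrite !conjC_M !conjC_D !conjC_M !conjc_real conjc_inv.
have d0 := den_neq0 Hp; have d0' := conj_neq0 d0.
move: d0 d0'; rewrite conj_den /den; move: (tau p) (tau p)^*c => t tb d0 d0'.
have i0 := iC_neq0.
move: (zc _ p) (zc _ p)^*c (X1 j) (X2 j) => z zb x1 x2.
move: c d d0 d0' iC i0 => c' d' d0 d0' I I0.
by field; rewrite I0 d0 d0'.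
Qed.

Lemma vv_act' p j : H p ->
  (vv (act g p) j 0)%:C = bt p * ((vv p j 0)%:C + (yc p)%:C * (om j p)^*c).
Proof.
move=> Hp; have := congr1 (@conjc R) (vv_act j Hp).
by rewrite conjC_M conjC_D conjC_M !conjc_real conjcK.
Qed.

(** The rule that trades the c coming from the derivative of beta^k for the
    ratio of beta to its conjugate, as needed for the term k / y of X_+. *)
Lemma bt_ratio p : H p -> bt p = (bt p)^*c * (1 - 2 * iC * c * (yc p)%:C * bt p).
Proof.
move=> Hp; rewrite yc_im btE conjc_inv.
have d0 := den_neq0 Hp; have d0' := conj_neq0 d0.
move: d0 d0'; rewrite conj_den /den; move: (tau p) (tau p)^*c => t tb d0 d0'.
have i0 := iC_neq0.
move: c d d0 d0' iC i0 => c' d' d0 d0' I I0.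
by field; rewrite I0 d0 d0'.
Qed.

Lemma holo_tau : holo (tau (R:=R) (N:=N)) (fun i _ => (i == ord0)%:R).
Proof. exact: holo_zc. Qed.

Lemma holo_den : holo den (fun i _ => c * (i == ord0)%:R).
Proof.
apply: holo_ext (holoD (holoZ c holo_tau) (holo_cst N d)) _ _ => // i p _.
by rewrite addr0.
Qed.

Lemma holo_bt : holo bt (fun i p => - (c * bt p * bt p * (i == ord0)%:R)).
Proof.
apply: holo_ext (holoV den_neq0 holo_den) _ _ => // i p _; rewrite !btE.
by move: (_ == _)%:R (den p) => *; ring.
Qed.

Lemma holo_zt j : holo (zt j) (fun i _ => (i == rshift 1 j)%:R + (i == ord0)%:R * X1 j).
Proof.
have h := holoD (holoD (holo_zc R (rshift 1 j)) (holoM holo_tau (holo_cst N (X1 j)))) (holo_cst N (X2 j)).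
apply: holo_ext h _ _ => [p _|i p _]; first by rewrite /zt zv_zc.
by rewrite mulr0 !addr0.
Qed.

(** The Jacobian matrix of the action: the derivative of the coordinate [i'] of
    the image along the coordinate [i]. *)
Definition actD (i' i : ix) (p : P) : C :=
  if i' == ord0 then (i == ord0)%:R * bt p ^+ 2
  else match fintype.split i' with
       | inl _ => 0
       | inr j => bt p * (i == i')%:R + (i == ord0)%:R * bt p * om j p
       end.

Lemma split_rshift1 (j : 'I_N) : fintype.split (rshift 1 j : ix) = inr j.
Proof. exact: (unsplitK (inr j)). Qed.

Lemma holo_act i' : holo (fun p => zc i' (act g p)) (actD i').
Proof.
case: (split1P i') => [|j]; rewrite /actD.
  have h := holoM (holoD (holoZ a holo_tau) (holo_cst N b)) holo_bt.
  apply: holo_ext h _ _ => [p _|i p Hp]; first by rewrite zc_act0.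
  rewrite /= addr0 btE; have d0 := den_neq0 Hp; move: d0; rewrite /den.
  move: (_ == _)%:R (tau p) jdetC => x t det d0.
  (* ad - bc = 1 is used once, in the derivative of the modular variable. *)
  rewrite -[x in RHS]mul1r -det; field; exact: d0.
have h := holoM holo_bt (holo_zt j).
apply: holo_ext h _ _ => [p _|i p Hp]; first by rewrite zc_actr.
rewrite rshift1_neq0 split_rshift1 /om.
by move: (i == ord0)%:R (i == rshift 1 j)%:R (bt p) (zt j p) => *; ring.
Qed.

(** 2 pi i tr(LA) expanded into coordinates. *)
Definition alE (L : 'M[C]_N) (p : P) : C := \sum_x \sum_y calL L x y *
   ((jk g y x)%:C + X2 y * X1 x + X1 y * zv p x 0 + zv p y 0 * X1 x
     + tau p * (X1 y * X1 x) - c * bt p * (zt y p * zt x p)).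

Lemma index_matrixE (K : 'M[C]_N) (A B Z S : 'cV[C]_N) (t s : C) y x :
  (K + B *m A^T + A *m Z^T + Z *m A^T + t *: (A *m A^T) - s *: (S *m S^T)) y x =
  K y x + B y 0 * A x 0 + A y 0 * Z x 0 + Z y 0 * A x 0 + t * (A y 0 * A x 0)
  - s * (S y 0 * S x 0).
Proof. by rewrite !mxE !big_ord1 !mxE. Qed.

Lemma alphaE L p : alpha L g p = cexp (alE L p).
Proof.
rewrite /alpha /alE /calL; congr cexp.
rewrite /mxtrace mulr_sumr; apply: eq_bigr => x _.
rewrite mxE mulr_sumr; apply: eq_bigr => y _.
rewrite index_matrixE !jshiftE [in RHS]mxE -[in RHS]mulrA; congr (_ * (_ * _)).
have E1 k : map_mx (real_complex R) (col 0 (jX g)) k 0 = X1 k by rewrite !mxE.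
have E2 k : map_mx (real_complex R) (col 1 (jX g)) k 0 = X2 k by rewrite !mxE.
have E3 : map_mx (real_complex R) (jk g) y x = (jk g y x)%:C by rewrite mxE.
by rewrite !E1 !E2 E3.
Qed.

(** The exponent of the multiplier is quadratic in X_1 and zeta; its gradient
    collapses to expressions in omega, because the derivatives of the term in
    c beta complete X_1 to omega in each factor. *)
Lemma holo_alpha L : holo (alpha L g) (fun i p => alpha L g p *
  \sum_x \sum_y calL L x y * ((i == ord0)%:R * (om y p * om x p)
     + om y p * (i == rshift 1 x)%:R + om x p * (i == rshift 1 y)%:R)).
Proof.
have h x y :=
   holoD (holoD (holoD (holoD (holo_cst N ((jk g y x)%:C + X2 y * X1 x))
     (holoZ (X1 y) (holo_zc R (rshift 1 x))))
     (holoM (holo_zc R (rshift 1 y)) (holo_cst N (X1 x))))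
     (holoM holo_tau (holo_cst N (X1 y * X1 x))))
     (holoZ (-1) (holoM (holoZ c holo_bt) (holoM (holo_zt y) (holo_zt x)))).
have h2 := holo_cexp (holo_sum (index_enum 'I_N) (fun x =>
   holo_sum (index_enum 'I_N) (fun y => holoZ (calL L x y) (h x y)))).
apply: (holo_ext h2) => [p _|i p Hp].
  rewrite alphaE /alE; congr cexp; apply: eq_bigr => x _; apply: eq_bigr => y _.
  by rewrite !zv_zc mulN1r.
rewrite alphaE /alE; congr (cexp _ * _).
  apply: eq_bigr => x _; apply: eq_bigr => y _.
  by rewrite !zv_zc mulN1r.
apply: eq_bigr => x _; apply: eq_bigr => y _; congr (_ * _); rewrite /om.
move: (zt x p) (zt y p) (X1 x) (X1 y) (i == rshift 1 x)%:R (i == rshift 1 y)%:R.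
by move: (i == ord0)%:R (bt p) c => *; ring.
Qed.

End JacobiAction.

(** * Raising and lowering operators in Wirtinger form *)

Section Letters.
Local Opaque pd wz smooth.
Variables (R : realType) (N : nat).
Local Notation C := R[i].
Local Notation iC := (Complex (0 : R) 1).
Local Notation P := (pt R N).
Local Notation H := (@halfspace R N).
Implicit Types (f : P -> C) (p : P) (k : int) (L : 'M[C]_N).

Definition yC p : C := (yc p)%:C.
Definition vC p (j : 'I_N) : C := (vv p j 0)%:C.

Lemma yC_neq0 p : H p -> yC p != 0.
Proof. by move=> Hp; rewrite /yC (fmorph_eq0 (real_complex R)) gt_eqF. Qed.

Lemma XmE f p : Xm f p = - (2 * iC * yC p) *
  (yC p * wz true ord0 f p + \sum_j vC p j * wz true (rshift 1 j) f p).
Proof. by []. Qed.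

Lemma YmE j f p : Ym j f p = - (iC * yC p) * wz true (rshift 1 j) f p.
Proof. by []. Qed.

Lemma calL_mulv L p j : (calL L *m map_mx (real_complex R) (vv p)) j 0 = \sum_l calL L j l * vC p l.
Proof. by rewrite mxE; apply: eq_bigr => l _; rewrite [map_mx _ _ _ _]mxE. Qed.

Lemma calL_form L p : ((map_mx (real_complex R) (vv p))^T *m calL L *m map_mx (real_complex R) (vv p)) 0 0
  = \sum_x \sum_y calL L x y * (vC p x * vC p y).
Proof.
rewrite -mulmxA mxE; apply: eq_bigr => x _; rewrite calL_mulv mulr_sumr.
apply: eq_bigr => y _.
have -> : (map_mx (real_complex R) (vv p))^T 0 x = vC p x.
  by rewrite mxE [map_mx _ _ _ _]mxE.
by rewrite mulrA [_ * calL L x y]mulrC mulrA.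
Qed.

Lemma XpE k L f p : Xp k L f p = 2 * iC * (wz false ord0 f p
    + (yC p)^-1 * (\sum_j vC p j * wz false (rshift 1 j) f p)
    + (yC p) ^- 2 * (\sum_x \sum_y calL L x y * (vC p x * vC p y)) * f p)
  + k%:~R * (yC p)^-1 * f p.
Proof.
rewrite /Xp calL_form /dtau /vdot /dz !wirtE.
by congr (_ * (_ + _ * _ + _) + _); apply: eq_bigr => j _; rewrite wirtE.
Qed.

Lemma YpE L j f p : Yp L j f p = iC * wz false (rshift 1 j) f p
  + 2 * iC * (yC p)^-1 * (\sum_l calL L j l * vC p l) * f p.
Proof. by rewrite /Yp calL_mulv /dz wirtE. Qed.

Lemma smooth_yC : smooth yC. Proof. exact: (smooth_coord (ord0, 1)). Qed.
Lemma smooth_vC j : smooth (vC^~ j).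
Proof.
apply: smooth_ext (@smooth_coord R N (rshift 1 j, 1)) => p _.
by rewrite /vC mxE.
Qed.

Lemma letter_ext k L a f h p : H p -> eqH f h ->
  letter_op k L a f p = letter_op k L a h p.
Proof.
move=> Hp fh; have E b i := wz_ext b i Hp fh; have fhp := fh p Hp.
have ES b : \sum_j vC p j * wz b (rshift 1 j) f p = \sum_j vC p j * wz b (rshift 1 j) h p.
  by apply: eq_bigr => j _; rewrite (E b).
case: a => [[j|]|[j|]]; rewrite /letter_op.
- by rewrite !YpE (E false) fhp.
- by rewrite !XpE (E false) (ES false) fhp.
- by rewrite !YmE (E true).
- by rewrite !XmE (E true) (ES true).
Qed.

Lemma smooth_letter k L a f : smooth f -> smooth (letter_op k L a f).
Proof.
move=> sf; have sy := smooth_yC; have sv := smooth_vC.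
have sy1 : smooth (fun p => (yC p)^-1) by exact: (smoothV yC_neq0 sy).
have sw b i := smooth_wz b i sf.
have sc (z : C) := @smooth_cst R N z.
have sM (u v : P -> C) (su : smooth u) (sv' : smooth v) := smoothM su sv'.
have sS b := smooth_sum (index_enum 'I_N) (fun j => sM _ _ (sv j) (sw b (rshift 1 j))).
case: a => [[j|]|[j|]].
- have sl := smooth_sum (index_enum 'I_N) (fun l => sM _ _ (sc (calL L j l)) (sv l)).
  have h := smoothD (sM _ _ (sc iC) (sw false (rshift 1 j)))
    (sM _ _ (sM _ _ (sM _ _ (sc (2 * iC)) sy1) sl) sf).
  by apply: (smooth_ext _ h) => p _; exact: esym (YpE L j f p).
- have sq := smooth_sum (index_enum 'I_N) (fun x => smooth_sum (index_enum 'I_N)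
    (fun z => sM _ _ (sc (calL L x z)) (sM _ _ (sv x) (sv z)))).
  have sy2 : smooth (fun p => yC p ^- 2).
    by apply: (smooth_ext _ (sM _ _ sy1 sy1)) => p _; rewrite -expr2 exprVn.
  have h := smoothD (sM _ _ (sc (2 * iC)) (smoothD (smoothD (sw false ord0)
      (sM _ _ sy1 (sS false))) (sM _ _ (sM _ _ sy2 sq) sf)))
      (sM _ _ (sM _ _ (sc k%:~R) sy1) sf).
  by apply: (smooth_ext _ h) => p _; exact: esym (XpE k L f p).
- have h := sM _ _ (sM _ _ (sc (-1)) (sM _ _ (sc iC) sy)) (sw true (rshift 1 j)).
  by apply: (smooth_ext _ h) => p _; rewrite mulN1r; exact: esym (YmE j f p).
- have h := sM _ _ (sM _ _ (sc (-1)) (sM _ _ (sc (2 * iC)) sy))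
    (smoothD (sM _ _ sy (sw true ord0)) (sS true)).
  by apply: (smooth_ext _ h) => p _; rewrite mulN1r; exact: esym (XmE f p).
Qed.

Lemma smooth_word k L w f : smooth f -> smooth (word_op k L w f).
Proof. by move=> sf; elim: w => [|a w IH]; [exact: sf | exact: (smooth_letter _ _ _ IH)]. Qed.

End Letters.

(** * Covariance of words in the raising and lowering operators *)

Section Covariance.
Local Opaque pd wz smooth.
Variables (R : realType) (N : nat).
Local Notation C := R[i].
Local Notation iC := (Complex (0 : R) 1).
Local Notation P := (pt R N).
Local Notation H := (@halfspace R N).
Local Notation ix := 'I_(1 + N).
Local Notation "x ^*c" := (conjc x) (at level 2, format "x ^*c").
Variables (L : 'M[C]_N) (g : jacobi R N).
Hypothesis hL : L^T = L.
Local Notation c := ((jM g 1 0)%:C).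
Implicit Types (f : P -> C) (p : P) (k : int).

(** The factor of automorphy of weight [k] and index [L]; [lam k i] is its
    logarithmic derivative in the i-th complex coordinate. *)
Definition jfac k p : C := bt g p ^ k * alpha L g p.
Definition lam k (i : ix) p : C := - (k%:~R * c * bt g p * (i == ord0)%:R) +
  \sum_x \sum_y calL L x y * ((i == ord0)%:R * (om g y p * om g x p)
     + om g y p * (i == rshift 1 x)%:R + om g x p * (i == rshift 1 y)%:R).

Lemma holo_jfac k : holo (jfac k) (fun i p => jfac k p * lam k i p).
Proof.
have h := holoM (holoXz k (@bt_neq0 _ _ g) (holo_bt g)) (holo_alpha g L).
apply: holo_ext h _ _ => // i p Hp.
rewrite /jfac /lam; have b0 := bt_neq0 g Hp.
set s := (X in _ * (_ + X)).
rewrite -[X in _ + _ * (_ * X)]/s.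
move: s (i == ord0)%:R (alpha L g p) (k%:~R) (bt g p ^ k) (bt g p) b0 => s x al K bk b b0.
by field.
Qed.

Lemma calL_sym : (calL L)^T = calL L.
Proof. by rewrite /calL linearZ /= hL. Qed.

Lemma calL_symE x y : calL L x y = calL L y x.
Proof. by rewrite -[in LHS]calL_sym mxE. Qed.

Lemma lam0 k p : lam k ord0 p = - (k%:~R * c * bt g p)
  + \sum_x \sum_y calL L x y * (om g x p * om g y p).
Proof.
rewrite /lam eqxx mulr1; congr (_ + _); apply: eq_bigr => x _; apply: eq_bigr => y _.
by rewrite ![ord0 == _]eq_sym !rshift1_neq0 !mulr0 !addr0 mul1r [X in _ * X]mulrC.
Qed.

Lemma lamr k l p : lam k (rshift 1 l) p = 2 * \sum_y calL L l y * om g y p.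
Proof.
rewrite /lam rshift1_neq0 mulr0 oppr0 add0r.
under eq_bigr => x _ do under eq_bigr => y _ do
  rewrite mul0r add0r !eq_rshift1 mulrDr.
under eq_bigr => x _ do rewrite big_split /=.
rewrite big_split /= mulr_natl mulr2n; congr (_ + _).
  rewrite (bigD1 l) //= [X in _ + X]big1 ?addr0; last first.
    move=> x xl; apply: big1 => y _.
    by rewrite eq_sym (negPf xl) !mulr0.
  by apply: eq_bigr => y _; rewrite eqxx mulr1.
rewrite exchange_big (bigD1 l) //= [X in _ + X]big1 ?addr0; last first.
  move=> x xl; apply: big1 => y _.
  by rewrite eq_sym (negPf xl) !mulr0.
by apply: eq_bigr => y _; rewrite eqxx mulr1 calL_symE.
Qed.

Lemma smooth_act f : smooth f -> smooth (fun p => f (act g p)).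
Proof. exact: (smooth_comp (@act_H _ _ g) (holo_act g)). Qed.

Lemma slashE k f p : slash k L g f p = jfac k p * f (act g p).
Proof. by []. Qed.

Lemma smooth_slash k f : smooth f -> smooth (slash k L g f).
Proof. by move=> sf; exact: (smoothM (holo_jfac k).1 (smooth_act sf)). Qed.

Lemma wz_slash_false k i f p : H p -> smooth f ->
  wz false i (slash k L g f) p = jfac k p * (lam k i p * f (act g p) +
    \sum_i' wz false i' f (act g p) * actD g i' i p).
Proof.
move=> Hp sf; have [sj hj] := holo_jfac k; have [_ dj] := hj i p Hp.
have [E _] := wz_comp (@act_H _ _ g) (holo_act g) i Hp sf.
rewrite -[slash k L g f]/(fun q => jfac k q * f (act g q)).
by rewrite (wzM false i Hp sj (smooth_act sf)) dj E -mulrA -mulrDr.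
Qed.

Lemma wz_slash_true k i f p : H p -> smooth f ->
  wz true i (slash k L g f) p =
    jfac k p * \sum_i' wz true i' f (act g p) * (actD g i' i p)^*c.
Proof.
move=> Hp sf; have [sj hj] := holo_jfac k; have [dj _] := hj i p Hp.
have [_ E] := wz_comp (@act_H _ _ g) (holo_act g) i Hp sf.
rewrite -[slash k L g f]/(fun q => jfac k q * f (act g q)).
by rewrite (wzM true i Hp sj (smooth_act sf)) dj E mul0r add0r.
Qed.

Lemma actD00 p : actD g ord0 ord0 p = bt g p ^+ 2.
Proof. by rewrite /actD eqxx mul1r. Qed.
Lemma actD0r l p : actD g ord0 (rshift 1 l) p = 0.
Proof. by rewrite /actD eqxx rshift1_neq0 mul0r. Qed.
Lemma actDr0 j p : actD g (rshift 1 j) ord0 p = bt g p * om g j p.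
Proof. by rewrite /actD rshift1_neq0 split_rshift1 eqxx eq_sym rshift1_neq0 mulr0 add0r mul1r. Qed.
Lemma actDrr j l p : actD g (rshift 1 j) (rshift 1 l) p = bt g p * (l == j)%:R.
Proof. by rewrite /actD rshift1_neq0 split_rshift1 rshift1_neq0 eq_rshift1 !mul0r addr0. Qed.

Lemma jfacD k (n : int) p : H p -> jfac (k + n) p = bt g p ^ n * jfac k p.
Proof.
move=> Hp; rewrite /jfac (expfzDr k n (bt_neq0 g Hp)).
by rewrite mulrA [_ ^ n * _]mulrC.
Qed.

Local Opaque actD jfac lam om bt act.

Section AtPoint.
Variables (k : int) (f : P -> C) (p : P).
Hypotheses (Hp : H p) (sf : smooth f).
Local Notation b := (bt g p).
Local Notation o j := (om g j p).
Local Notation q := (act g p).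

Lemma actDll l : actD g (rshift 1 l) (rshift 1 l) p = b.
Proof. by rewrite actDrr eqxx mulr1. Qed.

Lemma actD_neq j l : j != l -> actD g (rshift 1 j) (rshift 1 l) p = 0.
Proof. by move=> jl; rewrite actDrr eq_sym (negPf jl) mulr0. Qed.

Lemma wz_slash_f0 : wz false ord0 (slash k L g f) p = jfac k p *
  (lam k ord0 p * f q + (b ^+ 2 * wz false ord0 f q
    + b * \sum_j o j * wz false (rshift 1 j) f q)).
Proof.
have E : \sum_i' wz false i' f q * actD g i' ord0 p = b ^+ 2 * wz false ord0 f q
    + b * \sum_j o j * wz false (rshift 1 j) f q.
  rewrite sum1N actD00 [X in X + _]mulrC; congr (_ + _).
  by rewrite mulr_sumr; apply: eq_bigr => j _; rewrite actDr0 mulrC mulrA.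
by rewrite (wz_slash_false k ord0 Hp sf) E.
Qed.

Lemma wz_slash_fr l : wz false (rshift 1 l) (slash k L g f) p = jfac k p *
  (lam k (rshift 1 l) p * f q + b * wz false (rshift 1 l) f q).
Proof.
have E : \sum_i' wz false i' f q * actD g i' (rshift 1 l) p = b * wz false (rshift 1 l) f q.
  have E0 : wz false ord0 f q * actD g ord0 (rshift 1 l) p = 0 by rewrite actD0r mulr0.
  rewrite sum1N; apply: etrans (congr1 (+%R^~ _) E0) _; rewrite add0r (bigD1 l isT) actDll big1.
    by rewrite /= addr0 mulrC.
  by move=> j jl; rewrite (actD_neq jl) mulr0.
by rewrite (wz_slash_false k _ Hp sf) E.
Qed.

Lemma wz_slash_t0 : wz true ord0 (slash k L g f) p = jfac k p *
  (b^*c ^+ 2 * wz true ord0 f q + b^*c * \sum_j (o j)^*c * wz true (rshift 1 j) f q).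
Proof.
have E : \sum_i' wz true i' f q * (actD g i' ord0 p)^*c = b^*c ^+ 2 * wz true ord0 f q
    + b^*c * \sum_j (o j)^*c * wz true (rshift 1 j) f q.
  rewrite sum1N actD00 [X in X + _]mulrC; congr (_ + _).
    by congr (_ * _); rewrite !expr2 conjC_M.
  by rewrite mulr_sumr; apply: eq_bigr => j _; rewrite actDr0 mulrC conjC_M mulrA.
by rewrite (wz_slash_true k ord0 Hp sf) E.
Qed.

Lemma wz_slash_tr l : wz true (rshift 1 l) (slash k L g f) p = jfac k p *
  (b^*c * wz true (rshift 1 l) f q).
Proof.
have c0 : (0 : C)^*c = 0 by apply: complex_ext => /=; rewrite ?oppr0.
have E : \sum_i' wz true i' f q * (actD g i' (rshift 1 l) p)^*c = b^*c * wz true (rshift 1 l) f q.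
  have E0 : wz true ord0 f q * (actD g ord0 (rshift 1 l) p)^*c = 0 by rewrite actD0r c0 mulr0.
  rewrite sum1N; apply: etrans (congr1 (+%R^~ _) E0) _; rewrite add0r (bigD1 l isT) actDll big1.
    by rewrite /= addr0 mulrC.
  by move=> j jl; rewrite (actD_neq jl) c0 mulr0.
by rewrite (wz_slash_true k _ Hp sf) E.
Qed.

(** Covariance of the four kinds of operators, by direct computation.  With the
    transformation laws of y and v all quantities at the image point are
    expressed at the source point.  The lowering operators only see the
    conjugate Jacobian matrix and no derivative of the multiplier; for the
    raising operators the logarithmic derivative of the multiplier is exactly
    the discrepancy of their zero-order terms. *)
Lemma letter_slash a :
  letter_op k L a (slash k L g f) p = slash (k + letter_wt a) L g (letter_op k L a f) p.
Proof.
have b0 := bt_neq0 g Hp; have b0' := conj_neq0 b0.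
have y0 := yC_neq0 Hp; have iC0 := @iC_neq0 R.
have yE : yC q = yC p * b * b^*c := yc_act g Hp.
have vE j : vC q j = b^*c * (vC p j + yC p * o j) := vv_act g j Hp.
have vE' j : vC q j = b * (vC p j + yC p * (o j)^*c) := vv_act' g j Hp.
rewrite slashE (jfacD _ _ Hp).
case: a => [[j|]|[j|]] /=.
- rewrite !YpE wz_slash_fr slashE lamr yE expr1z.
  have -> : \sum_l calL L j l * vC q l = b^*c * (\sum_l calL L j l * vC p l)
     + b^*c * yC p * \sum_l calL L j l * o l.
    rewrite !mulr_sumr -big_split; apply: eq_bigr => l _ /=; rewrite vE.
    move: (calL L j l) (vC p l) (o l) (yC p) (b^*c) => *; ring.
  move: (\sum_l calL L j l * vC p l) (\sum_l calL L j l * o l) (jfac k p) (f q) (wz false _ _ _).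
  by move: (yC p) (b^*c) b iC y0 b0' b0 => *; field; do ?[apply/andP; split].
(* [bt_ratio] solved for c beta. *)
- have cE : c * b = (1 - b / b^*c) / (2 * iC * yC p).
    have -> : b / b^*c = 1 - 2 * iC * c * yC p * b.
      by rewrite {1}(bt_ratio g Hp) [b^*c * _]mulrC mulfK.
    move: c (yC p) b iC iC0 y0 => c' y b' I I0 y0.
    by field; rewrite I0 y0.
  rewrite !XpE wz_slash_f0 slashE lam0 yE -[k%:~R * c * b]mulrA cE.
  have -> : \sum_j vC p j * wz false (rshift 1 j) (slash k L g f) p =
     jfac k p * (2 * (\sum_j vC p j * \sum_l calL L j l * o l) * f q
       + b * \sum_j vC p j * wz false (rshift 1 j) f q).
    rewrite -mulrA mulr_suml !mulr_sumr -big_split mulr_sumr; apply: eq_bigr => j _ /=.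
    rewrite wz_slash_fr lamr.
    move: (\sum_l _) (wz false _ _ _) (vC p j) (jfac k p) (f q) b => *; ring.
  have -> : \sum_j vC q j * wz false (rshift 1 j) f q =
     b^*c * (\sum_j vC p j * wz false (rshift 1 j) f q) +
     b^*c * yC p * \sum_j o j * wz false (rshift 1 j) f q.
    rewrite !mulr_sumr -big_split; apply: eq_bigr => j _ /=; rewrite vE.
    move: (wz false _ _ _) (vC p j) (o j) (yC p) (b^*c) => *; ring.
  have -> : \sum_x \sum_y calL L x y * (vC q x * vC q y) =
      b^*c ^+ 2 * (\sum_x \sum_y calL L x y * (vC p x * vC p y)
      + 2 * yC p * (\sum_j vC p j * \sum_l calL L j l * o l)
      + yC p ^+ 2 * \sum_x \sum_y calL L x y * (o x * o y)).
    have E1 : \sum_x vC p x * (\sum_l calL L x l * o l) = \sum_x \sum_l calL L x l * (vC p x * o l).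
      apply: eq_bigr => x _; rewrite mulr_sumr; apply: eq_bigr => l _.
      by rewrite mulrCA.
    have E2 : \sum_x vC p x * (\sum_l calL L x l * o l) = \sum_x \sum_l calL L x l * (o x * vC p l).
      rewrite E1 exchange_big; apply: eq_bigr => l _; apply: eq_bigr => x _.
      by rewrite calL_symE [_ * o _]mulrC.
    rewrite -[2 * yC p * _]mulrA mulr_natl mulr2n {1}E1 E2.
    rewrite !mulr_sumr -!big_split mulr_sumr; apply: eq_bigr => x _ /=.
    rewrite !mulr_sumr -!big_split mulr_sumr; apply: eq_bigr => l _ /=.
    rewrite !vE; move: (calL L x l) (vC p x) (vC p l) (o x) (o l) (yC p) (b^*c) => *; ring.
  rewrite -[b ^ _]/(b ^+ 2).
  move: (\sum_j vC p j * \sum_l calL L j l * o l) (\sum_x \sum_y calL L x y * (vC p x * vC p y))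
    (\sum_x \sum_y calL L x y * (o x * o y)) (\sum_j vC p j * wz false (rshift 1 j) f q)
    (\sum_j o j * wz false (rshift 1 j) f q).
  move: (wz false _ _ _) (jfac k p) (f q) (k%:~R : C).
  move: (yC p) (b^*c) b iC y0 b0' b0 iC0 => y bb b' I y0 b0' b0 I0 *.
  by field; rewrite I0 y0 b0 b0'.
- rewrite !YmE wz_slash_tr yE.
  move: (wz true _ _ _) (jfac k p) => w J; rewrite -[- 1%:Z]/(-1) exprN1.
  by move: (yC p) (b^*c) b iC y0 b0' b0 => *; field.
- rewrite !XmE wz_slash_t0 yE.
  have -> : \sum_j vC p j * wz true (rshift 1 j) (slash k L g f) p =
     jfac k p * b^*c * \sum_j vC p j * wz true (rshift 1 j) f q.
    rewrite mulr_sumr; apply: eq_bigr => j _; rewrite wz_slash_tr.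
    move: (wz true _ _ _) (vC p j) (b^*c) (jfac k p) => *; ring.
  have -> : \sum_j vC q j * wz true (rshift 1 j) f q =
     b * (\sum_j vC p j * wz true (rshift 1 j) f q) +
     b * yC p * \sum_j (o j)^*c * wz true (rshift 1 j) f q.
    rewrite !mulr_sumr -big_split; apply: eq_bigr => j _ /=; rewrite vE'.
    move: (wz true _ _ _) (vC p j) (o j)^*c (yC p) b => *; ring.
  rewrite -[- 2%:Z]/(-2) -[b ^ _]/(b ^- 2).
  move: (\sum_j vC p j * wz true (rshift 1 j) f q) (\sum_j (o j)^*c * wz true (rshift 1 j) f q).
  move: (wz true _ _ _) (jfac k p).
  by move: (yC p) (b^*c) b iC y0 b0' b0 => *; field.
Qed.

End AtPoint.

(** The superscripts of a product are supplied so that the weight reached by one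
    letter is the one at which the next letter acts; hence covariance passes to
    words letter by letter. *)
Lemma word_slash k w f p : H p -> smooth f ->
  word_op k L w (slash k L g f) p = slash (k + word_wt w) L g (word_op k L w f) p.
Proof.
move=> + sf; elim: w p => [|a w IH] p Hp /=; first by rewrite /word_wt big_nil addr0.
rewrite (letter_ext _ _ _ Hp IH) letter_slash //; last exact: smooth_word.
by rewrite /word_wt big_cons -addrA [letter_wt a + _]addrC.
Qed.

End Covariance.

(** * Second-order contractions and their commutation rules *)

Section ContractedOperators.
Local Opaque pd wz smooth.
Variables (R : realType) (N : nat).
Local Notation C := R[i].
Local Notation iC := (Complex (0 : R) 1).
Local Notation P := (pt R N).
Local Notation H := (@halfspace R N).
Local Notation ix := 'I_(1 + N).
Local Notation y := (@yC R N).
Local Notation v := (@vC R N).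
Local Notation r j := (rshift 1 j : 'I_(1 + N)).
Implicit Types (f h : P -> C) (p q : P) (c d e : bool).

Lemma congr_mull (x a b : C) : a = b -> x * a = x * b.
Proof. by move=> ->. Qed.

Lemma sum2_lin (I : finType) (A B D : I -> I -> C) (s t : C) :
  \sum_a \sum_b (A a b + s * B a b + t * D a b) =
  \sum_a \sum_b A a b + s * (\sum_a \sum_b B a b) + t * \sum_a \sum_b D a b.
Proof.
rewrite !mulr_sumr -!big_split; apply: eq_bigr => a _ /=.
by rewrite !mulr_sumr -!big_split.
Qed.

(** The common value of the derivatives of y by tau and of v_j by z_j, and of
    their antiholomorphic analogues. *)
Definition sg c : C := if c then iC / 2 else - (iC / 2).

Lemma yC_E p : y p = (2 * iC)^-1 * (zc ord0 p - (zc ord0 p)^*%C).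
Proof. by rewrite /yC yc_im mulrC. Qed.

Lemma vC_E j p : v p j = (2 * iC)^-1 * (zc (r j) p - (zc (r j) p)^*%C).
Proof. by rewrite /vC vv_im zv_zc mulrC. Qed.

Lemma conjc_nat (b : bool) : (b%:R)^*%C = b%:R :> C.
Proof. by case: b; apply: complex_ext => /=; rewrite ?oppr0. Qed.

Lemma wz_im c i j p : H p ->
  wz c i (fun q => (2 * iC)^-1 * (zc j q - (zc j q)^*%C)) p = sg c * (i == j)%:R.
Proof.
move=> Hp; have sz := @smooth_zc R N j; have sz' := smooth_conj sz.
have szN := smoothM (@smooth_cst R N (-1)) sz'.
have -> : wz c i (fun q => (2 * iC)^-1 * (zc j q - (zc j q)^*%C)) p =
  wz c i (fun q => (2 * iC)^-1 * (zc j q + -1 * (zc j q)^*%C)) p.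
  by apply: (wz_ext c i Hp) => q _; rewrite mulN1r.
rewrite (wzZ c i _ Hp (smoothD sz szN)) (wzD c i Hp sz szN) (wzZ c i _ Hp sz').
rewrite (wz_conj c i Hp sz) !(wz_zc _ _ _ Hp) conjc_nat /sg.
have i0 := @iC_neq0 R.
have I2 : iC * iC = -1 :> C := @iC2 R.
have -> : iC / 2 = - (2 * iC)^-1 :> C.
  apply: (@mulIf _ (2 * iC)); first by rewrite mulf_neq0 // pnatr_eq0.
  rewrite mulNr mulVf; last by rewrite mulf_neq0 // pnatr_eq0.
  by rewrite mulrA divfK ?pnatr_eq0.
by case: c => /=; case: (i == j); rewrite /= ?mulr0 ?subrr ?mulr0 ?mulr1 ?addr0 ?add0r ?mulrN1 ?opprK ?mulr1 ?addr0 ?mulr0.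
Qed.

Lemma wz_yC0 c p : H p -> wz c ord0 y p = sg c.
Proof.
move=> Hp; rewrite -[RHS]mulr1 -[1]/((ord0 == ord0 :> ix)%:R) -(wz_im c ord0 ord0 Hp).
by apply: (wz_ext c ord0 Hp) => q _; rewrite yC_E.
Qed.

Lemma wz_yCr c j p : H p -> wz c (r j) y p = 0.
Proof.
move=> Hp; rewrite -[RHS](mulr0 (sg c)) -[0]/((r j == ord0 :> ix)%:R) -(wz_im c (r j) ord0 Hp).
by apply: (wz_ext c (r j) Hp) => q _; rewrite yC_E.
Qed.

Lemma wz_vC0 c j p : H p -> wz c ord0 (v^~ j) p = 0.
Proof.
move=> Hp; rewrite -[RHS](mulr0 (sg c)) -[0]/((ord0 == r j :> ix)%:R) -(wz_im c ord0 (r j) Hp).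
by apply: (wz_ext c ord0 Hp) => q _; rewrite vC_E.
Qed.

Lemma wz_vCr c l j p : H p -> wz c (r l) (v^~ j) p = sg c * (l == j)%:R.
Proof.
move=> Hp; rewrite -eq_rshift1 -(wz_im c (r l) (r j) Hp).
by apply: (wz_ext c (r l) Hp) => q _; rewrite vC_E.
Qed.

(** The Euler-type operators v^T d/dz and v^T d/dzbar. *)
Definition Vd c f p : C := \sum_j v p j * wz c (r j) f p.

Lemma smooth_Vd c f : smooth f -> smooth (Vd c f).
Proof. by move=> sf; apply: smooth_sum => j; exact: (smoothM (@smooth_vC R N j) (smooth_wz c (r j) sf)). Qed.

Lemma wz_Vd0 e c f p : H p -> smooth f -> wz e ord0 (Vd c f) p = Vd c (wz e ord0 f) p.
Proof.
move=> Hp sf; have sj j := smoothM (@smooth_vC R N j) (smooth_wz c (r j) sf).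
rewrite [LHS](wz_sum e ord0 (index_enum 'I_N) Hp sj); apply: eq_bigr => j _.
rewrite (wzM e ord0 Hp (@smooth_vC R N j) (smooth_wz c (r j) sf)) wz_vC0 // mul0r add0r.
by rewrite (wz_swap e c _ _ Hp sf).
Qed.

Lemma wz_Vdr e c l f p : H p -> smooth f ->
  wz e (r l) (Vd c f) p = Vd c (wz e (r l) f) p + sg e * wz c (r l) f p.
Proof.
move=> Hp sf; have sj j := smoothM (@smooth_vC R N j) (smooth_wz c (r j) sf).
rewrite [LHS](wz_sum e (r l) (index_enum 'I_N) Hp sj).
have E j : wz e (r l) (fun q => v q j * wz c (r j) f q) p =
   v p j * wz c (r j) (wz e (r l) f) p + sg e * (l == j)%:R * wz c (r j) f p.
  rewrite (wzM e (r l) Hp (@smooth_vC R N j) (smooth_wz c (r j) sf)) wz_vCr //.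
  by rewrite (wz_swap e c _ _ Hp sf) addrC.
rewrite (eq_bigr _ (fun j _ => E j)) big_split; congr (_ + _).
rewrite (bigD1 l isT) big1 ?eqxx ?mulr1; first by rewrite /= addr0.
by move=> j /negPf jl; rewrite eq_sym jl mulr0 mul0r.
Qed.

Variable Li : 'M[C]_N.

(** The contractions of two gradients with the matrix [Li], of which the
    operators L^-1[d_z], L^-1[d_zbar] and d_zbar^T L^-1 d_z are
    instances. *)
Definition biwz c d f p : C := \sum_a \sum_b Li a b * wz c (r a) (wz d (r b) f) p.

Lemma smooth_Bil c d f : smooth f -> smooth (biwz c d f).
Proof.
move=> sf; apply: smooth_sum => a; apply: smooth_sum => b.
exact: (smoothM (@smooth_cst R N _) (smooth_wz _ _ (smooth_wz _ _ sf))).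
Qed.

Lemma Bil_ext c d f h p : H p -> eqH f h -> biwz c d f p = biwz c d h p.
Proof.
move=> Hp fh; apply: eq_bigr => a _; apply: eq_bigr => b _; apply: congr_mull.
by apply: (wz_ext _ _ Hp) => q Hq; exact: wz_ext.
Qed.

Lemma Vd_ext c f h p : H p -> eqH f h -> Vd c f p = Vd c h p.
Proof. by move=> Hp fh; apply: eq_bigr => j _; rewrite (wz_ext _ _ Hp fh). Qed.

Lemma wz_Bil e i c d f p : H p -> smooth f -> wz e i (biwz c d f) p = biwz c d (wz e i f) p.
Proof.
move=> Hp sf.
have s2 a b := smooth_wz c (r a) (smooth_wz d (r b) sf).
have s1 a b := smoothM (@smooth_cst R N (Li a b)) (s2 a b).
have s0 a := smooth_sum (index_enum 'I_N) (s1 a).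
rewrite [LHS](wz_sum e i (index_enum 'I_N) Hp s0); apply: eq_bigr => a _.
rewrite (wz_sum e i (index_enum 'I_N) Hp (s1 a)); apply: eq_bigr => b _.
rewrite (wzZ e i _ Hp (s2 a b)); apply: congr_mull.
rewrite (wz_swap e c _ _ Hp (smooth_wz d (r b) sf)).
by apply: (wz_ext _ _ Hp) => q Hq; rewrite (wz_swap e d _ _ Hq sf).
Qed.

Lemma Bil_sum c d (I : Type) (s : seq I) (F : I -> P -> C) p : H p -> (forall k, smooth (F k)) ->
  biwz c d (fun q => \sum_(k <- s) F k q) p = \sum_(k <- s) biwz c d (F k) p.
Proof.
move=> Hp sF; rewrite exchange_big; apply: eq_bigr => a _.
rewrite exchange_big; apply: eq_bigr => b _; rewrite -mulr_sumr; apply: congr_mull.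
rewrite -(wz_sum c (r a) s Hp (fun k => smooth_wz d (r b) (sF k))).
by apply: (wz_ext _ _ Hp) => q Hq; rewrite (wz_sum d (r b) s Hq sF).
Qed.

Lemma BilZ c d z f p : H p -> smooth f -> biwz c d (fun q => z * f q) p = z * biwz c d f p.
Proof.
move=> Hp sf; rewrite mulr_sumr; apply: eq_bigr => a _; rewrite mulr_sumr; apply: eq_bigr => b _.
rewrite [RHS]mulrCA; apply: congr_mull; rewrite -(wzZ c (r a) z Hp (smooth_wz d (r b) sf)).
by apply: (wz_ext _ _ Hp) => q Hq; rewrite (wzZ d (r b) z Hq sf).
Qed.

Lemma Bil_Bil c d c' d' f p : H p -> smooth f ->
  biwz c d (biwz c' d' f) p = biwz c' d' (biwz c d f) p.
Proof.
move=> Hp sf.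
have s2 a b := smooth_wz c (r a) (smooth_wz d (r b) sf).
have s1 a b := smoothM (@smooth_cst R N (Li a b)) (s2 a b).
have s0 a := smooth_sum (index_enum 'I_N) (s1 a).
rewrite [RHS](Bil_sum c' d' (index_enum 'I_N) Hp s0); apply: eq_bigr => a _.
rewrite (Bil_sum c' d' (index_enum 'I_N) Hp (s1 a)); apply: eq_bigr => b _.
rewrite (BilZ _ _ _ Hp (s2 a b)); apply: congr_mull.
rewrite -(wz_Bil c (r a) c' d' Hp (smooth_wz d (r b) sf)).
by apply: (wz_ext _ _ Hp) => q Hq; rewrite (wz_Bil d (r b) c' d' Hq sf).
Qed.

Hypothesis Li_sym : forall a b, Li a b = Li b a.

Lemma Bil_sym c d f p : H p -> smooth f -> biwz c d f p = biwz d c f p.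
Proof.
move=> Hp sf; rewrite [LHS]exchange_big; apply: eq_bigr => a _; apply: eq_bigr => b _ /=.
by rewrite Li_sym (wz_swap c d _ _ Hp sf).
Qed.

(** The coefficients v_j of the Euler-type operator are linear in z and its
    conjugate, so each of the two derivatives of the contraction produces one
    correction term and the two together produce none. *)
Lemma Bil_Vd c d e f p : H p -> smooth f ->
  biwz c d (Vd e f) p = Vd e (biwz c d f) p + sg c * biwz e d f p + sg d * biwz c e f p.
Proof.
move=> Hp sf.
have E a b : Li a b * wz c (r a) (wz d (r b) (Vd e f)) p =
   (Li a b * Vd e (wz c (r a) (wz d (r b) f)) p
   + sg c * (Li a b * wz e (r a) (wz d (r b) f) p))
   + sg d * (Li a b * wz c (r a) (wz e (r b) f) p).
  have sb := smooth_wz d (r b) sf; have se := smooth_wz e (r b) sf.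
  have -> : wz c (r a) (wz d (r b) (Vd e f)) p =
    wz c (r a) (fun q => Vd e (wz d (r b) f) q + sg d * wz e (r b) f q) p.
    by apply: (wz_ext _ _ Hp) => q Hq; rewrite (wz_Vdr d e b Hq sf).
  rewrite (wzD c (r a) Hp (smooth_Vd e sb) (smoothM (@smooth_cst R N (sg d)) se)).
  rewrite (wzZ c (r a) _ Hp se) (wz_Vdr c e a Hp sb).
  move: (Vd _ _ _) (wz _ _ _ _) (wz _ _ _ _) (Li a b) => *; ring.
rewrite {1}/biwz (eq_bigr _ (fun a _ => eq_bigr _ (fun b _ => E a b))).
rewrite sum2_lin; congr (_ + _ + _).
have E2 j : v p j * wz e (r j) (biwz c d f) p = \sum_a \sum_b v p j * (Li a b * wz e (r j) (wz c (r a) (wz d (r b) f)) p).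
  rewrite (wz_Bil e (r j) c d Hp sf) mulr_sumr; apply: eq_bigr => a _.
  rewrite mulr_sumr; apply: eq_bigr => b _; do 2!apply: congr_mull.
  rewrite (wz_swap e c _ _ Hp (smooth_wz d (r b) sf)).
  by apply: (wz_ext _ _ Hp) => q Hq; rewrite (wz_swap e d _ _ Hq sf).
rewrite [RHS](eq_bigr _ (fun j _ => E2 j)) [RHS]exchange_big; apply: eq_bigr => a _.
rewrite [RHS]exchange_big; apply: eq_bigr => b _ /=; rewrite mulr_sumr; apply: eq_bigr => j _.
exact: mulrCA.
Qed.

End ContractedOperators.

(** * Linearity of the raising and lowering operators *)

Section Linearity.
Local Opaque pd wz smooth.
Variables (R : realType) (N : nat).
Local Notation C := R[i].
Local Notation P := (pt R N).
Local Notation H := (@halfspace R N).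
Implicit Types (f h : P -> C) (p q : P).

Lemma VdE c f p : \sum_j vC p j * wz c (rshift 1 j) f p = Vd c f p.
Proof. by []. Qed.

Lemma VdD c f h p : H p -> smooth f -> smooth h ->
  Vd c (fun q => f q + h q) p = Vd c f p + Vd c h p.
Proof.
move=> Hp sf sh; rewrite /Vd -big_split; apply: eq_bigr => j _ /=.
by rewrite (wzD c (rshift 1 j) Hp sf sh) mulrDr.
Qed.

Lemma VdZ c z f p : H p -> smooth f -> Vd c (fun q => z * f q) p = z * Vd c f p.
Proof.
move=> Hp sf; rewrite /Vd mulr_sumr; apply: eq_bigr => j _ /=.
rewrite (wzZ c (rshift 1 j) z Hp sf); exact: mulrCA.
Qed.

Lemma letterD k L a f h p : H p -> smooth f -> smooth h ->
  letter_op k L a (fun q => f q + h q) p = letter_op k L a f p + letter_op k L a h p.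
Proof.
move=> Hp sf sh; have E c i := wzD c i Hp sf sh; have EV c := VdD c Hp sf sh.
case: a => [[j|]|[j|]]; rewrite /letter_op.
- rewrite !YpE (E false); move: (wz _ _ _ _) (wz _ _ _ _) (\sum_l _) => *; ring.
- rewrite !XpE !VdE (E false) (EV false).
  move: (wz _ _ _ _) (wz _ _ _ _) (Vd _ _ _) (Vd _ _ _) (\sum_x _) (f p) (h p) => *; ring.
- by rewrite !YmE (E true) mulrDr.
- rewrite !XmE !VdE (E true) (EV true).
  move: (wz _ _ _ _) (wz _ _ _ _) (Vd _ _ _) (Vd _ _ _) => *; ring.
Qed.

Lemma letterZ k L a z f p : H p -> smooth f ->
  letter_op k L a (fun q => z * f q) p = z * letter_op k L a f p.
Proof.
move=> Hp sf; have E c i := wzZ c i z Hp sf; have EV c := VdZ c z Hp sf.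
case: a => [[j|]|[j|]]; rewrite /letter_op.
- rewrite !YpE (E false); move: (wz _ _ _ _) (\sum_l _) => *; ring.
- rewrite !XpE !VdE (E false) (EV false).
  move: (wz _ _ _ _) (Vd _ _ _) (\sum_x _) (f p) => *; ring.
- by rewrite !YmE (E true) mulrCA.
- rewrite !XmE !VdE (E true) (EV true).
  move: (wz _ _ _ _) (Vd _ _ _) => *; ring.
Qed.

Lemma letter_sum k L a (I : Type) (s : seq I) (z : I -> C) (F : I -> P -> C) p :
  H p -> (forall i, smooth (F i)) ->
  letter_op k L a (fun q => \sum_(i <- s) z i * F i q) p
  = \sum_(i <- s) z i * letter_op k L a (F i) p.
Proof.
move=> Hp sF; have sc (w : C) := @smooth_cst R N w.
elim: s => [|i s IH].
  rewrite big_nil -[RHS](mul0r (letter_op k L a (fun=> 0) p)) -(letterZ k L a 0 Hp (sc 0)).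
  by apply: (letter_ext _ _ _ Hp) => q _; rewrite big_nil mul0r.
rewrite big_cons -IH -(letterZ k L a (z i) Hp (sF i)).
rewrite -(letterD k L a Hp (smoothM (sc (z i)) (sF i))); last first.
  exact: (smooth_sum s (fun i => smoothM (sc (z i)) (sF i))).
by apply: (letter_ext _ _ _ Hp) => q _; rewrite big_cons.
Qed.

Lemma letter_sum2 k L a (z : 'I_N -> 'I_N -> C) (F : 'I_N -> 'I_N -> P -> C) p :
  H p -> (forall i j, smooth (F i j)) ->
  letter_op k L a (fun q => \sum_i \sum_j z i j * F i j q) p
  = \sum_i \sum_j z i j * letter_op k L a (F i j) p.
Proof.
move=> Hp sF; pose G i q := \sum_j z i j * F i j q.
have sG i : smooth (G i).
  exact: (smooth_sum (index_enum 'I_N) (fun j => smoothM (@smooth_cst R N (z i j)) (sF i j))).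
have := letter_sum k L a (index_enum 'I_N) (fun=> 1) Hp sG.
rewrite (eq_bigr (fun i => \sum_j z i j * letter_op k L a (F i j) p)) => [<-|i _].
  by apply: (letter_ext _ _ _ Hp) => q _; apply: eq_bigr => i _; rewrite mul1r.
by rewrite mul1r; exact: letter_sum.
Qed.

End Linearity.

(** * Contractions with the inverse of the index *)

Section InverseForm.
Local Opaque pd wz smooth.
Variables (R : realType) (N : nat).
Local Notation C := R[i].
Local Notation iC := (Complex (0 : R) 1).
Local Notation P := (pt R N).
Local Notation H := (@halfspace R N).
Local Notation y := (@yC R N).
Local Notation v := (@vC R N).
Local Notation r j := (rshift 1 j : 'I_(1 + N)).
Implicit Types (f h : P -> C) (p q : P) (c d e : bool).
Variables (L : 'M[C]_N).
Hypotheses (L_sym : L^T = L) (L_unit : L \in unitmx).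
Local Notation ell := (calL L).
Local Notation Li := (invmx (calL L)).
Local Notation Bil := (biwz Li).

Lemma calL_unit : ell \in unitmx.
Proof.
rewrite /calL unitmxZ // unitfE !mulf_neq0 ?pnatr_eq0 ?iC_neq0 //.
by rewrite (fmorph_eq0 (real_complex R)) gt_eqF // pi_gt0.
Qed.

Lemma Li_symE a b : Li a b = Li b a.
Proof.
have E : Li^T = Li by rewrite trmx_inv /calL linearZ /= L_sym.
by rewrite -{1}E mxE.
Qed.

Lemma ell_Li a x : \sum_b ell a b * Li b x = (a == x)%:R.
Proof.
have := congr1 (fun M : 'M[C]_N => M a x) (mulmxV calL_unit).
by rewrite mxE [X in _ = X]mxE.
Qed.

(** The zero-order term of Y_{+,a}, normalized so that Y_{+,a} h equals
    i (d_{z_a} h + q_a h). *)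
Definition qf a p : C := 2 * (y p)^-1 * \sum_l ell a l * v p l.

(** The quadratic form (2 pi i L)[v] in the zero-order term of X_+. *)
Definition Qv p : C := \sum_x \sum_z ell x z * (v p x * v p z).

Lemma smooth_iy : smooth (fun p : P => (y p)^-1).
Proof. exact: (smoothV (@yC_neq0 R N) (@smooth_yC R N)). Qed.

Lemma smooth_lin a : smooth (fun p => \sum_l ell a l * v p l).
Proof. exact: (smooth_sum (index_enum 'I_N) (fun l => smoothM (@smooth_cst R N (ell a l)) (@smooth_vC R N l))). Qed.

Lemma smooth_qf a : smooth (qf a).
Proof. exact: (smoothM (smoothM (@smooth_cst R N 2) smooth_iy) (smooth_lin a)). Qed.

Lemma smooth_Qv : smooth Qv.
Proof.
apply: smooth_sum => x; apply: smooth_sum => z; apply: (smoothM (smooth_cst _)).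
exact: (smoothM (@smooth_vC R N x) (@smooth_vC R N z)).
Qed.

(** Coefficients in y alone pass through all derivatives in the z_j, hence
    through the contractions and the Euler-type operators. *)
Definition zconst (u : P -> C) := smooth u /\ forall c l p, H p -> wz c (r l) u p = 0.

Lemma zconst_y : zconst y.
Proof. by split; [exact: smooth_yC | move=> *; exact: wz_yCr]. Qed.
Lemma zconst_cst (z : C) : zconst (fun=> z).
Proof. by split; [exact: smooth_cst | move=> *; exact: wz_cst]. Qed.
Lemma zconstM u w : zconst u -> zconst w -> zconst (fun p => u p * w p).
Proof.
move=> [su hu] [sw hw]; split; first exact: smoothM.
by move=> c l p Hp; rewrite (wzM _ _ Hp su sw) hu // hw // mulr0 mul0r addr0.
Qed.
Lemma zconst_iy : zconst (fun p => (y p)^-1).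
Proof.
split; first exact: smooth_iy.
move=> c l p Hp; rewrite (wzV _ _ (@yC_neq0 R N) Hp (@smooth_yC R N)).
by rewrite wz_yCr // mulr0 oppr0.
Qed.

Lemma wz_zconst u h c l p : zconst u -> H p -> smooth h ->
  wz c (r l) (fun q => u q * h q) p = u p * wz c (r l) h p.
Proof. by move=> [su hu] Hp sh; rewrite (wzM _ _ Hp su sh) hu // mul0r add0r. Qed.

Lemma Vd_zconst u h c p : zconst u -> H p -> smooth h ->
  Vd c (fun q => u q * h q) p = u p * Vd c h p.
Proof.
move=> zu Hp sh; rewrite /Vd mulr_sumr; apply: eq_bigr => j _.
by rewrite (wz_zconst c j zu Hp sh) mulrCA.
Qed.

Lemma Bil_zconst u h c d p : zconst u -> H p -> smooth h ->
  Bil c d (fun q => u q * h q) p = u p * Bil c d h p.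
Proof.
move=> zu Hp sh; rewrite /biwz mulr_sumr; apply: eq_bigr => a _.
rewrite mulr_sumr; apply: eq_bigr => b _.
rewrite [RHS]mulrCA; apply: congr_mull.
rewrite -(wz_zconst c a zu Hp (smooth_wz d (r b) sh)).
by apply: (wz_ext _ _ Hp) => q Hq; rewrite (wz_zconst d b zu Hq sh).
Qed.

Lemma wz_qf a b p : H p -> wz false (r a) (qf b) p = - (iC * (y p)^-1 * ell b a).
Proof.
move=> Hp; have zu := zconstM (zconst_cst 2) zconst_iy.
rewrite (wz_zconst false a zu Hp (smooth_lin b)).
have sv l := smoothM (@smooth_cst R N (ell b l)) (@smooth_vC R N l).
rewrite (wz_sum false (r a) (index_enum 'I_N) Hp sv).
have E l : wz false (r a) (fun q => ell b l * v q l) p = ell b l * (sg R false * (a == l)%:R).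
  by rewrite (wzZ _ _ _ Hp (@smooth_vC R N l)) wz_vCr.
rewrite (eq_bigr _ (fun l _ => E l)) (bigD1 a isT) big1 => [|l /negPf la]; last first.
  by rewrite eq_sym la !mulr0.
rewrite /= eqxx mulr1 addr0 /sg.
by move: (ell b a) ((y p)^-1) iC => *; field.
Qed.

Lemma YpqE a h p : Yp L a h p = iC * (wz false (r a) h p + qf a p * h p).
Proof. rewrite YpE /qf; move: (wz _ _ _ _) (\sum_l _) => *; ring. Qed.

Lemma Yp_ext a f h p : H p -> eqH f h -> Yp L a f p = Yp L a h p.
Proof. move=> Hp fh; exact: (@letter_ext R N 0 L (Raise (Some a)) f h p Hp fh). Qed.

Lemma smooth_Yp a f : smooth f -> smooth (Yp L a f).
Proof. exact: (@smooth_letter R N 0 L (Raise (Some a)) f). Qed.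

Lemma YpYpE a b h p : H p -> smooth h -> Yp L a (Yp L b h) p =
  - (wz false (r a) (wz false (r b) h) p + qf a p * wz false (r b) h p
     + qf b p * wz false (r a) h p + (qf a p * qf b p - iC * (y p)^-1 * ell b a) * h p).
Proof.
move=> Hp sh; have sb := smooth_wz false (r b) sh; have sq := smooth_qf b.
rewrite (@Yp_ext a _ (fun q => iC * (wz false (r b) h q + qf b q * h q)) p Hp); last first.
  by move=> q _; exact: YpqE.
rewrite YpqE (wzZ _ _ _ Hp (smoothD sb (smoothM sq sh))).
rewrite (wzD _ _ Hp sb (smoothM sq sh)) (wzM _ _ Hp sq sh) wz_qf //.
move: (wz false (r a) (wz false (r b) h) p) (wz false (r a) h p) (wz false (r b) h p) => A1 A2 A3.
move: (qf a p) (qf b p) (h p) (ell b a) ((y p)^-1) => q1 q2 hp e iy.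
have -> : forall X : C, - X = iC * iC * X by move=> X; rewrite iC2 mulN1r.
by move: iC => I; ring.
Qed.

(** The matrix 2 pi i L in the zero-order term of Y_+ cancels against its
    inverse: contraction leaves v alone, the coefficient of the Euler-type
    operators. *)
Lemma qf_Li p b : \sum_a qf a p * Li a b = 2 * (y p)^-1 * v p b.
Proof.
have E a : qf a p * Li a b = 2 * (y p)^-1 * \sum_l v p l * (ell l a * Li a b).
  rewrite /qf -[LHS]mulrA mulr_suml; apply: congr_mull; apply: eq_bigr => l _.
  by rewrite (calL_symE L_sym) mulrAC mulrC.
rewrite (eq_bigr _ (fun a _ => E a)) -mulr_sumr; apply: congr_mull.
rewrite exchange_big /= (bigD1 b isT) /= [X in _ + X]big1.
  by rewrite addr0 -mulr_sumr ell_Li eqxx mulr1.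
by move=> l /negPf lb; rewrite -mulr_sumr ell_Li lb mulr0.
Qed.

(** The trace of the identity matrix: the source of the dimension N in the
    coefficients of the Casimir operator. *)
Lemma Li_ell : \sum_a \sum_b Li a b * ell b a = N%:R.
Proof.
rewrite exchange_big /=.
under eq_bigr => b _ do under eq_bigr => a _ do rewrite mulrC.
by under eq_bigr => b _ do rewrite ell_Li eqxx; rewrite sumr_const card_ord.
Qed.

Lemma qf_Li_qf p : \sum_a \sum_b Li a b * (qf a p * qf b p) = 4 * (y p)^-1 ^+ 2 * Qv p.
Proof.
rewrite exchange_big /=.
have E b : \sum_a Li a b * (qf a p * qf b p) = 4 * (y p)^-1 ^+ 2 * \sum_l ell b l * (v p b * v p l).
  rewrite (_ : \sum_a _ = (\sum_a qf a p * Li a b) * qf b p); last first.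
    by rewrite mulr_suml; apply: eq_bigr => a _; rewrite mulrA [Li a b * _]mulrC.
  rewrite qf_Li /qf.
  have -> : \sum_l ell b l * (v p b * v p l) = v p b * \sum_l ell b l * v p l.
    by rewrite mulr_sumr; apply: eq_bigr => l _; rewrite mulrCA.
  move: (\sum_l _) => *; ring.
by rewrite (eq_bigr _ (fun b _ => E b)) -mulr_sumr.
Qed.

Lemma LiYpYp h p : H p -> smooth h ->
  \sum_a \sum_b Li a b * Yp L a (Yp L b h) p =
  - (Bil false false h p + 4 * (y p)^-1 * Vd false h p
     + (4 * (y p)^-1 ^+ 2 * Qv p - N%:R * iC * (y p)^-1) * h p).
Proof.
move=> Hp sh.
have E1 : \sum_a \sum_b Li a b * (qf a p * wz false (r b) h p) = 2 * (y p)^-1 * Vd false h p.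
  rewrite exchange_big /= /Vd mulr_sumr; apply: eq_bigr => b _.
  rewrite [RHS]mulrA -qf_Li mulr_suml; apply: eq_bigr => a _.
  by rewrite mulrA [Li a b * _]mulrC.
have E2 : \sum_a \sum_b Li a b * (qf b p * wz false (r a) h p) = 2 * (y p)^-1 * Vd false h p.
  apply: etrans _ E1; rewrite [LHS]exchange_big /=; apply: eq_bigr => b _; apply: eq_bigr => a _.
  by rewrite (Li_symE a b).
have E a b : Li a b * Yp L a (Yp L b h) p =
   - (Li a b * wz false (r a) (wz false (r b) h) p + Li a b * (qf a p * wz false (r b) h p)
     + Li a b * (qf b p * wz false (r a) h p) + (Li a b * (qf a p * qf b p)) * h p
     - (Li a b * ell b a) * (iC * (y p)^-1 * h p)).
  rewrite YpYpE //; move: (Li a b) (wz _ _ _ _) (wz _ _ _ _) (wz _ _ _ _) => *; ring.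
have S5 (A1 A2 A3 A4 A5 : 'I_N -> 'I_N -> C) (s t : C) :
  \sum_a \sum_b - (A1 a b + A2 a b + A3 a b + A4 a b * s - A5 a b * t) =
  - (\sum_a \sum_b A1 a b + \sum_a \sum_b A2 a b + \sum_a \sum_b A3 a b +
    (\sum_a \sum_b A4 a b) * s - (\sum_a \sum_b A5 a b) * t).
  rewrite !mulr_suml -sumrN -!big_split -sumrN; apply: eq_bigr => a _ /=.
  by rewrite !mulr_suml -sumrN -!big_split -sumrN.
have E0 : \sum_a \sum_b Li a b * wz false (r a) (wz false (r b) h) p = Bil false false h p by [].
apply: etrans (eq_bigr _ (fun a _ => eq_bigr _ (fun b _ => E a b))) _.
apply: etrans (S5 _ _ _ _ _ _ _) _.
move: (Bil false false h p) (Vd false h p) E0 E1 E2 => B V E0 E1 E2.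
have E4 := qf_Li_qf p; have E5 := Li_ell.
apply: etrans (congr1 -%R (congr2 +%R (congr2 +%R (congr2 +%R (congr2 +%R E0 E1) E2)
  (congr1 ( *%R^~ _) E4)) (congr1 -%R (congr1 ( *%R^~ _) E5)))) _.
move: (Qv p) (h p) ((y p)^-1) iC => *; ring.
Qed.

End InverseForm.

(** * The contracted products in the Casimir operator *)

Section CasimirWordSums.
Local Opaque pd wz smooth.
Variables (R : realType) (N : nat).
Local Notation C := R[i].
Local Notation iC := (Complex (0 : R) 1).
Local Notation P := (pt R N).
Local Notation H := (@halfspace R N).
Local Notation ix := 'I_(1 + N).
Local Notation y := (@yC R N).
Local Notation v := (@vC R N).
Local Notation r j := (rshift 1 j : 'I_(1 + N)).
Variables (L : 'M[C]_N).
Hypotheses (L_sym : L^T = L) (L_unit : L \in unitmx).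
Local Notation Li := (invmx (calL L)).
Local Notation Bil := (biwz Li).
Local Notation TT := (wz false (ord0 : ix)).
Local Notation TB := (wz true (ord0 : ix)).
Local Notation Q := (Qv L).

Variable f : P -> C.
Hypothesis sf : smooth f.

Definition y2 (p : P) : C := y p * y p.
Lemma zconst_y2 : zconst y2. Proof. exact: (zconstM (@zconst_y R N) (@zconst_y R N)). Qed.

Lemma TT_y h p : H p -> smooth h -> TT (fun q => y q * h q) p = - (iC / 2) * h p + y p * TT h p.
Proof. by move=> Hp sh; rewrite (wzM _ _ Hp (@smooth_yC R N) sh) wz_yC0. Qed.

Lemma TT_y2 h p : H p -> smooth h -> TT (fun q => y2 q * h q) p = - (iC * y p * h p) + y2 p * TT h p.
Proof.
move=> Hp sh; rewrite (wzM _ _ Hp zconst_y2.1 sh).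
rewrite (wzM _ _ Hp (@smooth_yC R N) (@smooth_yC R N)) wz_yC0 // /sg /y2.
move: (TT h p) (h p) (y p) iC => *; by field.
Qed.

(** X_- up to the constant -2i. *)
Definition xm p : C := y2 p * TB f p + y p * Vd true f p.

Lemma smooth_xm : smooth xm.
Proof.
exact: (smoothD (smoothM zconst_y2.1 (smooth_wz true ord0 sf)) (smoothM (@smooth_yC R N) (smooth_Vd true sf))).
Qed.

Lemma Xm_xm p : Xm f p = - (2 * iC) * xm p.
Proof. rewrite XmE VdE /xm /y2; move: (TB f p) (Vd _ _ _) (y p) iC => *; ring. Qed.

(** L^-1[d_zbar] f, to which the contraction of two lowering operators reduces,
    up to the factor -y^2. *)
Definition Kbar p : C := Bil true true f p.
Lemma smooth_Kbar : smooth Kbar. Proof. exact: smooth_Bil. Qed.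

Lemma YmYm c d p : H p -> Ym c (Ym d f) p = - (y2 p * wz true (r c) (wz true (r d) f) p).
Proof.
move=> Hp; rewrite YmE.
have -> : wz true (r c) (Ym d f) p = - (iC * (y p * wz true (r c) (wz true (r d) f) p)).
  have sd := smooth_wz true (r d) sf.
  rewrite -(wz_zconst true c (@zconst_y R N) Hp sd).
  rewrite -(wzZ true (r c) iC Hp (smoothM (@smooth_yC R N) sd)).
  rewrite -(wzN _ _ Hp (smoothM (@smooth_cst R N iC) (smoothM (@smooth_yC R N) sd))).
  by apply: (wz_ext _ _ Hp) => q _; rewrite YmE mulNr -mulrA.
rewrite /y2; move: (wz true (r c) _ p) (y p) => w yp.
transitivity (iC * iC * (yp * yp * w)); first by move: iC => *; ring.
by rewrite iC2 mulN1r.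
Qed.

Lemma LiYmYm p : H p -> \sum_a \sum_b Li a b * Ym a (Ym b f) p = - (y2 p * Kbar p).
Proof.
move=> Hp; rewrite /Kbar /biwz mulr_sumr -sumrN; apply: eq_bigr => a _.
rewrite mulr_sumr -sumrN; apply: eq_bigr => b _; rewrite (YmYm a b Hp).
by rewrite mulrN mulrCA.
Qed.

(** Here and in [vvbar] the Euler operators are normally ordered: all
    coefficients v stand to the left of the derivatives, as they do in the Casimir operator. *)
Definition vvmix p : C := \sum_l v p l * Vd true (wz false (r l) f) p.

Lemma V_xm p : H p -> Vd false xm p =
  y2 p * Vd false (TB f) p + y p * (vvmix p - iC / 2 * Vd true f p).
Proof.
move=> Hp; have sT := smooth_wz true ord0 sf; have sV := smooth_Vd true sf.
rewrite (VdD false Hp (smoothM zconst_y2.1 sT) (smoothM (@smooth_yC R N) sV)).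
rewrite (Vd_zconst false zconst_y2 Hp sT) (Vd_zconst false (@zconst_y R N) Hp sV).
have -> // : Vd false (Vd true f) p = vvmix p - iC / 2 * Vd true f p.
rewrite /vvmix -[Vd true f p]/(\sum_l v p l * wz true (r l) f p) mulr_sumr -sumrB; apply: eq_bigr => l _.
rewrite (wz_Vdr false true l Hp sf) mulrDr (_ : sg R false = - (iC / 2)) //; move: (Vd _ _ _) (wz _ _ _ _) => *; ring.
Qed.

Lemma T_xm p : H p -> TT xm p = - (iC * y p * TB f p) + y2 p * TT (TB f) p
   - iC / 2 * Vd true f p + y p * Vd true (TT f) p.
Proof.
move=> Hp; have sT := smooth_wz true ord0 sf; have sV := smooth_Vd true sf.
rewrite (wzD _ _ Hp (smoothM zconst_y2.1 sT) (smoothM (@smooth_yC R N) sV)).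
rewrite TT_y2 // TT_y // (wz_Vd0 false true Hp sf).
move: (TT (TB f) p) (TB f p) (Vd _ _ _) (Vd _ _ _) => *; ring.
Qed.

Lemma K_xm p : H p -> Bil false false xm p = y2 p * Bil false false (TB f) p
   + y p * (Vd true (Bil false false f) p - iC * Bil false true f p).
Proof.
move=> Hp; have sT := smooth_wz true ord0 sf; have sV := smooth_Vd true sf.
have E : Bil false false xm p = Bil false false (fun q => y2 q * TB f q) p
    + Bil false false (fun q => y q * Vd true f q) p.
  have sa := smoothM zconst_y2.1 sT; have sb := smoothM (@smooth_yC R N) sV.
  rewrite /biwz -big_split; apply: eq_bigr => a _ /=; rewrite -big_split; apply: eq_bigr => b _ /=.
  rewrite -mulrDr; apply: congr_mull.
  rewrite -(wzD _ _ Hp (smooth_wz false (r b) sa) (smooth_wz false (r b) sb)).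
  by apply: (wz_ext _ _ Hp) => q Hq; rewrite (wzD _ _ Hq sa sb).
rewrite E (Bil_zconst L false false zconst_y2 Hp sT) (Bil_zconst L false false (@zconst_y R N) Hp sV).
rewrite (Bil_Vd Li false false true Hp sf).
rewrite (Bil_sym (@Li_symE R N L L_sym) true false Hp sf).
have -> : sg R false = - (iC / 2) by [].
move: (Bil _ _ _ p) (Vd _ _ _) (Bil _ _ _ p) iC => *; by field.
Qed.

Lemma XpQ k h p : Xp k L h p = 2 * iC * (TT h p + (y p)^-1 * Vd false h p
    + (y p)^-1 ^+ 2 * Q p * h p) + k%:~R * (y p)^-1 * h p.
Proof. by rewrite XpE VdE exprVn. Qed.

(** Here and below a contracted product of letters is evaluated as a
    combination of the same finite list of operators with coefficients in y, v
    and (2 pi i L)[v], to be matched against the Casimir operator. *)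
Lemma word_XX k p : H p -> word_op k L [:: Raise None; Lower None] f p =
   4 * (y2 p * TT (TB f) p + y p * Vd true (TT f) p + y p * Vd false (TB f) p + vvmix p)
   - 2 * iC * k%:~R * (y p * TB f p + Vd true f p)
   + 4 * Q p * (TB f p + (y p)^-1 * Vd true f p).
Proof.
move=> Hp; rewrite /= /word_wt big_seq1 /=.
have E : Xp (k + - 2%:Z) L (Xm f) p = - (2 * iC) * Xp (k + - 2%:Z) L xm p.
  rewrite -(@letterZ R N (k + - 2%:Z) L (Raise None) (- (2 * iC)) xm p Hp smooth_xm).
  by apply: (@letter_ext R N _ L (Raise None) _ _ p Hp) => q _; exact: Xm_xm.
rewrite E XpQ (V_xm Hp) (T_xm Hp) /xm intrD.
have -> : (- 2%:Z)%:~R = - 2 :> C by rewrite mulrNz.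
have y0 := yC_neq0 Hp; rewrite /y2.
move: (TT (TB f) p) (TB f p) (Vd true f p) (Vd true (TT f) p) (Vd false (TB f) p) (vvmix p) (Q p) (k%:~R : C) => a1 a2 a3 a4 a5 a6 a7 K.
(* The terms to which i^2 = -1 applies are set apart, as i is a variable for [field]. *)
transitivity (- (iC * iC) * (4 * (y p * y p * a1 + y p * a4 + y p * a5 + a6) + 4 * a7 * (a2 + (y p)^-1 * a3)
   ) - 2 * iC * K * (y p * a2 + a3)
   + (iC * iC + 1) * (4 * iC * (y p * a2 + a3))).
  move: (y p) y0 iC => yp y0 I; field; exact: y0.
by rewrite iC2; ring.
Qed.

Lemma word_XYY k p : H p ->
  \sum_a \sum_b Li a b * word_op k L [:: Raise None; Lower (Some a); Lower (Some b)] f p =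
  - (2 * iC * (y2 p * TT Kbar p + y p * Vd false Kbar p + Q p * Kbar p)) - k%:~R * y p * Kbar p.
Proof.
move=> Hp; rewrite /=.
have E (a b : 'I_N) : word_wt [:: Lower (Some a); Lower (Some b)] = - 1%:Z + - 1%:Z.
  by rewrite /word_wt big_cons big_seq1.
under eq_bigr => a _ do under eq_bigr => b _ do rewrite E.
set k' := k + _.
have sYY a b : smooth (Ym a (Ym b f)).
  exact: (@smooth_letter R N 0 L (Lower (Some a)) _ (@smooth_letter R N 0 L (Lower (Some b)) _ sf)).
have -> : \sum_a \sum_b Li a b * Xp k' L (Ym a (Ym b f)) p
   = Xp k' L (fun q => \sum_a \sum_b Li a b * Ym a (Ym b f) q) p.
  by rewrite -(@letter_sum2 R N k' L (Raise None) (fun a b => Li a b) (fun a b => Ym a (Ym b f)) p Hp sYY).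
have sy2g := smoothM zconst_y2.1 smooth_Kbar.
have -> : Xp k' L (fun q => \sum_a \sum_b Li a b * Ym a (Ym b f) q) p = -1 * Xp k' L (fun q => y2 q * Kbar q) p.
  rewrite -(@letterZ R N k' L (Raise None) (-1) _ p Hp sy2g).
  by apply: (@letter_ext R N _ L (Raise None) _ _ p Hp) => q Hq; rewrite LiYmYm // mulN1r.
rewrite XpQ (TT_y2 Hp smooth_Kbar).
rewrite (Vd_zconst false zconst_y2 Hp smooth_Kbar).
have -> : k'%:~R = k%:~R - 2 :> C.
  rewrite /k' !intrD; rewrite !mulrNz; ring.
have y0 := yC_neq0 Hp; rewrite /y2.
move: (TT Kbar p) (Kbar p) (Vd _ _ _) (Q p) (k%:~R : C) => a1 a2 a3 a4 K.
transitivity (- (2 * iC * (y p * y p * a1 + y p * a3 + a4 * a2)) - K * y p * a2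
   + (1 + iC * iC) * (2 * y p * a2)).
  move: (y p) y0 iC => yp y0 I; field; exact: y0.
by rewrite iC2; ring.
Qed.

Lemma word_YYX k p : H p ->
  \sum_a \sum_b Li a b * word_op k L [:: Raise (Some a); Raise (Some b); Lower None] f p =
  2 * iC * (y2 p * Bil false false (TB f) p
   + y p * (Vd true (Bil false false f) p - iC * Bil false true f p)
   + 4 * (y p * Vd false (TB f) p + (vvmix p - iC / 2 * Vd true f p))
   + (4 * (y p)^-1 * Q p - N%:R * iC) * (y p * TB f p + Vd true f p)).
Proof.
move=> Hp; rewrite /=.
have sX : smooth (Xm f) by exact: (@smooth_letter R N 0 L (Lower None) _ sf).
have E : Bil false false (Xm f) p = - (2 * iC) * Bil false false xm p.
  rewrite -(BilZ _ _ _ _ Hp smooth_xm); apply: (Bil_ext _ _ _ Hp) => q _; exact: Xm_xm.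
have E2 : Vd false (Xm f) p = - (2 * iC) * Vd false xm p.
  rewrite -(VdZ _ _ Hp smooth_xm); apply: (Vd_ext _ Hp) => q _; exact: Xm_xm.
rewrite (LiYpYp L_sym L_unit Hp sX) E E2 Xm_xm (K_xm Hp) (V_xm Hp) /xm.
have y0 := yC_neq0 Hp; rewrite /y2.
move: (Bil _ _ _ _) (Bil _ _ _ _) (Vd _ _ _) (Vd _ _ _) (Vd _ _ _) (vvmix p) (Q p) (TB f p) => a1 a2 a3 a4 a5 a6 a7 a8.
by move: (y p) y0 iC => yp y0 I; field; exact: y0.
Qed.

Lemma word_YYYY1 k p : H p ->
  \sum_a \sum_b \sum_c \sum_d Li a b * Li c d *
     word_op k L [:: Raise (Some a); Raise (Some b); Lower (Some c); Lower (Some d)] f p =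
  y2 p * Bil false false Kbar p + 4 * y p * Vd false Kbar p
  + (4 * Q p - N%:R * iC * y p) * Kbar p.
Proof.
move=> Hp; rewrite /=.
have sYY a b : smooth (Ym a (Ym b f)).
  exact: (@smooth_letter R N 0 L (Lower (Some a)) _ (@smooth_letter R N 0 L (Lower (Some b)) _ sf)).
pose G q := \sum_c \sum_d Li c d * Ym c (Ym d f) q.
have sG : smooth G.
  exact: (smooth_sum (index_enum 'I_N) (fun a => smooth_sum (index_enum 'I_N) (fun b => smoothM (@smooth_cst R N (Li a b)) (sYY a b)))).
have E a b : \sum_c \sum_d Li a b * Li c d * Yp L a (Yp L b (Ym c (Ym d f))) p = Li a b * Yp L a (Yp L b G) p.
  have -> : Yp L a (Yp L b G) p = \sum_c \sum_d Li c d * Yp L a (Yp L b (Ym c (Ym d f))) p.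
    rewrite -(@letter_sum2 R N 0 L (Raise (Some a)) (fun c d => Li c d) (fun c d => Yp L b (Ym c (Ym d f))) p Hp); last first.
      by move=> c d; exact: (smooth_Yp L b (sYY c d)).
    apply: (Yp_ext _ _ Hp) => q Hq.
    by rewrite -(@letter_sum2 R N 0 L (Raise (Some b)) (fun c d => Li c d) (fun c d => (Ym c (Ym d f))) q Hq).
  rewrite mulr_sumr; apply: eq_bigr => c _; rewrite mulr_sumr; apply: eq_bigr => d _.
  by rewrite mulrA.
rewrite (eq_bigr _ (fun a _ => eq_bigr _ (fun b _ => E a b))).
rewrite (LiYpYp L_sym L_unit Hp sG).
have GE q : H q -> G q = -1 * (y2 q * Kbar q) by move=> Hq; rewrite mulN1r; exact: LiYmYm.
have sy2g := smoothM zconst_y2.1 smooth_Kbar.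
have -> : Bil false false G p = - (y2 p * Bil false false Kbar p).
  rewrite (Bil_ext _ _ _ Hp GE) (BilZ _ _ _ _ Hp sy2g) (Bil_zconst L _ _ zconst_y2 Hp smooth_Kbar).
  by rewrite mulN1r.
have -> : Vd false G p = - (y2 p * Vd false Kbar p).
  rewrite (Vd_ext _ Hp GE) (VdZ _ _ Hp sy2g) (Vd_zconst _ zconst_y2 Hp smooth_Kbar).
  by rewrite mulN1r.
rewrite (GE p Hp); have y0 := yC_neq0 Hp; rewrite /y2.
move: (Bil _ _ _ _) (Vd _ _ _) (Kbar p) (Q p) => a1 a2 a3 a4.
by move: (y p) y0 iC => yp y0 I; field; exact: y0.
Qed.

(** Y_+^T L^-1 Y_-, to which the crossed contraction of four letters in
    [word_YYYY2] reduces. *)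
Lemma LiYpYm h p : H p -> smooth h ->
  \sum_a \sum_b Li a b * Yp L a (Ym b h) p = y p * Bil false true h p + 2 * Vd true h p.
Proof.
move=> Hp sh.
have E a b : Li a b * Yp L a (Ym b h) p = y p * (Li a b * wz false (r a) (wz true (r b) h) p)
   + y p * ((qf L a p * Li a b) * wz true (r b) h p).
  have sb := smooth_wz true (r b) sh.
  rewrite YpqE YmE.
  have -> : wz false (r a) (Ym b h) p = - iC * (y p * wz false (r a) (wz true (r b) h) p).
    rewrite -(wz_zconst false a (@zconst_y R N) Hp sb) -(wzZ _ _ _ Hp (smoothM (@smooth_yC R N) sb)).
    by apply: (wz_ext _ _ Hp) => q _; rewrite YmE -mulNr -mulrA.
  move: (wz false (r a) (wz true (r b) h) p) (wz true (r b) h p) (qf L a p) (Li a b) (y p) => a1 a2 a3 a4 yp.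
  transitivity (- (iC * iC) * (yp * (a4 * a1) + yp * (a3 * a4 * a2))).
    by move: iC => *; ring.
  by rewrite iC2 opprK mul1r.
have E2 : \sum_a \sum_b Li a b * Yp L a (Ym b h) p =
  y p * (\sum_a \sum_b Li a b * wz false (r a) (wz true (r b) h) p) +
  y p * (\sum_a \sum_b qf L a p * Li a b * wz true (r b) h p).
  rewrite !mulr_sumr -big_split; apply: eq_bigr => a _ /=.
  rewrite !mulr_sumr -big_split; apply: eq_bigr => b _ /=; exact: E.
apply: etrans E2 _; congr (_ + _).
have -> : \sum_a \sum_b qf L a p * Li a b * wz true (r b) h p = 2 * (y p)^-1 * Vd true h p.
  rewrite exchange_big /= /Vd mulr_sumr; apply: eq_bigr => b _.
  rewrite -mulr_suml (qf_Li L_sym L_unit). exact: esym (mulrA _ _ _).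
by rewrite !mulrA [y p * 2]mulrC mulfK // yC_neq0.
Qed.

Lemma word_YY k p : H p ->
  \sum_a \sum_b Li a b * word_op k L [:: Raise (Some a); Lower (Some b)] f p =
  y p * Bil false true f p + 2 * Vd true f p.
Proof. by move=> Hp; rewrite /=; exact: LiYpYm. Qed.

Definition vvbar p : C := \sum_l v p l * Vd true (wz true (r l) f) p.

(** The doubly crossed contraction is an iterated mixed contraction: the inner
    sum over [b] and [c] is [LiYpYm] applied to Y_{-,d} f, and what remains is
    the sum over [a] and [d] of one further Y_+. *)
Lemma word_YYYY2 k p : H p ->
  \sum_a \sum_b \sum_c \sum_d Li b c * Li a d *
     word_op k L [:: Raise (Some a); Raise (Some b); Lower (Some c); Lower (Some d)] f p =
  y2 p * Bil false true (Bil false true f) p + 4 * y p * Vd true (Bil false true f) p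
  - iC * y p * Kbar p + 4 * vvbar p.
Proof.
move=> Hp; rewrite /=.
have sY d : smooth (Ym d f) := @smooth_letter R N 0 L (Lower (Some d)) _ sf.
have sYY a b : smooth (Ym a (Ym b f)) := @smooth_letter R N 0 L (Lower (Some a)) _ (sY b).
have sB d := smooth_wz true (r d) sf.
(* [LiYpYm] at [Ym d f] evaluates the inner contraction to -i E d. *)
pose E d q := y2 q * Bil false true (wz true (r d) f) q + 2 * (y q * Vd true (wz true (r d) f) q).
have sE1 d := smoothM zconst_y2.1 (smooth_Bil Li false true (sB d)).
have sE2 d := smoothM (@smooth_yC R N) (smooth_Vd true (sB d)).
have sE d : smooth (E d) := smoothD (sE1 d) (smoothM (@smooth_cst R N 2) (sE2 d)).
have inner d q : H q -> \sum_b \sum_c Li b c * Yp L b (Ym c (Ym d f)) q = - iC * E d q.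
  move=> Hq; rewrite (LiYpYm Hq (sY d)).
  have YE : eqH (Ym d f) (fun q => - iC * (y q * wz true (r d) f q)).
    by move=> q' _; rewrite YmE -mulNr -mulrA.
  have sy := smoothM (@smooth_yC R N) (sB d).
  rewrite (Bil_ext Li false true Hq YE) (Vd_ext true Hq YE) (BilZ Li _ _ _ Hq sy) (VdZ _ _ Hq sy).
  rewrite (Bil_zconst L _ _ (@zconst_y R N) Hq (sB d)) (Vd_zconst _ (@zconst_y R N) Hq (sB d)).
  rewrite /E /y2; move: (Bil _ _ _ _) (Vd _ _ _) => *; ring.
have outer a d : \sum_b \sum_c Li b c * Yp L a (Yp L b (Ym c (Ym d f))) p = - iC * Yp L a (E d) p.
  rewrite -(@letter_sum2 R N 0 L (Raise (Some a)) (fun b c => Li b c) (fun b c => Yp L b (Ym c (Ym d f))) p Hp); last first.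
    by move=> b c; exact: (smooth_Yp L b (sYY c d)).
  rewrite -(@letterZ R N 0 L (Raise (Some a)) (- iC) _ p Hp (sE d)).
  by apply: (Yp_ext _ _ Hp) => q Hq; exact: inner.
have S a : \sum_b \sum_c \sum_d Li b c * Li a d * Yp L a (Yp L b (Ym c (Ym d f))) p
   = \sum_d Li a d * (- iC * Yp L a (E d) p).
  under [RHS]eq_bigr => d _ do rewrite -outer mulr_sumr.
  rewrite [RHS]exchange_big; apply: eq_bigr => b _ /=.
  under [RHS]eq_bigr => d _ do rewrite mulr_sumr.
  rewrite [RHS]exchange_big; apply: eq_bigr => c _ /=; apply: eq_bigr => d _.
  by rewrite mulrA [Li a d * _]mulrC.
rewrite (eq_bigr _ (fun a _ => S a)).
have dE a d : wz false (r a) (E d) p = y2 p * Bil false true (wz false (r a) (wz true (r d) f)) p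
   + 2 * (y p * (Vd true (wz false (r a) (wz true (r d) f)) p - iC / 2 * wz true (r a) (wz true (r d) f) p)).
  rewrite (wzD _ _ Hp (sE1 d) (smoothM (@smooth_cst R N 2) (sE2 d))) (wzZ _ _ _ Hp (sE2 d)).
  rewrite (wz_zconst _ _ zconst_y2 Hp (smooth_Bil Li false true (sB d))).
  rewrite (wz_zconst _ _ (@zconst_y R N) Hp (smooth_Vd true (sB d))).
  by rewrite (wz_Bil _ _ _ _ _ Hp (sB d)) (wz_Vdr _ _ _ Hp (sB d)) mulNr.
have T a d : Li a d * (- iC * Yp L a (E d) p) =
    y2 p * (Li a d * Bil false true (wz false (r a) (wz true (r d) f)) p)
  + 2 * y p * (Li a d * Vd true (wz false (r a) (wz true (r d) f)) p)
  + (- (iC * y p)) * (Li a d * wz true (r a) (wz true (r d) f) p)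
  + qf L a p * Li a d * E d p.
  rewrite YpqE dE.
  move: (Bil _ _ _ _) (Vd _ _ _) (wz _ _ _ _) (qf _ _ _) (E d p) (Li a d) (y2 p) (y p) => a1 a2 a3 a4 a5 a6 yy yp.
  transitivity (- (iC * iC) * (yy * (a6 * a1) + 2 * yp * (a6 * a2) + - (iC * yp) * (a6 * a3) + a4 * a6 * a5)).
    by move: iC => I; field.
  by rewrite iC2 opprK mul1r.
have S4 (A1 A2 A3 A4 : 'I_N -> 'I_N -> C) (s t u : C) :
  \sum_a \sum_b (s * A1 a b + t * A2 a b + u * A3 a b + A4 a b) =
  s * (\sum_a \sum_b A1 a b) + t * (\sum_a \sum_b A2 a b) + u * (\sum_a \sum_b A3 a b)
   + \sum_a \sum_b A4 a b.
  rewrite !mulr_sumr -!big_split; apply: eq_bigr => a _ /=.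
  by rewrite !mulr_sumr -!big_split.
apply: etrans (eq_bigr _ (fun a _ => eq_bigr _ (fun d _ => T a d))) _.
apply: etrans (S4 _ _ _ _ _ _ _) _.
have T1 : \sum_a \sum_d Li a d * Bil false true (wz false (r a) (wz true (r d) f)) p = Bil false true (Bil false true f) p.
  apply: eq_bigr => a _; apply: eq_bigr => d _; apply: congr_mull.
  rewrite -(wz_Bil _ _ _ _ _ Hp (sB d)); apply: (wz_ext _ _ Hp) => q Hq.
  by rewrite (wz_Bil _ _ _ _ _ Hq sf).
have VB : Vd true (Bil false true f) p = \sum_a \sum_d Li a d * Vd true (wz false (r a) (wz true (r d) f)) p.
  have E2 j : v p j * wz true (r j) (Bil false true f) p = \sum_a \sum_b Li a b * (v p j * wz true (r j) (wz false (r a) (wz true (r b) f)) p).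
    rewrite (wz_Bil _ _ _ _ _ Hp sf) mulr_sumr; apply: eq_bigr => a _.
    rewrite mulr_sumr; apply: eq_bigr => b _; rewrite mulrCA; do 2!apply: congr_mull.
    rewrite (wz_swap true false _ _ Hp (sB b)).
    by apply: (wz_ext _ _ Hp) => q Hq; rewrite (wz_swap true true _ _ Hq sf).
  rewrite {1}/Vd (eq_bigr _ (fun j _ => E2 j)) exchange_big; apply: eq_bigr => a _ /=.
  by rewrite exchange_big; apply: eq_bigr => b _ /=; rewrite -mulr_sumr.
have T4 : \sum_a \sum_d qf L a p * Li a d * E d p = 2 * y p * Vd true (Bil false true f) p + 4 * vvbar p.
  rewrite exchange_big /=.
  have E3 d : \sum_a qf L a p * Li a d * E d p =
    2 * y p * (v p d * wz true (r d) (Bil false true f) p) + 4 * (v p d * Vd true (wz true (r d) f) p).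
    rewrite -mulr_suml (qf_Li L_sym L_unit) /E (wz_Bil _ _ _ _ _ Hp sf) /y2.
    have y0 := yC_neq0 Hp.
    by move: (Bil _ _ _ _) (Vd _ _ _) (v p d) (y p) y0 => a1 a2 a3 yp y0; field.
  by rewrite (eq_bigr _ (fun d _ => E3 d)) big_split /= -!mulr_sumr.
rewrite T1 -VB T4.
move: (Bil _ _ _ _) (Vd _ _ _) (vvbar p) => *; rewrite -[\sum_a \sum_b _]/(Kbar p); ring.
Qed.

End CasimirWordSums.

(** * The expression of the Casimir operator *)

Section CasimirFinal.
Local Opaque smooth.
Variables (R : realType) (N : nat).
Local Notation C := R[i].
Local Notation iC := (Complex (0 : R) 1).
Local Notation P := (pt R N).
Local Notation H := (@halfspace R N).
Local Notation y := (@yC R N).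
Local Notation r j := (rshift 1 j : 'I_(1 + N)).
Implicit Types (f : P -> C).

Lemma dzE : @dz R N = fun j => wz false (r j).
Proof. by apply/funext => j; rewrite /dz wirtE. Qed.
Lemma dzbE : @dzb R N = fun j => wz true (r j). Proof. by []. Qed.
Lemma dtauE : @dtau R N = wz false ord0. Proof. by rewrite /dtau wirtE. Qed.
Lemma dtaubE : @dtaub R N = wz true ord0. Proof. by []. Qed.
Lemma duE j f p : du j f p = wz false (r j) f p + wz true (r j) f p.
Proof. rewrite /du /wz; move: (pd _ _ _) (pd _ _ _) iC => a b I; by field. Qed.

Lemma bilE (A : 'M[C]_N) c d f : bil (fun j => wz c (r j)) A (fun j => wz d (r j)) f = biwz A c d f.
Proof. by []. Qed.
Lemma bil_du (A : 'M[C]_N) c f p : H p -> smooth f ->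
  bil (fun j => wz c (r j)) A (@du R N) f p = biwz A c false f p + biwz A c true f p.
Proof.
move=> Hp sf; rewrite /bil /biwz -big_split; apply: eq_bigr => a _ /=.
rewrite -big_split; apply: eq_bigr => b _ /=; rewrite -mulrDr; apply: congr_mull.
rewrite -(wzD _ _ Hp (smooth_wz false (r b) sf) (smooth_wz true (r b) sf)).
by apply: (wz_ext _ _ Hp) => q _; exact: duE.
Qed.

Local Opaque pd wz.

Variables (L : 'M[C]_N).
Hypotheses (L_sym : L^T = L) (L_unit : L \in unitmx).
Local Notation Li := (invmx (calL L)).

(** All the operators that occur on either side commute past each other into a
    fixed list of terms; once these are named, the two sides agree as rational
    functions of y, k, N and i.  The terms in (2 pi i L)[v] and v^T d_z cancel
    among the products of raising and lowering operators. *)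
Theorem casimirE k : opeq (casimir k L) (casimir_expression k L).
Proof.
move=> f sf p Hp.
have Lsy := @Li_symE R N L L_sym.
have sM c d := smooth_Bil Li c d sf.
pose K : C := k%:~R; pose n : C := N%:R.
(* The two sides as polynomials in their constituent sums, to rewrite all of them at once. *)
pose F (s1 s2 s3 s4 s5 s6 : C) := - 2 * s1 + iC * (s2 - s3) - 2^-1 * (s4 - s5)
  - 2^-1 * (2 * K - n - 3) * iC * s6.
have FE x1 x2 x3 x4 x5 x6 z1 z2 z3 z4 z5 z6 : x1 = z1 -> x2 = z2 -> x3 = z3 -> x4 = z4 ->
    x5 = z5 -> x6 = z6 -> F x1 x2 x3 x4 x5 x6 = F z1 z2 z3 z4 z5 z6.
  by do 6 move=> ->.
pose G (s1 s2 s3 s4 s5 s6 s7 s8 s9 t1 t2 : C) :=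
  - 2 * (4 * y p ^+ 2 * s1 - 2 * iC * (K - n / 2) * y p * s2)
  + 2 * y p ^+ 2 * (s3 + s4) - 8 * y p * s5 - 2^-1 * y p ^+ 2 * (s6 - s7)
  + 2 * y p * s8 - 2^-1 * (2 * K - n + 1) * iC * y p * s9 + 2 * t1 + (2 * K - n - 1) * iC * t2.
have GE x1 x2 x3 x4 x5 x6 x7 x8 x9 u1 u2 z1 z2 z3 z4 z5 z6 z7 z8 z9 w1 w2 :
    x1 = z1 -> x2 = z2 -> x3 = z3 -> x4 = z4 -> x5 = z5 -> x6 = z6 -> x7 = z7 ->
    x8 = z8 -> x9 = z9 -> u1 = w1 -> u2 = w2 ->
    G x1 x2 x3 x4 x5 x6 x7 x8 x9 u1 u2 = G z1 z2 z3 z4 z5 z6 z7 z8 z9 w1 w2.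
  by do 11 move=> ->.
have e1 : dtau (dtaub f) p = wz false ord0 (wz true ord0 f) p by rewrite dtauE.
have e2 : dtaub f p = wz true ord0 f p by [].
have e3 : dtaub (bil (@dz R N) Li (@dz R N) f) p = biwz Li false false (wz true ord0 f) p.
  by rewrite dzE bilE dtaubE (wz_Bil _ true ord0 false false Hp sf).
have e4 : dtau (bil (@dzb R N) Li (@dzb R N) f) p = wz false ord0 (Kbar L f) p.
  by rewrite dtauE.
have e5 : \sum_j (vv p j 0)%:C * dtau (dzb j f) p = Vd true (wz false ord0 f) p.
  by apply: eq_bigr => j _; rewrite dtauE dzbE (wz_swap false true _ _ Hp sf).
have e6 : bil (@dzb R N) Li (@dzb R N) (bil (@dz R N) Li (@dz R N) f) p = biwz Li false false (Kbar L f) p.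
  by rewrite dzE; exact: (Bil_Bil Li true true false false Hp sf).
have e7 : bil (@dzb R N) Li (@dz R N) (bil (@dzb R N) Li (@dz R N) f) p =
    biwz Li false true (biwz Li false true f) p.
  rewrite dzE; apply: etrans (Bil_sym Lsy true false Hp (sM true false)) _.
  by apply: (Bil_ext _ _ _ Hp) => q Hq; exact: (Bil_sym Lsy true false Hq sf).
have e8 : vdot (@dzb R N) (bil (@dz R N) Li (@du R N) f) p =
    Vd true (biwz Li false false f) p + Vd true (biwz Li false true f) p.
  have VE : eqH (bil (fun j => wz false (r j)) Li (@du R N) f)
      (fun q => biwz Li false false f q + biwz Li false true f q).
    by move=> q Hq; exact: bil_du.
  by rewrite dzE; exact: etrans (Vd_ext true Hp VE) (VdD true Hp (sM false false) (sM false true)).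
have e9 : bil (@dzb R N) Li (@du R N) f p = biwz Li false true f p + Kbar L f p.
  apply: etrans (bil_du Li true Hp sf) _.
  exact: (congr1 (+%R^~ _) (Bil_sym Lsy true false Hp sf)).
have e10 : \sum_a \sum_b (vv p a 0)%:C * (vv p b 0)%:C * dzb b (dzb a f) p = vvbar f p.
  apply: eq_bigr => a _; rewrite /Vd mulr_sumr; apply: eq_bigr => b _; exact: esym (mulrA _ _ _).
have e11 : vdot (@dzb R N) f p = Vd true f p by [].
apply: etrans (GE _ _ _ _ _ _ _ _ _ _ _ _ _ _ _ _ _ _ _ _ _ _ e1 e2 e3 e4 e5 e6 e7 e8 e9 e10 e11) _.
apply: etrans (esym (FE _ _ _ _ _ _ _ _ _ _ _ _ (word_XX L sf k Hp) (word_XYY L sf k Hp)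
  (word_YYX L_sym L_unit sf k Hp) (word_YYYY1 L_sym L_unit sf k Hp)
  (word_YYYY2 L_sym L_unit sf k Hp) (word_YY L_sym L_unit sf k Hp))).
rewrite /F /G /K /n {F FE G GE K n e1 e2 e3 e4 e5 e6 e7 e8 e9 e10 e11}.
have y0 := yC_neq0 Hp; rewrite /y2.
move: (wz false ord0 (Kbar L f) p) (wz false ord0 (wz true ord0 f) p) (wz true ord0 f p) => a1 a2 a3.
move: (biwz Li false false (wz true ord0 f) p) (Vd true (wz false ord0 f) p) (biwz Li false false (Kbar L f) p) => a4 a5 a6.
move: (biwz Li false true (biwz Li false true f) p) (Vd true (biwz Li false false f) p) (Vd true (biwz Li false true f) p) => a7 a8 a9.
move: (biwz Li false true f p) (Kbar L f p) (vvbar f p) (Vd true f p) (Vd false (wz true ord0 f) p) (vvmix f p) => b1 b2 b3 b4 b5 b6.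
move: (Vd false (Kbar L f) p) (Qv L p) (k%:~R : C) (N%:R : C) (y p) y0 => b7 b8 K n Y Y0.
have II (X Z W : C) : iC * ((- (2 * iC * X) - Z) - 2 * iC * W) = 2 * X + 2 * W - iC * Z.
  transitivity (- (iC * iC) * (2 * X + 2 * W) - iC * Z); first by move: iC => *; ring.
  by rewrite iC2; ring.
rewrite II; move: iC => I; field; exact: Y0.
Qed.

End CasimirFinal.

(** * Injectivity of expansions in base B *)

Section Digits.
Variables (B : nat).

Lemma digits_inj n (d d' : nat -> nat) :
  (forall k, d k < B)%N -> (forall k, d' k < B)%N ->
  (\sum_(k < n) d k * B ^ k = \sum_(k < n) d' k * B ^ k)%N ->
  forall k, (k < n)%N -> d k = d' k.
Proof.
elim: n d d' => [//|n IH] d d' dB d'B.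
have S (e : nat -> nat) : (\sum_(k < n.+1) e k * B ^ k = e 0 + B * \sum_(k < n) e k.+1 * B ^ k)%N.
  rewrite big_ord_recl expn0 muln1 big_distrr /=; congr (_ + _)%N.
  by apply: eq_bigr => i _; rewrite /bump /= add1n expnS mulnCA.
rewrite !S => E.
have E0 : d 0 = d' 0.
  have := congr1 (fun x => x %% B)%N E => /=.
  by rewrite (addnC (d 0)) (addnC (d' 0)) !(mulnC B) !modnMDl !modn_small.
have B0 : (0 < B)%N by apply: leq_ltn_trans (dB 0).
move: E => /eqP; rewrite E0 eqn_add2l eqn_pmul2l // => /eqP E [//|k] kn.
exact: (IH (fun k => d k.+1) (fun k => d' k.+1) (fun k => dB k.+1) (fun k => d'B k.+1) E).
Qed.

Lemma weighted_sum_inj (I : finType) (rank : I -> nat) (m m' : I -> nat) :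
  injective rank -> (forall i, m i < B)%N -> (forall i, m' i < B)%N ->
  (\sum_i m i * B ^ rank i = \sum_i m' i * B ^ rank i)%N -> m =1 m'.
Proof.
move=> ri mB m'B E i0.
pose d (m : I -> nat) k := (\sum_(i | rank i == k) m i)%N.
have B0 : (0 < B)%N by apply: leq_ltn_trans (mB i0).
have dr m0 i : d m0 (rank i) = m0 i.
  by rewrite /d (big_pred1 i) // => j; rewrite (inj_eq ri).
have dB m0 : (forall i, m0 i < B)%N -> forall k, (d m0 k < B)%N.
  move=> m0B k; case: (pickP (fun i => rank i == k)) => [i /eqP <-|no].
    by rewrite dr.
  by rewrite /d big_pred0.
pose n := (\max_i rank i).+1.
have rn i : (rank i < n)%N by rewrite ltnS leq_bigmax.
have S m0 : (\sum_i m0 i * B ^ rank i = \sum_(k < n) d m0 k * B ^ k)%N.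
  rewrite (partition_big (fun i => Ordinal (rn i)) xpredT) //=.
  apply: eq_bigr => k _; rewrite /d big_distrl /=.
  rewrite (eq_bigl (fun i => rank i == k)) => [|i]; last by rewrite -val_eqE.
  by apply: eq_bigr => i /eqP ->.
rewrite !S in E; have := digits_inj (dB m mB) (dB m' m'B) E (rn i0).
by rewrite !dr.
Qed.

End Digits.

(** * Words acting on exponential test functions *)

Section TestFunctions.
Local Opaque pd wz smooth.
Variables (R : realType) (N : nat).
Local Notation C := R[i].
Local Notation iC := (Complex (0 : R) 1).
Local Notation P := (pt R N).
Local Notation H := (@halfspace R N).
Local Notation ix := 'I_(1 + N).
Local Notation y := (@yC R N).
Local Notation v := (@vC R N).
Local Notation r j := (rshift 1 j : 'I_(1 + N)).

(** Families of functions that are polynomial of degree less than [n] in the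
    parameter, with smooth coefficients.  The exponents need not be distinct,
    which makes sums and products immediate. *)
Definition Pol (n : nat) (F : C -> P -> C) : Prop :=
  exists (I : finType) (c : I -> P -> C) (e : I -> nat),
   [/\ (forall i, smooth (c i)), (forall i, e i < n)%N &
    forall z p, H p -> F z p = \sum_i c i p * z ^+ e i].

Lemma Pol_ext n F G : Pol n F -> (forall z p, H p -> G z p = F z p) -> Pol n G.
Proof.
move=> [I [c [e [sc en EF]]]] FG; exists I, c, e; split=> // z p Hp.
by rewrite FG // EF.
Qed.

Lemma PolW n m F : (n <= m)%N -> Pol n F -> Pol m F.
Proof.
move=> nm [I [c [e [sc en EF]]]]; exists I, c, e; split=> // i.
exact: leq_trans (en i) nm.
Qed.

Lemma Pol_mono n e (c : P -> C) : smooth c -> (e < n)%N -> Pol n (fun z p => c p * z ^+ e).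
Proof.
move=> sc en; exists unit, (fun _ => c), (fun _ => e); split=> // z p _.
by rewrite (big_pred1 tt) // => -[].
Qed.

Lemma PolD n F G : Pol n F -> Pol n G -> Pol n (fun z p => F z p + G z p).
Proof.
move=> [I [c [e [sc en EF]]]] [J [d [h [sd hn EG]]]].
exists (I + J)%type, (fun x => match x with inl i => c i | inr j => d j end),
  (fun x => match x with inl i => e i | inr j => h j end); split; try by case.
by move=> z p Hp; rewrite big_sumType /= EF // EG.
Qed.

Lemma PolM n m F G : Pol n F -> Pol m G -> Pol (n + m).-1 (fun z p => F z p * G z p).
Proof.
move=> [I [c [e [sc en EF]]]] [J [d [h [sd hn EG]]]].
exists (I * J)%type, (fun x p => c x.1 p * d x.2 p), (fun x => e x.1 + h x.2)%N; split.
- by move=> x; exact: smoothM (sc _) (sd _).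
- move=> x; have := en x.1; have := hn x.2.
  by case: n en => [|n] en //; case: m hn => [|m] hn //; rewrite addSn addnS /= !ltnS => a b; rewrite leq_add.
move=> z p Hp; rewrite EF // EG // mulr_suml.
rewrite -(pair_bigA _ (fun i j => c i p * d j p * z ^+ (e i + h j))) /=.
apply: eq_bigr => i _; rewrite mulr_sumr; apply: eq_bigr => j _.
by rewrite exprD mulrACA.
Qed.

Lemma Pol_sum n (J : finType) (F : J -> C -> P -> C) :
  (forall j, Pol n (F j)) -> Pol n (fun z p => \sum_j F j z p).
Proof.
move=> PF; have Q (s : seq J) : Pol n (fun z p => \sum_(j <- s) F j z p).
  elim: s => [|j s IH].
    exists void, (fun _ _ => 0), (fun _ => 0%N); split=> [[]|[]|z p _].
    by rewrite big_nil big1 // => -[].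
  by apply: Pol_ext (PolD (PF j) IH) _ => z p _; rewrite big_cons.
exact: Q.
Qed.

(** Degree exactly [n] in the parameter, at every point of the half space. *)
Definition Lead (n : nat) (F : C -> P -> C) : Prop :=
  exists (c : P -> C) (G : C -> P -> C),
  [/\ smooth c, (forall p, H p -> c p != 0), Pol n G &
      forall z p, H p -> F z p = c p * z ^+ n + G z p].

Lemma Lead_Pol n F : Lead n F -> Pol n.+1 F.
Proof.
move=> [c [G [sc _ PG EF]]]; apply: Pol_ext EF.
by apply: PolD; [exact: Pol_mono | exact: PolW PG].
Qed.

Lemma LeadM n m F G : Lead n F -> Lead m G -> Lead (n + m) (fun z p => F z p * G z p).
Proof.
move=> LF LG; have PF := Lead_Pol LF; have PG := Lead_Pol LG.
move: LF LG => [c [F' [sc c0 PF' EF]]] [d [G' [sd d0 PG' EG]]].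
exists (fun p => c p * d p), (fun z p => F z p * G' z p + F' z p * (d p * z ^+ m)).
split.
- exact: smoothM.
- by move=> p Hp; rewrite mulf_neq0 ?c0 ?d0.
- apply: PolD.
    by have := PolM PF PG'; rewrite addSn.
  have := PolM PF' (Pol_mono sd (ltnSn m)); by rewrite addnS.
by move=> z p Hp; rewrite EG // mulrDr EF // exprD; ring.
Qed.

Lemma LeadDl n m F G : Lead n F -> Pol m G -> (m <= n)%N -> Lead n (fun z p => F z p + G z p).
Proof.
move=> [c [F' [sc c0 PF' EF]]] PG mn; exists c, (fun z p => F' z p + G z p); split=> //.
  by apply: PolD PF' _; exact: PolW PG.
by move=> z p Hp; rewrite EF // addrA.
Qed.

(** The derivation part of a letter: being of first order, a letter is
    the sum of a derivation and of the multiplication by its value on 1. *)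
Definition lsymb k L a (u : P -> C) p : C :=
  letter_op k L a u p - letter_op k L a (fun=> 1) p * u p.

Lemma smooth_lsymb k L a u : smooth u -> smooth (lsymb k L a u).
Proof.
move=> su; have s1 := @smooth_letter R N k L a _ (@smooth_cst R N 1).
have := smoothD (smooth_letter k L a su) (smoothM (@smooth_cst R N (-1)) (smoothM s1 su)).
by apply: smooth_ext => p _; rewrite mulN1r.
Qed.

Lemma letterM k L a u f p : H p -> smooth u -> smooth f ->
  letter_op k L a (fun q => u q * f q) p = lsymb k L a u p * f p + u p * letter_op k L a f p.
Proof.
move=> Hp su sf; have E b i := wzM b i Hp su sf.
have EV c : Vd c (fun q => u q * f q) p = Vd c u p * f p + u p * Vd c f p.
  rewrite /Vd mulr_suml mulr_sumr -big_split; apply: eq_bigr => j _ /=; rewrite E.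
  move: (wz _ _ _ _) (wz _ _ _ _) => *; ring.
have EV1 c : Vd c (fun=> 1) p = 0 by rewrite /Vd big1 // => j _; rewrite wz_cst mulr0.
rewrite /lsymb; case: a => [[j|]|[j|]]; rewrite /letter_op.
- rewrite !YpE (E false) wz_cst.
  move: (wz _ _ u _) (wz _ _ f _) (\sum_l _) => *; ring.
- rewrite !XpE !VdE (E false) wz_cst (EV false) (EV1 false).
  move: (wz _ _ u _) (wz _ _ f _) (Vd _ u _) (Vd _ f _) (\sum_x _) => *; ring.
- rewrite !YmE (E true) wz_cst; move: (wz _ _ u _) (wz _ _ f _) => *; ring.
- rewrite !XmE !VdE (E true) wz_cst (EV true) (EV1 true).
  move: (wz _ _ u _) (wz _ _ f _) (Vd _ u _) (Vd _ f _) => *; ring.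
Qed.

Lemma lsymb_Pol k L a n F : Pol n F -> Pol n (fun z => lsymb k L a (F z)).
Proof.
move=> [I [c [e [sc en EF]]]].
exists I, (fun i => lsymb k L a (c i)), e; split=> //.
  by move=> i; exact: smooth_lsymb.
move=> z p Hp; rewrite /lsymb.
have EF' : eqH (F z) (fun q => \sum_i z ^+ e i * c i q).
  by move=> q Hq; rewrite EF //; apply: eq_bigr => i _; rewrite mulrC.
rewrite (letter_ext k L a Hp EF') (letter_sum k L a _ (fun i => z ^+ e i) Hp sc) EF'  //.
rewrite mulr_sumr -sumrB; apply: eq_bigr => i _.
move: (letter_op _ _ _ _ _) (letter_op _ _ _ _ _) (z ^+ _) => *; ring.
Qed.

Variable B : nat.
Hypothesis B1 : (1 < B)%N.

(** The variables are ranked with all antiholomorphic ones above the holomorphic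
    ones, and the modular variable last in each group.  X_+ and X_- also
    differentiate in the z_j; giving the modular variable the larger exponent
    makes its derivative the leading term. *)
Definition wrank (b : bool) (i : ix) : nat := ((b : nat) * N.+1 + (if i == ord0 then N else i.-1))%N.
Definition wexp b i : nat := (B ^ wrank b i)%N.

Lemma wrank_r b j : wrank b (r j) = (b * N.+1 + j)%N. Proof. by []. Qed.
Lemma wrank_0 b : wrank b ord0 = (b * N.+1 + N)%N. Proof. by []. Qed.

Lemma wexp_lt b j : (wexp b (r j) < wexp b ord0)%N.
Proof. by rewrite /wexp ltn_exp2l // wrank_r wrank_0 ltn_add2l. Qed.
Lemma wexp_gt0 b i : (0 < wexp b i)%N.
Proof. by rewrite expn_gt0 (ltnW B1). Qed.

(** The exponent is linear, with coefficients powers of one parameter, so that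
    the degree in the parameter records which derivatives have been applied. *)
Definition phi (z : C) (p : P) : C :=
  \sum_i (z ^+ wexp false i * zc i p + z ^+ wexp true i * (zc i p)^*%C).
Definition ftest z p : C := cexp (phi z p).

Lemma smooth_phi z : smooth (phi z).
Proof.
apply: smooth_sum => i; have sz := @smooth_zc R N i.
exact: (smoothD (smoothM (@smooth_cst R N _) sz) (smoothM (@smooth_cst R N _) (smooth_conj sz))).
Qed.
Lemma smooth_ftest z : smooth (ftest z). Proof. exact: (smooth_cexp (smooth_phi z)). Qed.

Lemma wz_phi z b i p : H p -> wz b i (phi z) p = z ^+ wexp b i.
Proof.
move=> Hp; have sz j := @smooth_zc R N j; have scz j := smooth_conj (sz j).
have sc c := @smooth_cst R N c.
have s1 j := smoothD (smoothM (sc (z ^+ wexp false j)) (sz j)) (smoothM (sc (z ^+ wexp true j)) (scz j)).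
rewrite (wz_sum b i (index_enum ix) Hp s1).
have E j : wz b i (fun q => z ^+ wexp false j * zc j q + z ^+ wexp true j * (zc j q)^*%C) p =
   (i == j)%:R * z ^+ wexp b i.
  rewrite (wzD _ _ Hp (smoothM (sc _) (sz j)) (smoothM (sc _) (scz j))).
  rewrite (wzZ _ _ _ Hp (sz j)) (wzZ _ _ _ Hp (scz j)) (wz_conj _ _ Hp (sz j)) !wz_zc // conjc_nat.
  case: eqVneq => [->|_]; last by rewrite !andbF !mulr0 mul0r addr0.
  by case: b; rewrite !andbT /= mulr0 mulr1 ?addr0 ?add0r mul1r.
rewrite (eq_bigr _ (fun j _ => E j)) (bigD1 i isT) big1 /=.
  by rewrite eqxx mul1r addr0.
by move=> j ji; rewrite eq_sym (negPf ji) mul0r.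
Qed.

Lemma wz_ftest z b i p : H p -> wz b i (ftest z) p = z ^+ wexp b i * ftest z p.
Proof. by move=> Hp; rewrite (wz_cexp _ _ Hp (smooth_phi z)) wz_phi // mulrC. Qed.

Definition lexp (a : letter N) : nat :=
  match a with
  | Raise None => wexp false ord0 | Raise (Some j) => wexp false (r j)
  | Lower None => wexp true ord0 | Lower (Some j) => wexp true (r j)
  end.

Lemma lexp_gt0 a : (0 < lexp a)%N.
Proof. by case: a => [[j|]|[j|]]; exact: wexp_gt0. Qed.

(** The coefficient of the dominant derivative of each letter, namely i or 2i
    for the raising operators and -iy or -2iy^2 for the lowering ones, vanishes
    nowhere on the half space. *)
Lemma letter_ftest k L a : exists2 s, Lead (lexp a) s &
  forall z p, H p -> letter_op k L a (ftest z) p = s z p * ftest z p.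
Proof.
have sc c := @smooth_cst R N c; have sy := @smooth_yC R N; have siy := @smooth_iy R N.
have sv j := @smooth_vC R N j.
have i0 := @iC_neq0 R.
have tw : 2 != 0 :> C by rewrite pnatr_eq0.
case: a => [[j|]|[j|]]; rewrite /letter_op /lexp.
- exists (fun z p => iC * z ^+ wexp false (r j) + 2 * iC * (y p)^-1 * (\sum_l calL L j l * v p l) * z ^+ 0).
    exists (fun=> iC), (fun z p => 2 * iC * (y p)^-1 * (\sum_l calL L j l * v p l) * z ^+ 0); split=> //.
    apply: Pol_mono; last exact: wexp_gt0.
    exact: (smoothM (smoothM (sc _) siy) (smooth_lin L j)).
  move=> z p Hp; rewrite YpE wz_ftest // expr0.
  move: (\sum_l _) (z ^+ _) (ftest z p) ((y p)^-1) iC => *; ring.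
- pose G z p := \sum_j (2 * iC * (y p)^-1 * v p j) * z ^+ wexp false (r j)
     + (2 * iC * ((y p)^-1 * (y p)^-1 * Qv L p) + k%:~R * (y p)^-1) * z ^+ 0.
  exists (fun z p => 2 * iC * z ^+ wexp false ord0 + G z p).
    exists (fun=> 2 * iC), G; split=> //; first by move=> *; rewrite mulf_neq0.
    apply: PolD.
      apply: Pol_sum => j; apply: Pol_mono; last exact: wexp_lt.
      exact: (smoothM (smoothM (sc _) siy) (sv j)).
    apply: Pol_mono; last exact: wexp_gt0.
    have sQ := @smooth_Qv R N L.
    exact: (smoothD (smoothM (sc _) (smoothM (smoothM siy siy) sQ)) (smoothM (sc _) siy)).
  move=> z p Hp; rewrite XpE wz_ftest // /G expr0 mulr1.
  have -> : \sum_j v p j * wz false (r j) (ftest z) p = (\sum_j v p j * z ^+ wexp false (r j)) * ftest z p.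
    by rewrite mulr_suml; apply: eq_bigr => j _; rewrite wz_ftest // mulrA.
  have -> : \sum_j 2 * iC * (y p)^-1 * v p j * z ^+ wexp false (r j) = 2 * iC * (y p)^-1 * \sum_j v p j * z ^+ wexp false (r j).
    by rewrite mulr_sumr; apply: eq_bigr => j _; rewrite !mulrA.
  rewrite -[\sum_x \sum_y _]/(Qv L p) -exprVn expr2.
  move: (\sum_j _) (Qv L p) (z ^+ _) (ftest z p) ((y p)^-1) iC => *; ring.
- exists (fun z p => - (iC * y p) * z ^+ wexp true (r j)); last first.
    by move=> z p Hp; rewrite YmE wz_ftest // mulrA.
  exists (fun p => -1 * (iC * y p)), (fun z p => 0 * z ^+ 0); split.
  + exact: (smoothM (sc _) (smoothM (sc _) sy)).
  + by move=> p Hp; rewrite mulN1r oppr_eq0 mulf_neq0 ?yC_neq0.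
  + by apply: (Pol_mono (sc 0)); exact: wexp_gt0.
  + by move=> z p _; rewrite mul0r addr0 mulN1r.
- exists (fun z p => - (2 * iC * y p * y p) * z ^+ wexp true ord0 +
      \sum_j - (2 * iC * y p * v p j) * z ^+ wexp true (r j)); last first.
    move=> z p Hp; rewrite XmE wz_ftest //.
    have -> : \sum_j v p j * wz true (r j) (ftest z) p = (\sum_j v p j * z ^+ wexp true (r j)) * ftest z p.
      by rewrite mulr_suml; apply: eq_bigr => j _; rewrite wz_ftest // mulrA.
    have -> : \sum_j - (2 * iC * y p * v p j) * z ^+ wexp true (r j) = - (2 * iC * y p) * \sum_j v p j * z ^+ wexp true (r j).
      by rewrite mulr_sumr; apply: eq_bigr => j _; rewrite -mulNr -mulrA.
    move: (\sum_j _) => *; ring.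
  exists (fun p => -1 * (2 * iC * y p * y p)), (fun z p => \sum_j - (2 * iC * y p * v p j) * z ^+ wexp true (r j)); split.
  + exact: (smoothM (sc _) (smoothM (smoothM (sc _) sy) sy)).
  + by move=> p Hp; rewrite mulN1r oppr_eq0 !mulf_neq0 ?yC_neq0.
  + apply: Pol_sum => j; have PM := Pol_mono (smoothM (sc (-1)) (smoothM (smoothM (sc (2 * iC)) sy) (sv j))) (wexp_lt true j).
    by apply: Pol_ext PM _ => z p _; rewrite mulN1r.
  + by move=> z p _; rewrite mulN1r.
Qed.

Definition word_exp (w : seq (letter N)) : nat := (\sum_(a <- w) lexp a)%N.

(** A further letter either differentiates the exponential, which multiplies by
    a polynomial of exact degree [lexp a], or falls on the polynomial factor
    already produced, which does not raise its degree.  Hence degrees add up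
    along the word. *)
Lemma word_ftest k L w : exists2 F, Lead (word_exp w) F &
  forall z p, H p -> word_op k L w (ftest z) p = F z p * ftest z p.
Proof.
elim: w => [|a w [F LF EF]].
  exists (fun _ _ => 1); last by move=> z p _; rewrite mul1r.
  rewrite /word_exp big_nil; exists (fun=> 1), (fun _ _ => 0); split.
  - exact: smooth_cst.
  - by move=> p _; exact: oner_neq0.
  - exists void, (fun _ _ => 0), (fun _ => 0%N); split=> [[]|[]|z p _].
    by rewrite big1 // => -[].
  - by move=> z p _; rewrite expr0 mulr1 addr0.
have [s Ls Es] := letter_ftest (k + word_wt w) L a.
have PF := Lead_Pol LF.
have sF z : smooth (F z).
  have [I [c [e [sc _ E]]]] := PF.
  have sS := smooth_sum (index_enum I) (fun i => smoothM (sc i) (@smooth_cst R N (z ^+ e i))).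
  by apply: (smooth_ext _ sS) => p Hp; rewrite E.
exists (fun z p => F z p * s z p + lsymb (k + word_wt w) L a (F z) p).
  have -> : word_exp (a :: w) = (word_exp w + lexp a)%N by rewrite /word_exp big_cons addnC.
  apply: (LeadDl (LeadM LF Ls) (lsymb_Pol _ _ _ PF)).
  by rewrite -addn1 leq_add2l lexp_gt0.
move=> z p Hp /=.
rewrite (letter_ext _ _ _ Hp (EF z)) (letterM _ _ _ Hp (sF z) (smooth_ftest z)) Es //.
move: (lsymb _ _ _ _ _) => *; ring.
Qed.

End TestFunctions.

(** * Normal words and multi-indices *)

Section ExpoWords.
Variables (I : finType) (r : nat).

Lemma sum_expo_word (m : expo I r) (F : I -> nat) :
  (\sum_(a <- expo_word m) F a = \sum_i m i * F i)%N.
Proof.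
rewrite /expo_word big_flatten /= big_map big_enum /=; apply: eq_bigr => i _.
by rewrite big_nseq iter_addn_0 mulnC.
Qed.

Lemma size_expo_word (m : expo I r) : size (expo_word m) = expo_deg m.
Proof.
rewrite -sum1_size sum_expo_word; apply: eq_bigr => i _; exact: muln1.
Qed.

Lemma count_expo_word (m : expo I r) x : count_mem x (expo_word m) = m x.
Proof.
rewrite -sum1_count big_mkcond /= sum_expo_word (bigD1 x) //= eqxx muln1.
rewrite big1 ?addn0 // => i /negPf ix; by rewrite ix muln0.
Qed.

(** The multi-index of a word; [inord] is harmless for words of length at most
    [r]. *)
Definition word_content (w : seq I) : expo I r := [ffun x => inord (count_mem x w)].

Lemma perm_content w : (size w <= r)%N -> perm_eq w (expo_word (word_content w)).
Proof.
move=> wr; apply/allP => x _ /=; rewrite count_expo_word ffunE inordK //.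
by rewrite ltnS (leq_trans (count_size _ _)).
Qed.

Lemma deg_content w : (size w <= r)%N -> expo_deg (word_content w) = size w.
Proof. by move=> wr; rewrite -size_expo_word -(perm_size (perm_content wr)). Qed.

End ExpoWords.

(** * Linear independence of normally ordered words at a point *)

Section Freeness.
Local Opaque pd wz smooth.
Variables (R : realType) (N r : nat).
Local Notation C := R[i].
Local Notation P := (pt R N).
Local Notation H := (@halfspace R N).
Local Notation B := r.+2.

Lemma cexp_neq0 (z : C) : cexp z != 0.
Proof.
rewrite /cexp mulf_neq0 //; first by rewrite (fmorph_eq0 (real_complex R)) gt_eqF // expR_gt0.
rewrite eq_complex /=; apply/negP => /andP[/eqP c0 /eqP s0].
by have := cos2Dsin2 (complex.Im z); rewrite c0 s0 expr0n addr0 => /esym/eqP; rewrite oner_eq0.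
Qed.

(** The exponent of B in the degree contributed by a letter; the left summand is
    for raising, the right one for lowering operators. *)
Definition genrank (x : gen N + gen N) : nat :=
  match x with
  | inl None => wrank false (ord0 : 'I_(1 + N)) | inl (Some j) => wrank false (rshift 1 j : 'I_(1 + N))
  | inr None => wrank true (ord0 : 'I_(1 + N)) | inr (Some j) => wrank true (rshift 1 j : 'I_(1 + N))
  end.

Lemma genrank_inj : injective genrank.
Proof.
have lt (j : 'I_N) := ltn_ord j.
move=> [[i|]|[i|]] [[j|]|[j|]] /=; rewrite ?wrank_0 ?wrank_r ?mul0n ?mul1n ?add0n //.
all: try (have := lt i); try (have := lt j); move=> *; try lia.
  by do 2 congr (_ _); apply: val_inj => /=; lia.
by do 2 congr (_ _); apply: val_inj => /=; lia.
Qed.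

Lemma word_exp_nexpo (m : nexpo N r) : word_exp B (nexpo_word m) =
  (\sum_(x : gen N + gen N) (match x with inl g => m.1 g | inr g => m.2 g end : nat) * B ^ genrank x)%N.
Proof.
rewrite /word_exp /nexpo_word big_cat !big_map !sum_expo_word big_sumType /=.
by congr (_ + _)%N; apply: eq_bigr => -[j|] _.
Qed.

(** The degree of a normal word has the multiplicities of its letters as digits
    in base r + 2. *)
Lemma word_exp_inj (m m' : nexpo N r) : word_exp B (nexpo_word m) = word_exp B (nexpo_word m') -> m = m'.
Proof.
rewrite !word_exp_nexpo => /(weighted_sum_inj genrank_inj) E.
have lt (z : 'I_r.+1) : (z < B)%N by rewrite ltnS ltnW.
have {}E := E (fun x => match x with inl g => lt _ | inr g => lt _ end)
              (fun x => match x with inl g => lt _ | inr g => lt _ end).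
case: m m' E => m1 m2 [m1' m2'] E; congr (_, _); apply/ffunP => g; apply: val_inj.
  exact: (E (inl g)).
exact: (E (inr g)).
Qed.

Lemma Lead_poly n F (p : P) : H p -> @Lead R N n F ->
  exists2 q : {poly C}, size q = n.+1 & forall z, F z p = q.[z].
Proof.
move=> Hp [c [G [_ c0 [I [d [e [_ en EG]]]] EF]]].
pose g := \sum_i d i p *: 'X^(e i) : {poly C}.
have sg : (size g <= n)%N.
  apply: (leq_trans (size_sum _ _ _)); apply/bigmax_leqP => i _.
  by apply: (leq_trans (size_scale_leq _ _)); rewrite size_polyXn.
exists (c p *: 'X^n + g) => [|z].
  rewrite size_polyDl size_scale ?c0 // size_polyXn //.
by rewrite EF // EG // hornerE !hornerE; congr (_ + _); rewrite horner_sum; apply: eq_bigr => i _; rewrite !hornerE.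
Qed.

Lemma poly_all_roots (q : {poly C}) : (forall z, q.[z] = 0) -> q = 0.
Proof.
move=> q0; apply: (@roots_geq_poly_eq0 _ q [seq (n%:R : C) | n <- iota 0 (size q)]).
- by apply/allP => x _; apply/rootP.
- by rewrite map_inj_uniq ?iota_uniq // => a b /eqP; rewrite eqr_nat => /eqP.
- by rewrite size_map size_iota.
Qed.

(** Applied to the test functions, normal words become polynomials in the
    parameter with pairwise different degrees; so a vanishing combination has no
    word of maximal degree with nonzero coefficient. *)
Theorem words_free k (L : 'M[C]_N) (p : P) (c : nexpo N r -> C) : H p ->
  (forall f, smooth f -> \sum_m c m * word_op k L (nexpo_word m) f p = 0) ->
  forall m, c m = 0.
Proof.
move=> Hp c0; have B1 : (1 < B)%N by [].
have /boolp.choice [q qP] : forall m : nexpo N r, exists q : {poly C},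
    size q = (word_exp B (nexpo_word m)).+1 /\
    forall z, word_op k L (nexpo_word m) (ftest B z) p = q.[z] * ftest B z p.
  move=> m; have [F LF EF] := word_ftest B1 k L (nexpo_word m).
  have [q sq qF] := Lead_poly Hp LF.
  by exists q; split=> // z; rewrite EF // qF.
have Q0 : \sum_m c m *: q m = 0.
  apply: poly_all_roots => z; apply: (mulIf (cexp_neq0 (phi B z p))).
  rewrite mul0r -[RHS](c0 _ (smooth_ftest B z)) horner_sum mulr_suml.
  by apply: eq_bigr => m _; rewrite hornerZ (qP m).2 -[LHS]mulrA.
apply: contrapT => /existsNP[m1 /eqP m1P].
have [m /= cm mmax] := @arg_maxnP _ m1 (fun m => c m != 0) (fun m => word_exp B (nexpo_word m)) m1P.
have := congr1 (fun q : {poly C} => q`_(word_exp B (nexpo_word m))) Q0.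
rewrite coef0 coef_sum (bigD1 m) //= big1 ?addr0.
  rewrite coefZ => /eqP; rewrite mulf_eq0 (negPf cm) /=.
  have := lead_coef_eq0 (q m); rewrite lead_coefE (qP m).1 /= => ->.
  by rewrite -size_poly_eq0 (qP m).1.
move=> m' m'm; rewrite coefZ; have [->|cm'] := eqVneq (c m') 0; first by rewrite mul0r.
rewrite nth_default ?mulr0 // (qP m').1 ltn_neqAle mmax // andbT.
by apply: contra m'm => /eqP/word_exp_inj ->.
Qed.

End Freeness.

(** * Words as differential operators *)

Section Expansion.
Local Opaque pd wz smooth.
Variables (R : realType) (N : nat).
Local Notation C := R[i].
Local Notation iC := (Complex (0 : R) 1).
Local Notation P := (pt R N).
Local Notation H := (@halfspace R N).
Local Notation dir := (dir N).
Local Notation rr j := (rshift 1 j : 'I_(1 + N)).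

(** Differential operators written with words of partial derivatives in
    arbitrary order and with repetitions, a form that is stable under all the
    operations; [Dop_normal] then sorts the words. *)
Definition Dop (n : nat) (T : op R N) : Prop :=
  exists (I : finType) (c : I -> P -> C) (w : I -> seq dir),
  [/\ forall i, smooth (c i), forall i, (size (w i) <= n)%N &
      forall f p, smooth f -> H p -> T f p = \sum_i c i p * iter_pd (w i) f p].

Lemma smooth_iter w (f : P -> C) : smooth f -> smooth (iter_pd w f).
Proof. by move=> sf; elim: w => [|d w IH]; [exact: sf | exact: (smooth_pd d IH)]. Qed.

Lemma Dop_ext n T U : Dop n T -> (forall f p, smooth f -> H p -> U f p = T f p) -> Dop n U.
Proof.
move=> [I [c [w [sc sw E]]]] TU; exists I, c, w; split=> // f p sf Hp.
by rewrite TU // E.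
Qed.

Lemma DopW n m T : (n <= m)%N -> Dop n T -> Dop m T.
Proof.
move=> nm [I [c [w [sc sw E]]]]; exists I, c, w; split=> // i.
exact: leq_trans (sw i) nm.
Qed.

Lemma Dop_id : Dop 0 (fun f => f).
Proof.
exists unit, (fun _ _ => 1), (fun _ => [::]); split=> //; first by move=> _; exact: smooth_cst.
by move=> f p _ _; rewrite (big_pred1 tt) ?mul1r // => -[].
Qed.

Lemma DopD n T U : Dop n T -> Dop n U -> Dop n (fun f p => T f p + U f p).
Proof.
move=> [I [c [w [sc sw E]]]] [J [d [x [sd sx E']]]].
exists (I + J)%type, (fun i => match i with inl i => c i | inr j => d j end),
  (fun i => match i with inl i => w i | inr j => x j end); split; try by case.
by move=> f p sf Hp; rewrite big_sumType /= E // E'.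
Qed.

Lemma Dop_mul n u T : smooth u -> Dop n T -> Dop n (fun f p => u p * T f p).
Proof.
move=> su [I [c [w [sc sw E]]]]; exists I, (fun i p => u p * c i p), w; split; [|exact: sw|].
  by move=> i; exact: (smoothM su (sc i)).
by move=> f p sf Hp; rewrite E // mulr_sumr; apply: eq_bigr => i _; rewrite mulrA.
Qed.

Lemma Dop_sum n (J : finType) (T : J -> op R N) : (forall j, Dop n (T j)) ->
  Dop n (fun f p => \sum_j T j f p).
Proof.
move=> DT; have Q (s : seq J) : Dop n (fun f p => \sum_(j <- s) T j f p).
  elim: s => [|j s IH].
    exists void, (fun _ _ => 0), (fun _ => [::]); split=> [[]|[]|f p _ _].
    by rewrite big_nil big1 // => -[].
  by apply: Dop_ext (DopD (DT j) IH) _ => f p _ _; rewrite big_cons.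
exact: Q.
Qed.

Lemma Dop_pd n d T : Dop n T -> Dop n.+1 (fun f => pd d (T f)).
Proof.
move=> [I [c [w [sc sw E]]]].
have D1 : Dop n.+1 (fun f p => \sum_i pd d (c i) p * iter_pd (w i) f p).
  exists I, (fun i => pd d (c i)), w; split; [|by move=> i; exact: leqW|by []].
  by move=> i; exact: (smooth_pd d (sc i)).
have D2 : Dop n.+1 (fun f p => \sum_i c i p * iter_pd (d :: w i) f p).
  by exists I, c, (fun i => d :: w i); split.
apply: Dop_ext (DopD D1 D2) _ => f p sf Hp.
have si i := smooth_iter (w i) sf.
have sci i := smoothM (sc i) (si i).
rewrite (pd_ext d Hp (fun q Hq => E f q sf Hq)) (pd_sum d (index_enum I) Hp sci).
rewrite -big_split; apply: eq_bigr => i _ /=.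
exact: (pdM d Hp (sc i) (si i)).
Qed.

Lemma Dop_wz n b i T : Dop n T -> Dop n.+1 (fun f => wz b i (T f)).
Proof.
move=> DT; have sc c := @smooth_cst R N c.
have D := Dop_mul (sc 2^-1) (DopD (Dop_pd (i, 0) DT) (Dop_mul (sc (if b then iC else - iC)) (Dop_pd (i, 1) DT))).
by apply: (Dop_ext D) => f p _ _.
Qed.

Lemma Dop_letter n k L a T : Dop n T -> Dop n.+1 (fun f => letter_op k L a (T f)).
Proof.
move=> DT; have sc c := @smooth_cst R N c; have sy := @smooth_yC R N; have siy := @smooth_iy R N.
have sv j := @smooth_vC R N j; have DT' := DopW (leqnSn n) DT.
have Dw b i := Dop_wz b i DT.
have DV b := Dop_sum (fun j => Dop_mul (sv j) (Dw b (rr j))).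
case: a => [[j|]|[j|]]; rewrite /letter_op.
- have D := DopD (Dop_mul (sc iC) (Dw false (rr j)))
    (Dop_mul (smoothM (smoothM (sc (2 * iC)) siy) (smooth_lin L j)) DT').
  by apply: (Dop_ext D) => f p _ _; exact: YpE.
- have sQ := @smooth_Qv R N L.
  have D := DopD (Dop_mul (sc (2 * iC)) (DopD (DopD (Dw false ord0) (Dop_mul siy (DV false)))
    (Dop_mul (smoothM (smoothM siy siy) sQ) DT'))) (Dop_mul (smoothM (sc k%:~R) siy) DT').
  by apply: (Dop_ext D) => f p _ _; rewrite XpE -exprVn expr2.
- have D := Dop_mul (smoothM (sc (-1)) (smoothM (sc iC) sy)) (Dw true (rr j)).
  by apply: (Dop_ext D) => f p _ _; rewrite YmE mulN1r.
- have D := Dop_mul (smoothM (sc (-1)) (smoothM (sc (2 * iC)) sy))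
    (DopD (Dop_mul sy (Dw true ord0)) (DV true)).
  by apply: (Dop_ext D) => f p _ _; rewrite XmE mulN1r.
Qed.

Lemma Dop_word k L w : Dop (size w) (word_op k L w).
Proof. by elim: w => [|a w IH]; [exact: Dop_id | exact: Dop_letter]. Qed.

Lemma iter_pd_ext w (f h : P -> C) : eqH f h -> eqH (iter_pd w f) (iter_pd w h).
Proof.
move=> fh; elim: w => [|d w IH] p Hp; first exact: fh.
exact: (pd_ext d Hp IH).
Qed.

Lemma iter_pd_move w1 d w2 (f : P -> C) : smooth f ->
  eqH (iter_pd (w1 ++ d :: w2) f) (iter_pd (d :: w1 ++ w2) f).
Proof.
move=> sf; elim: w1 => [|d1 w1 IH] p Hp //=.
rewrite -[LHS]/(pd d1 (iter_pd (w1 ++ d :: w2) f) p) (pd_ext d1 Hp IH).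
exact: (pd_swap d1 d Hp (smooth_iter (w1 ++ w2) sf)).
Qed.

Lemma iter_pd_perm w w' (f : P -> C) : smooth f -> perm_eq w w' ->
  eqH (iter_pd w f) (iter_pd w' f).
Proof.
move=> sf; elim: w w' => [|d w IH] w'.
  by rewrite perm_sym => /perm_nilP ->.
move=> ww' p Hp; have dw' : d \in w' by rewrite -(perm_mem ww') mem_head.
case/splitPr: dw' ww' => w1 w2; rewrite perm_sym -cat1s perm_catCA cat1s perm_cons perm_sym => ww'.
by rewrite (iter_pd_move _ _ _ sf Hp); exact: (pd_ext d Hp (IH _ ww')).
Qed.

(** Partial derivatives of a smooth function commute, so only the multi-index of
    a word matters. *)
Lemma Dop_normal n r T p : Dop n T -> (n <= r)%N -> H p ->
  exists a : expo dir r -> C, forall f, smooth f ->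
    T f p = \sum_(m | (expo_deg m <= r)%N) a m * iter_pd (expo_word m) f p.
Proof.
move=> [I [c [w [sc sw E]]]] nr Hp.
have wr i : (size (w i) <= r)%N := leq_trans (sw i) nr.
exists (fun m => \sum_(i | word_content r (w i) == m) c i p) => f sf; rewrite E //.
rewrite (partition_big (fun i => word_content r (w i)) (fun m => (expo_deg m <= r)%N)) /=; last first.
  by move=> i _; rewrite deg_content.
apply: eq_bigr => m _; rewrite mulr_suml; apply: eq_bigr => i /eqP <-.
by rewrite (iter_pd_perm sf (perm_content (wr i)) Hp).
Qed.

End Expansion.

(** * Normal words are as many as partial derivatives *)

Section Counting.
Variables (N r : nat).

Definition gen_ix (g : gen N) : 'I_(1 + N) := if g is Some j then rshift 1 j else ord0.
Definition ix_gen (i : 'I_(1 + N)) : gen N :=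
  match fintype.split i with inl _ => None | inr j => Some j end.

Lemma gen_ixK : cancel gen_ix ix_gen.
Proof.
case=> [j|]; rewrite /ix_gen /gen_ix; first by rewrite split_rshift1.
by case: splitP => // j.
Qed.

Lemma ix_genK : cancel ix_gen gen_ix.
Proof.
move=> i; case: (split1P i) => [|j]; last by rewrite /ix_gen split_rshift1.
by rewrite -[ord0]/(gen_ix None) gen_ixK.
Qed.

Definition expo_nexpo (m : expo (dir N) r) : nexpo N r :=
  ([ffun g => m (gen_ix g, 0)], [ffun g => m (gen_ix g, 1)]).
Definition nexpo_expo (m : nexpo N r) : expo (dir N) r :=
  [ffun d => if d.2 == 0 then m.1 (ix_gen d.1) else m.2 (ix_gen d.1)].

Lemma expo_nexpoK : cancel expo_nexpo nexpo_expo.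
Proof.
move=> m; apply/ffunP => -[i k]; rewrite !ffunE /=.
by case: (ord2P k) => ->; rewrite /= ix_genK.
Qed.

Lemma nexpo_expoK : cancel nexpo_expo expo_nexpo.
Proof.
move=> [m1 m2]; congr (_, _); apply/ffunP => g; rewrite !ffunE /= gen_ixK //.
Qed.

Lemma deg_expo_nexpo m : nexpo_deg (expo_nexpo m) = expo_deg m.
Proof.
rewrite /nexpo_deg /expo_deg -big_split /=.
have -> : (\sum_i m i = \sum_(d : 'I_(1 + N) * 'I_2) m (d.1, d.2))%N.
  by apply: eq_bigr => -[].
rewrite -(pair_bigA _ (fun i k => (m (i, k) : nat))) /=.
rewrite (reindex gen_ix) /=; last by exists ix_gen => ? _; [exact: gen_ixK | exact: ix_genK].
apply: eq_bigr => g _; rewrite !ffunE big_ord_recl big_ord1.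
by congr (m (_, _) + m (_, _))%N; exact: val_inj.
Qed.

(** Raising generators match the real coordinates of the 1 + N complex
    variables, lowering generators the imaginary ones. *)
Lemma card_nexpo_deg :
  #|[set m : nexpo N r | (nexpo_deg m <= r)%N]%SET| = #|[set m : expo (dir N) r | (expo_deg m <= r)%N]%SET|.
Proof.
have bij : bijective expo_nexpo by exists nexpo_expo; [exact: expo_nexpoK | exact: nexpo_expoK].
rewrite -(on_card_preimset (onW_bij _ bij)); apply: eq_card => m.
by rewrite !inE deg_expo_nexpo.
Qed.

End Counting.

(** * Normally ordered words span all operators at a point *)

Section Existence.
Local Opaque pd wz smooth.
Variables (R : realType) (N r : nat).
Local Notation C := R[i].
Local Notation H := (@halfspace R N).

(** At [p] the normal words of length at most [r] are combinations of the partial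
    derivatives of order at most [r]; the coefficient matrix is square by
    [card_nexpo_deg] and its rows are independent by [words_free], so it is
    invertible. *)
Theorem exists_words k (L : 'M[C]_N) (T : op R N) p : H p -> diffop r T ->
  exists2 c : {ffun nexpo N r -> C}, forall m, (r < nexpo_deg m)%N -> c m = 0 &
    forall f, smooth f -> T f p = \sum_m c m * word_op k L (nexpo_word m) f p.
Proof.
move=> Hp [a [_ aT]].
pose S := [set m : nexpo N r | (nexpo_deg m <= r)%N]%SET.
pose S' := [set m : expo (dir N) r | (expo_deg m <= r)%N]%SET.
have /boolp.choice [A AP] : forall m : nexpo N r, exists A : expo (dir N) r -> C, m \in S ->
    forall f, smooth f -> word_op k L (nexpo_word m) f p =
      \sum_(m' in S') A m' * iter_pd (expo_word m') f p.
  move=> m; have [mS|mS] := boolP (m \in S); last by exists (fun=> 0).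
  have sm : (size (nexpo_word m) <= r)%N.
    by move: mS; rewrite inE /nexpo_word size_cat !size_map !size_expo_word.
  have [A AP] := Dop_normal (Dop_word k L (nexpo_word m)) sm Hp.
  exists A => _ f sf; rewrite AP //; apply: eq_bigl => m'; by rewrite inE.
pose M : 'M[C]_(#|S|, #|S'|) := \matrix_(i, j) A (enum_val i) (enum_val j).
have ME (u : 'rV[C]_#|S|) f : smooth f ->
    \sum_i u 0 i * word_op k L (nexpo_word (enum_val i)) f p =
    \sum_j (u *m M) 0 j * iter_pd (expo_word (enum_val j)) f p.
  move=> sf; under [RHS]eq_bigr => j _ do rewrite mxE mulr_suml.
  rewrite exchange_big; apply: eq_bigr => i _ /=.
  rewrite AP ?enum_valP // big_enum_val /= mulr_sumr; apply: eq_bigr => j _.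
  by rewrite mxE mulrA.
pose ext (u : 'rV[C]_#|S|) (m : nexpo N r) : C :=
  \sum_(i | enum_val i == m) u 0 i.
have extE u f : \sum_m ext u m * word_op k L (nexpo_word m) f p =
    \sum_i u 0 i * word_op k L (nexpo_word (enum_val i)) f p.
  rewrite [RHS](partition_big (fun i => enum_val i) xpredT) //=.
  by apply: eq_bigr => m _; rewrite mulr_suml; apply: eq_bigr => i /eqP ->.
have extK u i : ext u (enum_val i) = u 0 i.
  by rewrite /ext (big_pred1 i) // => j; rewrite (inj_eq enum_val_inj).
have Mfree : row_free M.
  apply: inj_row_free => u uM; apply/rowP => i; rewrite mxE -extK.
  apply: (@words_free R N r k L p (ext u) Hp) => f sf; rewrite extE ME // uM big1 // => j _.
  by rewrite mxE mul0r.
have Mfull : row_full M by rewrite /row_full (eqP Mfree) card_nexpo_deg.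
pose av : 'rV[C]_#|S'| := \row_j a (enum_val j) p.
have /submxP[u uE] : (av <= M)%MS by apply: submx_full.
exists [ffun m => ext u m] => [m rm|f sf].
  rewrite ffunE /ext big1 // => i /eqP im; move: (enum_valP i).
  by rewrite im inE leqNgt rm.
under eq_bigr => m _ do rewrite ffunE.
rewrite extE ME // -uE aT // [LHS](eq_bigl (mem S')) => [|m]; last by rewrite /= inE.
by rewrite big_enum_val; apply: eq_bigr => j _; rewrite mxE.
Qed.

End Existence.

(** * Transitivity, rotations and the center *)

Section Elements.
Local Opaque pd wz smooth.
Variables (R : realType) (N : nat).
Local Notation C := R[i].
Local Notation iC := (Complex (0 : R) 1).
Local Notation P := (pt R N).
Local Notation H := (@halfspace R N).
Local Notation re := (@complex.Re R).
Local Notation im := (@complex.Im R).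

Definition mx2 (a b c d : R) : 'M[R]_2 :=
  \matrix_(i, j) if i == 0 then (if j == 0 then a else b) else (if j == 0 then c else d).

Lemma det_mx2 a b c d : \det (mx2 a b c d) = a * d - b * c.
Proof.
rewrite (expand_det_row _ ord0) !big_ord_recl big_ord0 /cofactor !det_mx11 !mxE.
by rewrite /= !expr0 /bump /= expr1 addr0; ring.
Qed.

(** Any symmetric [S] yields an admissible central component by subtracting the
    correction term in [X]. *)
Lemma kappa_sym (X : 'M[R]_(N, 2)) (S : 'M[R]_N) : S^T = S ->
  let T := (S - 2^-1 *: (X *m @J2 R *m X^T)) + 2^-1 *: (X *m @J2 R *m X^T) in T^T = T.
Proof. by move=> SS /=; rewrite subrK. Qed.

Definition jacobi_elt a b c d (D : a * d - b * c = 1) (X : 'M[R]_(N, 2)) (S : 'M[R]_N) (SS : S^T = S) : jacobi R N :=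
  Jacobi (etrans (det_mx2 a b c d) D) (kappa_sym X SS).

Lemma zc_inj (p q : P) : (forall i, zc i p = zc i q) -> p = q.
Proof.
move=> E; apply/matrixP => i k; have := E i; rewrite /zc => -[E0 E1].
by case: (ord2P k) => ->.
Qed.

Definition base_pt : P := mkpt iC 0.

Lemma tau_base : tau base_pt = iC. Proof. exact: zc_mkpt0. Qed.
Lemma zv_base j : zv base_pt j 0 = 0.
Proof. by rewrite zv_zc zc_mkptr mxE. Qed.
Lemma base_H : H base_pt.
Proof.
have : yc base_pt = im (tau base_pt) by [].
by rewrite tau_base /halfspace /= => ->; exact: ltr01.
Qed.

(** With s the square root of y, the upper triangular matrix with rows
    (s, x/s), (0, 1/s) moves i to tau; since z = 0 at the base point, X is
    determined by the real and imaginary parts of the target z. *)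
Lemma act_transitive (p : P) : H p -> exists g : jacobi R N, act g base_pt = p.
Proof.
rewrite /halfspace /= => Hp; pose s := Num.sqrt (yc p).
have s0 : 0 < s by rewrite sqrtr_gt0.
have ss : s * s = yc p by rewrite -expr2 sqr_sqrtr // ltW.
have sn : s != 0 by rewrite gt_eqF.
have D : s * s^-1 - (re (tau p) / s) * 0 = 1 by rewrite mulr0 subr0 divff.
pose X : 'M[R]_(N, 2) := \matrix_(j, k) if k == 0 then p (rshift 1 j) 1 / s else p (rshift 1 j) 0 / s.
exists (jacobi_elt D X (trmx0 _ _ _)); set g := jacobi_elt _ _ _.
have B : bt g base_pt = s%:C.
  by rewrite btE /den /= !mxE /= mul0r add0r -fmorphV /= invrK.
have X0 j : jX g j 0 = p (rshift 1 j) 1 / s by rewrite /= mxE.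
have X1 j : jX g j 1 = p (rshift 1 j) 0 / s by rewrite /= mxE.
apply: zc_inj => i; case: (split1P i) => [|j].
  rewrite zc_act0 B tau_base /= !mxE /=; apply: complex_ext => /=.
    by field; exact: sn.
  by rewrite -[RHS]/(yc p) -ss; field; exact: sn.
rewrite zc_actr B /zt zv_base tau_base X0 X1 add0r; apply: complex_ext => /=; field; exact: sn.
Qed.

Lemma J2_zero : (0 : 'M[R]_(N, 2)) *m @J2 R *m (0 : 'M[R]_(N, 2))^T = 0.
Proof. by rewrite trmx0 mulmx0. Qed.

Lemma jk_elt0 a b c d (D : a * d - b * c = 1) (S : 'M[R]_N) (SS : S^T = S) : jk (jacobi_elt D 0 SS) = S.
Proof. by rewrite /= J2_zero scaler0 subr0. Qed.

Lemma cos_sin_det (t : R) : cos t * cos t - (- sin t) * sin t = 1.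
Proof. by rewrite mulNr opprK -!expr2 cos2Dsin2. Qed.

(** The rotations of SL_2 fix the base point, so covariance under them is a
    condition at that point alone, and distinguishes weights. *)
Definition rotation (t : R) : jacobi R N := jacobi_elt (cos_sin_det t) 0 (trmx0 _ _ _).

Lemma bt_rot t : bt (rotation t) base_pt = (cos t +i* sin t)^-1.
Proof.
rewrite btE /den tau_base /= !mxE /=; congr (_^-1).
by apply: complex_ext => /=; ring.
Qed.

Lemma zt_rot t j : zt (rotation t) j base_pt = 0.
Proof. by rewrite /zt zv_base /= !mxE !mulr0 !addr0. Qed.

Lemma act_rot t : act (rotation t) base_pt = base_pt.
Proof.
have b0 := bt_neq0 (rotation t) base_H.
apply: zc_inj => i; case: (split1P i) => [|j]; last first.
  by rewrite zc_actr zt_rot mulr0 -zv_zc zv_base.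
rewrite zc_act0 -zc_tau; apply: (mulIf (invr_neq0 b0)); rewrite mulfK // bt_rot invrK tau_base.
by rewrite /= !mxE /=; apply: complex_ext => /=; ring.
Qed.

Lemma alpha_rot L t : alpha L (rotation t) base_pt = 1.
Proof.
rewrite alphaE /alE big1 => [|x _].
  by apply: complex_ext; rewrite /cexp /= ?expR0 ?cos0 ?sin0; ring.
rewrite big1 // => z _; rewrite !zt_rot !zv_base /rotation jk_elt0 !mxE /=.
by move: (calL L x z) (bt _ _) (sin t)%:C => *; ring.
Qed.

Lemma jfac_rot L k t : jfac L (rotation t) k base_pt = (cos t +i* sin t) ^ (- k).
Proof. by rewrite /jfac alpha_rot mulr1 bt_rot exprz_inv. Qed.

Lemma unit_circle_pow (t : R) n : (cos t +i* sin t) ^+ n = cos (n%:R * t) +i* sin (n%:R * t).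
Proof.
elim: n => [|n IH]; first by rewrite expr0 mul0r cos0 sin0.
rewrite exprS IH -nat1r mulrDl mul1r cosD sinD; apply: complex_ext => /=; ring.
Qed.

(** Otherwise the power would be -1 at the angle pi / |d|. *)
Lemma unit_circle_pow_trivial (d : int) :
  (forall t : R, (cos t +i* sin t) ^ d = 1) -> d = 0.
Proof.
move=> E; have {}E t : (cos t +i* sin t) ^+ `|d| = 1 :> C.
  have := E t; case: d {E} => n //= E; rewrite NegzE in E.
  by apply: invr_inj; rewrite invr1.
apply/eqP; rewrite -absz_eq0; apply/negPn/negP => d0.
have n0 : (`|d|%:R : R) != 0 by rewrite pnatr_eq0.
have := E (pi / `|d|%:R); rewrite unit_circle_pow mulrC divfK // cospi sinpi => -[] /eqP.
by rewrite -subr_eq0 -opprD oppr_eq0 (_ : 1 + 1 = 2%:R) ?pnatr_eq0.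
Qed.

(** The elements (1, 0, S) act trivially on the half space and multiply functions
    by a character depending only on the index. *)
Definition central (S : 'M[R]_N) (SS : S^T = S) : jacobi R N :=
  @jacobi_elt 1 0 0 1 (etrans (congr2 (fun x z => x - z) (mulr1 1) (mulr0 0)) (subr0 1)) 0 S SS.

Lemma bt_ctr S SS p : bt (@central S SS) p = 1.
Proof. by rewrite btE /den /= !mxE /= mul0r add0r invr1. Qed.

Lemma zt_ctr S SS j p : zt (@central S SS) j p = zv p j 0.
Proof. by rewrite /zt /= !mxE !mulr0 !addr0. Qed.

Lemma act_ctr S SS p : act (@central S SS) p = p.
Proof.
apply: zc_inj => i; case: (split1P i) => [|j].
  by rewrite zc_act0 bt_ctr /= !mxE /= mul1r addr0 mulr1.
by rewrite zc_actr bt_ctr zt_ctr mul1r zv_zc.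
Qed.

Lemma jfac_ctr L k S SS p : jfac L (@central S SS) k p =
  cexp (\sum_x \sum_z calL L x z * (S z x)%:C).
Proof.
rewrite /jfac bt_ctr exp1rz mul1r alphaE /alE; congr cexp.
apply: eq_bigr => x _; apply: eq_bigr => z _; congr (_ * _).
rewrite /central jk_elt0 /= !mxE /=; ring.
Qed.

(** Moduli at t = 1 give the real part; if the imaginary parts differed, some
    real t would make the quotient of the two exponentials equal to -1. *)
Lemma cexp_real_inj (a b : C) : (forall t : R, cexp (t%:C * a) = cexp (t%:C * b)) -> a = b.
Proof.
have rE (t : R) (x : C) : re (t%:C * x) = t * re x by case: x => ? ? /=; ring.
have iE (t : R) (x : C) : im (t%:C * x) = t * im x by case: x => ? ? /=; ring.
have cr (x : C) : re (cexp x) = expR (re x) * cos (im x) by rewrite /cexp /=; ring.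
have ci (x : C) : im (cexp x) = expR (re x) * sin (im x) by rewrite /cexp /=; ring.
move=> E.
have Er t : expR (t * re a) * cos (t * im a) = expR (t * re b) * cos (t * im b).
  by rewrite -!rE -!iE -!cr E.
have Ei t : expR (t * re a) * sin (t * im a) = expR (t * re b) * sin (t * im b).
  by rewrite -!rE -!iE -!ci E.
have reE : re a = re b.
  have := congr2 (fun x z => x ^+ 2 + z ^+ 2) (Er 1) (Ei 1).
  rewrite !mul1r !exprMn -!mulrDr !cos2Dsin2 !mulr1 => /eqP.
  rewrite eqrXn2 ?expR_ge0 // => /eqP; exact: expR_inj.
have ce t : cos (t * im a) = cos (t * im b).
  by have := Er t; rewrite reE; apply: mulfI; rewrite gt_eqF // expR_gt0.
have se t : sin (t * im a) = sin (t * im b).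
  by have := Ei t; rewrite reE; apply: mulfI; rewrite gt_eqF // expR_gt0.
apply: complex_ext => //; apply/eqP; rewrite -subr_eq0; apply/negPn/negP => d0.
have : cos (pi / (im a - im b) * (im a - im b)) = 1.
  by rewrite [X in cos X]mulrBr cosB ce se -!expr2 cos2Dsin2.
rewrite divfK // cospi => /eqP.
by rewrite -subr_eq0 -opprD oppr_eq0 (_ : 1 + 1 = 2%:R) ?pnatr_eq0.
Qed.

End Elements.

(** * Covariant operators in normal form *)

Section Classification.
Local Opaque pd wz smooth.
Variables (R : realType) (N r : nat).
Local Notation C := R[i].
Local Notation P := (pt R N).
Local Notation H := (@halfspace R N).
Implicit Types (T : op R N) (L : 'M[C]_N).

Lemma diffop_ext T f h p : diffop r T -> H p -> smooth f -> eqH f h -> T f p = T h p.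
Proof.
move=> [a [_ aT]] Hp sf fh; have sh := smooth_ext fh sf.
by rewrite !aT //; apply: eq_bigr => m _; rewrite (iter_pd_ext _ fh Hp).
Qed.

Lemma iter_pdZ w z (f : P -> C) : smooth f ->
  eqH (iter_pd w (fun q => z * f q)) (fun q => z * iter_pd w f q).
Proof.
move=> sf; elim: w => [|d w IH] p Hp //.
rewrite -[LHS]/(pd d (iter_pd w (fun q => z * f q)) p) (pd_ext d Hp IH).
by rewrite (pdM d Hp (@smooth_cst R N z) (smooth_iter w sf)) pd_cst mul0r add0r.
Qed.

Lemma diffopZ T z f p : diffop r T -> H p -> smooth f -> T (fun q => z * f q) p = z * T f p.
Proof.
move=> [a [_ aT]] Hp sf; have szf := smoothM (@smooth_cst R N z) sf.
rewrite !aT // mulr_sumr; apply: eq_bigr => m _; rewrite (iter_pdZ _ _ sf Hp).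
exact: mulrCA.
Qed.

Lemma calL_inj : injective (@calL R N).
Proof.
apply: scalerI; rewrite !mulf_neq0 ?pnatr_eq0 ?iC_neq0 //.
by rewrite (fmorph_eq0 (real_complex R)) gt_eqF // pi_gt0.
Qed.

(** Where an operator does not vanish it must respect the central character, and
    the characters of the elements with S = t (E_ij + E_ji) determine the
    (i, j) entry of the index. *)
Lemma covariant_index_eq k k' L L' T f p : L^T = L -> L'^T = L' ->
  diffop r T -> covariant k L k' L' T -> smooth f -> H p -> T f p != 0 -> L = L'.
Proof.
move=> sL sL' dT cT sf Hp Tf0; apply: calL_inj; apply/matrixP => i j.
have sumE (A : 'M[C]_N) (t : R) : A^T = A ->
    \sum_x \sum_z A x z * ((t *: (delta_mx i j + delta_mx j i) : 'M[R]_N) z x)%:C = t%:C * (2 * A i j).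
  move=> sA; have E x z : A x z * ((t *: (delta_mx i j + delta_mx j i) : 'M[R]_N) z x)%:C =
    t%:C * ((z == i)%:R * ((x == j)%:R * A x z)) + t%:C * ((z == j)%:R * ((x == i)%:R * A x z)).
    have bR (b : bool) : (b%:R : R)%:C = b%:R :> C by case: b.
    rewrite !mxE rmorphM rmorphD /= !bR.
    by case: (z == i); case: (x == j); case: (z == j); case: (x == i); rewrite /=; ring.
  have pick (a b : 'I_N) : \sum_x \sum_z t%:C * ((z == a)%:R * ((x == b)%:R * A x z)) = t%:C * A b a.
    rewrite (bigD1 b) //= [X in _ + X]big1 ?addr0 => [|x /negPf xb]; last first.
      by apply: big1 => z _; rewrite xb mul0r !mulr0.
    rewrite (bigD1 a) //= [X in _ + X]big1 ?addr0 => [|z /negPf za]; last by rewrite za mul0r mulr0.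
    by rewrite !eqxx !mul1r.
  under eq_bigr => x _ do under eq_bigr => z _ do rewrite E.
  under eq_bigr => x _ do rewrite big_split /=.
  rewrite big_split /= !pick -{1}sA mxE; ring.
have key : 2 * calL L i j = 2 * calL L' i j.
  apply: cexp_real_inj => t.
  have SS : (t *: (delta_mx i j + delta_mx j i) : 'M[R]_N)^T = t *: (delta_mx i j + delta_mx j i).
    by rewrite linearZ linearD /= !trmx_delta addrC.
  have := cT (central SS) f sf p Hp; rewrite slashE jfac_ctr act_ctr (sumE _ _ (calL_sym sL')).
  have sE : eqH (slash k L (central SS) f) (fun q => cexp (t%:C * (2 * calL L i j)) * f q).
    by move=> q _; rewrite slashE jfac_ctr act_ctr (sumE _ _ (calL_sym sL)).
  rewrite (diffop_ext dT Hp (smooth_slash L (central SS) k sf) sE) diffopZ //.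
  exact: mulIf.
by apply: mulfI key; rewrite pnatr_eq0.
Qed.

Lemma normal_expression_unique k L T (c c' : {ffun nexpo N r -> C}) :
  normal_expression k L T c -> normal_expression k L T c' -> c = c'.
Proof.
move=> [_ E] [_ E']; apply/ffunP => m; apply/eqP; rewrite -subr_eq0; apply/eqP.
apply: (@words_free R N r k L (base_pt R N) (fun m => c m - c' m) (base_H R N)) => f sf.
have Z := etrans (esym (E f sf _ (base_H R N))) (E' f sf _ (base_H R N)).
apply: etrans (_ : _ = \sum_m c m * word_op k L (nexpo_word m) f (base_pt R N)
   - \sum_m c' m * word_op k L (nexpo_word m) f (base_pt R N)) _.
  by rewrite -sumrB; apply: eq_bigr => m' _; rewrite mulrBl.
by rewrite Z subrr.
Qed.

Lemma normal_sum_slash k L (sL : L^T = L) g (c : nexpo N r -> C) f p : H p -> smooth f ->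
  \sum_m c m * word_op k L (nexpo_word m) (slash k L g f) p =
  \sum_m c m * (jfac L g (k + word_wt (nexpo_word m)) p * word_op k L (nexpo_word m) f (act g p)).
Proof.
move=> Hp sf; apply: eq_bigr => m _.
by rewrite (word_slash g sL k (nexpo_word m) Hp sf) slashE.
Qed.

(** The expansion of [exists_words] at the base point; comparing it with its
    image under the rotations, independence of words forces each occurring
    word to have weight k' - k.  Each of these words is then covariant with the
    same weights as the operator, and transitivity carries the identity to every
    point. *)
Lemma covariant_normal_form k k' L T : L^T = L -> diffop r T -> covariant k L k' L T ->
  exists c : {ffun nexpo N r -> C}, normal_expression k L T c.
Proof.
move=> sL dT cT; have bH := base_H R N.
have [c c0 cE] := exists_words k L bH dT.
have sg g f : smooth f -> smooth (slash k L g f) := fun sf => smooth_slash L g k sf.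
have weight m : c m != 0 -> k + word_wt (nexpo_word m) = k'.
  move=> cm; apply/eqP; rewrite eq_sym -subr_eq0; apply/eqP.
  apply: (@unit_circle_pow_trivial R) => t.
  pose g := rotation N t; pose b : C := cos t +i* sin t.
  have b0 : b != 0 by have := bt_neq0 g bH; rewrite /g bt_rot invr_eq0.
  have Z : c m * (b ^ (- (k + word_wt (nexpo_word m))) - b ^ (- k')) = 0.
    apply: (@words_free R N r k L _ (fun m => c m * (b ^ (- (k + word_wt (nexpo_word m))) - b ^ (- k'))) bH) => f sf.
    have := cT g f sf _ bH; rewrite slashE (cE _ (sg g f sf)) normal_sum_slash //.
    rewrite /g act_rot jfac_rot cE // -/b => /eqP; rewrite -subr_eq0 mulr_sumr -sumrB => /eqP Z.
    apply: etrans _ Z; apply: eq_bigr => m' _; rewrite jfac_rot -/b.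
    by rewrite mulrBr mulrBl -!mulrA [_ * (c m' * _)]mulrCA.
  move/eqP: Z; rewrite mulf_eq0 (negPf cm) /= subr_eq0 => /eqP Z.
  by rewrite -/b expfzDr // Z -expfzDr // subrr.
exists c; split=> // f sf p Hp.
have [g gp] := act_transitive Hp.
have j0 : jfac L g k' (base_pt R N) != 0.
  rewrite /jfac mulf_neq0 //; last by rewrite alphaE cexp_neq0.
  by rewrite expfz_neq0 // bt_neq0.
apply: (mulfI j0); rewrite -gp.
have := cT g f sf _ bH; rewrite slashE => <-.
rewrite (cE _ (sg g f sf)) normal_sum_slash // mulr_sumr; apply: eq_bigr => m _.
have [->|cm] := eqVneq (c m) 0; first by rewrite !mul0r mulr0.
by rewrite (weight m cm) mulrCA.
Qed.

(** The zero operator is covariant between any two indices; a nonzero one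
    requires equal indices. *)
Theorem normal_form_exists k k' L L' T : L^T = L -> L'^T = L' ->
  diffop r T -> covariant k L k' L' T ->
  exists c : {ffun nexpo N r -> C}, normal_expression k L T c.
Proof.
move=> sL sL' dT cT.
have [T0|] := pselect (forall f, smooth f -> forall p, H p -> T f p = 0).
  exists [ffun=> 0]; split=> [m _|f sf p Hp]; first by rewrite ffunE.
  by rewrite T0 // big1 // => m _; rewrite ffunE mul0r.
move=> /existsNP[f /not_implyP[sf /existsNP[p /not_implyP[Hp /eqP Tf]]]].
have LL := covariant_index_eq sL sL' dT cT sf Hp Tf.
by apply: (covariant_normal_form sL dT (k' := k')); rewrite {2}LL.
Qed.

Lemma size_nexpo_word (m : nexpo N r) : size (nexpo_word m) = nexpo_deg m.
Proof. by rewrite /nexpo_word size_cat !size_map !size_expo_word. Qed.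

Lemma normal_expression_lincomb k L T (c : {ffun nexpo N r -> C}) : normal_expression k L T c ->
  exists s : seq (C * seq (letter N)), all (fun t => (size t.2 <= r)%N) s /\ opeq T (lincomb_words k L s).
Proof.
move=> [c0 cE].
exists [seq (c m, nexpo_word m) | m <- enum {: nexpo N r} & (nexpo_deg m <= r)%N]; split.
  by rewrite all_map; apply/allP => m; rewrite mem_filter /= size_nexpo_word => /andP[].
move=> f sf p Hp; rewrite cE // /lincomb_words big_map big_filter big_enum_cond /=.
rewrite [RHS]big_mkcond /=; apply: eq_bigr => m _.
by case: leqP => // mr; rewrite c0 // mul0r.
Qed.

End Classification.

Theorem proposition2p7 (R : realType) (N : nat) (hN : (1 <= N)%N) :
  (forall (k k' : int) (L L' : 'M[R[i]]_N),
     L^T = L -> L'^T = L' ->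
   forall (r : nat) (T : op R N),
     diffop r T -> covariant k L k' L' T ->
     (exists s : seq (R[i] * seq (letter N)),
        all (fun t => (size t.2 <= r)%N) s /\
        opeq T (lincomb_words k L s)) /\
     (exists! c : {ffun nexpo N r -> R[i]}, normal_expression k L T c)) /\
  (forall (k : int) (L : 'M[R[i]]_N),
     L^T = L -> L \in unitmx ->
     opeq (casimir k L) (casimir_expression k L)).
Proof.
split=> [k k' L L' sL sL' r T dT cT|k L sL uL]; last exact: casimirE.
have [c cP] := normal_form_exists sL sL' dT cT.
split; first exact: normal_expression_lincomb cP.
by exists c; split=> // c' c'P; exact: normal_expression_unique cP c'P.
Qed.
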